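(* Let $a\ge 0$, let $\zeta,\nu\in\mathbb{C}$ with $\Re\zeta\ge 0$, $\Re\nu\ge 0$, and suppose there are constants $C_\zeta>0$ and $h(\zeta,\nu)>0$ such that $$|\mu_1(x,\zeta+h\nu)-\mu_j(x,\zeta+h\nu)|\ge C_\zeta,\qquad j=2,\dots,5,\quad x\in[a,\infty),\quad 0<h\le h(\zeta,\nu).$$ Consider, with $h=1/\epsilon$, the system $$\theta'=\frac1h\left[\Phi_0(x,\zeta)+h\Phi_1(x,\nu)\right]\theta\quad\text{on }[a,\infty).$$ Then for all sufficiently small $h>0$ there exist a (locally integrable) function $\mu_1^\sharp(x,\zeta,\nu,h)$ with $$\mu_1^\sharp=\mu_1(x,\zeta+h\nu)+O(he^{-\beta x}),$$ a vector function $\rho(x,\zeta,\nu,h)=O(h)$ (uniformly in $x$), and an exact solution $\theta(x,\zeta,\nu,h)$ of the system such that for any $\delta_*<\beta$ there is a constant $C$ (independent of $x$ and $h$) with $$\left|\theta-e^{\frac1h\int_0^x\mu_1^\sharp(s,\zeta,\nu,h)\,ds}\left[T(x,\zeta)e_1+\rho(x,\zeta,\nu,h)\right]\right|\le C\,h\,e^{-\delta_*x}\left|e^{\frac1h\int_0^x\mu_1^\sharp(s,\zeta,\nu,h)\,ds}\right|\quad\text{on }[a,\infty),$$ where $e_1=(1,0,0,0,0)^t$.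
   Context: **Profile and thermodynamics.** $v,u,S,\lambda$ denote specific volume, $x$-velocity, entropy and reactant mass fraction. The pressure $p$, temperature $\Theta$, free energy increment $\Delta F$ and reaction rate $r$ are real-analytic functions of $(v,S,\lambda)$; put $\omega:=-r\,\Delta F/\Theta$ and $c_0^2:=-v^2p_v(v,S,\lambda)$ (sound speed $c_0>0$). The ZND equations for $(v,\mathbf u,S,\lambda)$ are $$v_t+\mathbf u\cdot\nabla v-v\nabla\cdot\mathbf u=0,\quad \mathbf u_t+\mathbf u\cdot\nabla\mathbf u+v\nabla p=0,\quad S_t+\mathbf u\cdot\nabla S=\omega,\quad \lambda_t+\mathbf u\cdot\nabla\lambda=r.$$ A steady strong detonation profile is a weak solution $w(x)=(v,u,0,0,S,\lambda)(x)$ depending only on $x$, with $u>0$, constant and supersonic ($u>c_0$) for $x<0$, with a jump (the von Neumann shock) at $x=0$ satisfying the Rankine–Hugoniot conditions, and, in the subsonic reaction zone $x>0$, a smooth solution of the steady equations, with limit $w(\infty)=\lim_{x\to\infty}w(x)$ a chemical equilibrium. Such a profile is fixed. All functions of $(v,S,\lambda)$ are evaluated along $w(x)$, $x\ge 0$, and $'=d/dx$. Put $m=u/v$ (constant in $x$), $\kappa=u/c_0$, $\eta=1-\kappa^2$. **Standing assumptions.** $w$ is real-analytic on $[0,\infty)$ (using one-sided values at $0$); there are constants with $0<C_1\le\kappa\le C_2<1$ and $0<C_1\le u\le C_2<1$ on $[0,\infty)$; there are $C,\beta>0$ with $|w(x)-w(\infty)|\le Ce^{-\beta x}$ (this $\beta$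 appears in the claim); and $r|_{\lambda=0}=0$, $r_\lambda<0$, $r_v|_{\lambda=0}=0$, $r_S|_{\lambda=0}=0$. **Matrices.** $$A_x=\begin{pmatrix}u&-v&0&0&0\\ vp_v&u&0&vp_S&vp_\lambda\\ 0&0&u&0&0\\ 0&0&0&u&0\\ 0&0&0&0&u\end{pmatrix},\quad A_y=\begin{pmatrix}0&0&-v&0&0\\ 0&0&0&0&0\\ vp_v&0&0&vp_S&vp_\lambda\\ 0&0&0&0&0\\ 0&0&0&0&0\end{pmatrix},$$ $$B=\begin{pmatrix}-u'&v'&0&0&0\\ p'-v(c_0^2/v^2)'&u'&0&v(p_S)'&v(p_\lambda)'\\ 0&0&0&0&0\\ -\omega_v&S'&0&-\omega_S&-\omega_\lambda\\ -r_v&\lambda'&0&-r_S&-r_\lambda\end{pmatrix},$$ $$\Phi_0(x,\zeta)=\{A_x^{-1}(\zeta I+iA_y)\}^t,\qquad \Phi_1(x,\nu)=\{A_x^{-1}\nu\}^t+\{A_x^{-1}B\}^t.$$ **Eigenvalues and eigenvectors of $\Phi_0$.** Let $s(x,\zeta)=\sqrt{\zeta^2+c_0^2\eta}$, the branch that is positive for $\zeta>0$, as a function of $\zeta$ having branch cut $[-ic_0\sqrt\eta,ic_0\sqrt\eta]$; for $\Re\zeta=0$: $s=|s|$ if $\zeta^2+c_0^2\eta>0$, and $s=\pm i|s|$ if $\zeta^2+c_0^2\eta<0$ and $\zeta=\pm i|\zeta|$. Then $$\mu_1=-\kappa(\kappa\zeta+s)/(\eta u),\quad \mu_2=-\kappa(\kappa\zeta-s)/(\eta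 u),\quad \mu_3=\mu_4=\mu_5=\zeta/u,$$ with corresponding eigenvectors the columns of $$T(x,\zeta)=\begin{pmatrix}\frac{ms}{\kappa u}&-\frac{ms}{\kappa u}&-\frac{im}{1-\eta}&0&0\\ \frac{\zeta}{u}&\frac{\zeta}{u}&i&0&0\\ -i&-i&\frac{\zeta}{u}&0&0\\ \frac{-\kappa p_Ss}{um}&\frac{\kappa p_Ss}{um}&0&1&0\\ \frac{-\kappa p_\lambda s}{um}&\frac{\kappa p_\lambda s}{um}&0&0&1\end{pmatrix}.$$ *)

(* Defs.v *)
From HB Require Import structures.
From mathcomp Require Import all_boot all_order all_algebra.
From mathcomp Require Import complex.
From mathcomp Require Import all_classical all_reals all_analysis.

Set Implicit Arguments.
Unset Strict Implicit.
Unset Printing Implicit Defensive.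

Import Order.TTheory GRing.Theory Num.Theory.
Import numFieldNormedType.Exports.

Local Open Scope classical_set_scope.
Local Open Scope ring_scope.
Local Open Scope complex_scope.

(* (v, S, lambda) *)
Notation state R := (R * R * R)%type.

Definition vol_of {R : realType} (q : state R) : R := q.1.1.
Definition ent_of {R : realType} (q : state R) : R := q.1.2.
Definition lam_of {R : realType} (q : state R) : R := q.2.

Definition d_v {R : realType} (f : state R -> R) (q : state R) : R :=
  derive1 (fun t : R => f (t, ent_of q, lam_of q)) (vol_of q).
Definition d_S {R : realType} (f : state R -> R) (q : state R) : R :=
  derive1 (fun t : R => f (vol_of q, t, lam_of q)) (ent_of q).
Definition d_lam {R : realType} (f : state R -> R) (q : state R) : R :=
  derive1 (fun t : R => f (vol_of q, ent_of q, t)) (lam_of q).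

Definition monomial3 {R : realType} (c : nat -> nat -> nat -> R)
    (q : state R) (i j k : nat) : R :=
  c i j k * vol_of q ^+ i * ent_of q ^+ j * lam_of q ^+ k.

Definition analytic_on {R : realType} (D : set (state R)) (f : state R -> R) :
    Prop :=
  forall q0, D q0 -> exists (c : nat -> nat -> nat -> R) (rho : R), 0 < rho /\
    forall q, `|vol_of q - vol_of q0| < rho -> `|ent_of q - ent_of q0| < rho ->
              `|lam_of q - lam_of q0| < rho ->
      cvgn (fun N : nat => \sum_(i < N) \sum_(j < N) \sum_(k < N)
              `|monomial3 c (q - q0) i j k|) /\
      (fun N : nat => \sum_(i < N) \sum_(j < N) \sum_(k < N)
              monomial3 c (q - q0) i j k) @ \oo --> f q.

(* [dom] is the region of state space on which the thermodynamic functions are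
   given.  The internal energy enters only through the Rankine-Hugoniot
   conditions; [free_energy] is the free energy increment Delta F. *)
Record thermo (R : realType) := Thermo {
  dom : set (state R);
  pressure : state R -> R;
  temperature : state R -> R;
  free_energy : state R -> R;
  energy : state R -> R;
  rate : state R -> R }.

Definition omega {R : realType} (th : thermo R) (q : state R) : R :=
  - (rate th q * free_energy th q / temperature th q).

(* [Num.sqrt] vanishes on nonpositive numbers, so [0 < c0 th q] expresses that
   the sound speed is defined and positive, i.e. p_v < 0. *)
Definition c0 {R : realType} (th : thermo R) (q : state R) : R :=
  Num.sqrt (- (vol_of q ^+ 2 * d_v (pressure th) q)).

(* Closure of the domain under (v,S,lambda) |-> (v,S,t lambda) makes the
   conditions on lambda = 0 below meaningful for the whole domain (it says that
   a reaction may run to completion).  The last clause is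
   de = -p dv + Theta dS + Delta F dlambda, which is what makes the entropy
   equation with source omega equivalent to conservation of energy. *)
Definition thermodynamics {R : realType} (th : thermo R) : Prop :=
  [/\ open (dom th) /\ (forall q, dom th q -> 0 < vol_of q),
      (forall v S l t : R, 0 <= t <= 1 ->
         dom th (v, S, l) -> dom th (v, S, t * l)),
      [/\ analytic_on (dom th) (pressure th),
          analytic_on (dom th) (temperature th),
          analytic_on (dom th) (free_energy th),
          analytic_on (dom th) (energy th) &
          analytic_on (dom th) (rate th)],
      (forall q, dom th q -> 0 < temperature th q) &
      (forall q, dom th q ->
         [/\ d_v (energy th) q = - pressure th q,
             d_S (energy th) q = temperature th q &
             d_lam (energy th) q = free_energy th q])].

Definition rate_assumptions {R : realType} (th : thermo R) : Prop :=
  [/\ forall q, dom th q -> lam_of q = 0 -> rate th q = 0,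
      forall q, dom th q -> d_lam (rate th) q < 0,
      forall q, dom th q -> lam_of q = 0 -> d_v (rate th) q = 0 &
      forall q, dom th q -> lam_of q = 0 -> d_S (rate th) q = 0].

(* The profile is (v, u, 0, 0, S, lambda), with (v, S, lambda) stored in [st]
   and u in [vel].  At x = 0 the functions take their values at 0+, on the
   burning side of the shock. *)
Record profile (R : realType) := Profile {
  st : R -> state R;
  vel : R -> R;
  st_up : state R;
  vel_up : R;
  st_oo : state R;
  vel_oo : R }.

Definition vol {R : realType} (w : profile R) (x : R) : R := vol_of (st w x).
Definition ent {R : realType} (w : profile R) (x : R) : R := ent_of (st w x).
Definition lam {R : realType} (w : profile R) (x : R) : R := lam_of (st w x).

(* Continuity of the fluxes of mass, momentum, energy and reactant across a
   stationary shock, with zero tangential velocity. *)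
Definition rankine_hugoniot {R : realType} (th : thermo R)
    (q1 : state R) (u1 : R) (q2 : state R) (u2 : R) : Prop :=
  let p := pressure th in
  let e := energy th in
  [/\ u1 / vol_of q1 = u2 / vol_of q2,
      u1 ^+ 2 / vol_of q1 + p q1 = u2 ^+ 2 / vol_of q2 + p q2,
      u1 / vol_of q1 * (e q1 + u1 ^+ 2 / 2) + u1 * p q1 =
      u2 / vol_of q2 * (e q2 + u2 ^+ 2 / 2) + u2 * p q2 &
      u1 * lam_of q1 / vol_of q1 = u2 * lam_of q2 / vol_of q2].

Definition smooth_at {R : realType} (f : R -> R) (x : R) : Prop :=
  forall n : nat, derivable (derive1n n f) x 1.

(* The two transverse momentum equations hold trivially, since the transverse
   velocity vanishes and p depends on x only. *)
Definition steady_ZND_at {R : realType} (th : thermo R) (w : profile R) (x : R) :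
    Prop :=
  [/\ vel w x * derive1 (vol w) x - vol w x * derive1 (vel w) x = 0,
      vel w x * derive1 (vel w) x
        + vol w x * derive1 (fun y => pressure th (st w y)) x = 0,
      vel w x * derive1 (ent w) x = omega th (st w x) &
      vel w x * derive1 (lam w) x = rate th (st w x)].

(* The reaction source is not imposed in the quiescent constant state x < 0:
   there the material is unburnt and, as always in the ZND model, inert. *)
Definition strong_detonation {R : realType} (th : thermo R) (w : profile R) :
    Prop :=
  [/\ [/\ dom th (st_up w),
          forall x, x < 0 -> st w x = st_up w /\ vel w x = vel_up w &
          0 < c0 th (st_up w) < vel_up w],
      rankine_hugoniot th (st_up w) (vel_up w) (st w 0) (vel w 0),
      (st w x @[x --> 0^'+] --> st w 0) /\ (vel w x @[x --> 0^'+] --> vel w 0),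
      (forall x, 0 <= x -> dom th (st w x)) /\
      (forall x, 0 < x ->
         [/\ 0 < vel w x < c0 th (st w x),
             [/\ smooth_at (vol w) x, smooth_at (vel w) x,
                 smooth_at (ent w) x & smooth_at (lam w) x] &
             steady_ZND_at th w x]) &
      [/\ st w x @[x --> +oo] --> st_oo w, vel w x @[x --> +oo] --> vel_oo w,
          dom th (st_oo w) & rate th (st_oo w) = 0]].

Definition kappa {R : realType} (th : thermo R) (w : profile R) (x : R) : R :=
  vel w x / c0 th (st w x).
Definition eta {R : realType} (th : thermo R) (w : profile R) (x : R) : R :=
  1 - kappa th w x ^+ 2.
Definition mflux {R : realType} (w : profile R) (x : R) : R := vel w x / vol w x.

Definition analytic_half_line {R : realType} (f : R -> R) : Prop :=
  forall x0, 0 <= x0 -> exists (c : nat -> R) (rho : R), 0 < rho /\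
    forall x, 0 <= x -> `|x - x0| < rho -> pseries c (x - x0) @ \oo --> f x.

Definition standing_assumptions {R : realType} (th : thermo R) (w : profile R)
    (beta : R) : Prop :=
  [/\ [/\ analytic_half_line (vol w), analytic_half_line (vel w),
          analytic_half_line (ent w) & analytic_half_line (lam w)],
      (exists C1 C2 : R, [/\ 0 < C1, C2 < 1 &
         forall x, 0 <= x -> C1 <= kappa th w x <= C2 /\ C1 <= vel w x <= C2]),
      0 < beta /\
      (exists C : R, forall x, 0 <= x ->
         [/\ `|vol w x - vol_of (st_oo w)| <= C * expR (- beta * x),
             `|vel w x - vel_oo w| <= C * expR (- beta * x),
             `|ent w x - ent_of (st_oo w)| <= C * expR (- beta * x) &
             `|lam w x - lam_of (st_oo w)| <= C * expR (- beta * x)]) &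
      rate_assumptions th].

(* Difference quotients taken within [A]: the usual derivative at interior
   points of [A], the one-sided derivative at an endpoint. *)
Definition diff_quot {R : realType} (f : R -> R) (x y : R) : R :=
  (f y - f x) / (y - x).

Definition has_derivative_within {R : realType} (A : set R) (f : R -> R)
    (x l : R) : Prop :=
  diff_quot f x y @[y --> within A x^'] --> l.

Definition ddx {R : realType} (f : R -> R) (x : R) : R :=
  lim (diff_quot f x y @[y --> within `[0, +oo[ x^']).

(* Not the library's generic ['i], which is only specified as a root of -1. *)
Definition iC {R : realType} : R[i] := 0 +i* 1.

Definition modc {R : realType} (z : R[i]) : R := ComplexField.Normc.normc z.

Definition vnorm {R : realType} (n : nat) (v : 'cV[R[i]]_n) : R :=
  Num.sqrt (\sum_(i < n) modc (v i 0) ^+ 2).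

Definition expC {R : realType} (z : R[i]) : R[i] :=
  (expR (complex.Re z))%:C * (cos (complex.Im z) +i* sin (complex.Im z)).

Definition intC {R : realType} (f : R -> R[i]) (a b : R) : R[i] :=
  Rintegral lebesgue_measure `[a, b] (fun x => complex.Re (f x)) +i*
  Rintegral lebesgue_measure `[a, b] (fun x => complex.Im (f x)).

Definition locally_integrableC {R : realType} (f : R -> R[i]) : Prop :=
  forall X : R, 0 <= X ->
    lebesgue_measure.-integrable `[0, X] (EFin \o (fun x => complex.Re (f x))) /\
    lebesgue_measure.-integrable `[0, X] (EFin \o (fun x => complex.Im (f x))).

Definition has_derivative_withinC {R : realType} (n : nat) (A : set R)
    (f : R -> 'cV[R[i]]_n) (x : R) (l : 'cV[R[i]]_n) : Prop :=
  forall i : 'I_n,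
    has_derivative_within A (fun y => complex.Re (f y i 0)) x
      (complex.Re (l i 0)) /\
    has_derivative_within A (fun y => complex.Im (f y i 0)) x
      (complex.Im (l i 0)).

Definition mx_of_rows {K : nzRingType} (n : nat) (rows : seq (seq K)) : 'M[K]_n :=
  \matrix_(i < n, j < n) nth 0 (nth [::] rows i) j.

Definition realmx {R : realType} (n : nat) (M : 'M[R]_n) : 'M[R[i]]_n :=
  map_mx (fun t : R => t%:C) M.

Definition Ax {R : realType} (th : thermo R) (w : profile R) (x : R) : 'M[R]_5 :=
  let q := st w x in let v := vol w x in let u := vel w x in
  let p := pressure th in
  mx_of_rows 5
    [:: [:: u;            - v; 0; 0;           0];
        [:: v * d_v p q;  u;   0; v * d_S p q; v * d_lam p q];
        [:: 0;            0;   u; 0;           0];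
        [:: 0;            0;   0; u;           0];
        [:: 0;            0;   0; 0;           u]].

Definition Ay {R : realType} (th : thermo R) (w : profile R) (x : R) : 'M[R]_5 :=
  let q := st w x in let v := vol w x in
  let p := pressure th in
  mx_of_rows 5
    [:: [:: 0;            0; - v; 0;           0];
        [:: 0;            0; 0;   0;           0];
        [:: v * d_v p q;  0; 0;   v * d_S p q; v * d_lam p q];
        [:: 0;            0; 0;   0;           0];
        [:: 0;            0; 0;   0;           0]].

Definition Bmx {R : realType} (th : thermo R) (w : profile R) (x : R) : 'M[R]_5 :=
  let q := st w x in let v := vol w x in
  let p := pressure th in let om := omega th in let r := rate th in
  let along (f : state R -> R) := fun y : R => f (st w y) in
  mx_of_rows 5
    [:: [:: - ddx (vel w) x; ddx (vol w) x; 0; 0; 0];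
        [:: ddx (along p) x
              - v * ddx (along (fun q => c0 th q ^+ 2 / vol_of q ^+ 2)) x;
            ddx (vel w) x; 0;
            v * ddx (along (d_S p)) x; v * ddx (along (d_lam p)) x];
        [:: 0; 0; 0; 0; 0];
        [:: - d_v om q; ddx (ent w) x; 0; - d_S om q; - d_lam om q];
        [:: - d_v r q; ddx (lam w) x; 0; - d_S r q; - d_lam r q]].

Definition Phi0 {R : realType} (th : thermo R) (w : profile R) (x : R)
    (z : R[i]) : 'M[R[i]]_5 :=
  (invmx (realmx (Ax th w x)) *m (z%:M + iC *: realmx (Ay th w x)))^T.

Definition Phi1 {R : realType} (th : thermo R) (w : profile R) (x : R)
    (nu : R[i]) : 'M[R[i]]_5 :=
  (nu *: invmx (realmx (Ax th w x)))^T +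
  (invmx (realmx (Ax th w x)) *m realmx (Bmx th w x))^T.

(* s = sqrt (zeta^2 + c0^2 eta).  [sqrtc] is the principal square root (argument
   in ]-pi/2, pi/2]); on Re zeta > 0 it is the branch positive for zeta > 0, whose
   continuation across the imaginary axis outside the cut is its opposite on
   Re zeta < 0.  On the imaginary axis zeta^2 + c0^2 eta is real and [sqrtc]
   gives |s| or i|s|; the sign in the latter case is that of Im zeta. *)
Definition sfun {R : realType} (th : thermo R) (w : profile R) (x : R)
    (z : R[i]) : R[i] :=
  let d := c0 th (st w x) ^+ 2 * eta th w x in
  let root := sqrtc (z ^+ 2 + d%:C) in
  if 0 < complex.Re z then root
  else if complex.Re z < 0 then - root
  else if 0 <= complex.Re (z ^+ 2 + d%:C) then root
  else if 0 < complex.Im z then root else - root.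

(* The index 'I_5 starts at 0: mu_1, ..., mu_5 are [mu _ _ _ _ 0], ... *)
Definition mu {R : realType} (th : thermo R) (w : profile R) (x : R) (z : R[i])
    (j : 'I_5) : R[i] :=
  let k := (kappa th w x)%:C in let s := sfun th w x z in
  let eu := (eta th w x * vel w x)%:C in let u := (vel w x)%:C in
  nth 0 [:: - (k * (k * z + s) / eu); - (k * (k * z - s) / eu);
            z / u; z / u; z / u] j.

Definition Tmx {R : realType} (th : thermo R) (w : profile R) (x : R)
    (z : R[i]) : 'M[R[i]]_5 :=
  let k := (kappa th w x)%:C in let s := sfun th w x z in
  let u := (vel w x)%:C in let m := (mflux w x)%:C in
  let e := (eta th w x)%:C in
  let pS := (d_S (pressure th) (st w x))%:C in
  let pl := (d_lam (pressure th) (st w x))%:C in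
  mx_of_rows 5
    [:: [:: m * s / (k * u); - (m * s / (k * u)); - (iC * m / (1 - e)); 0; 0];
        [:: z / u; z / u; iC; 0; 0];
        [:: - iC; - iC; z / u; 0; 0];
        [:: - (k * pS * s / (u * m)); k * pS * s / (u * m); 0; 1; 0];
        [:: - (k * pl * s / (u * m)); k * pl * s / (u * m); 0; 0; 1]].

Definition e1 {R : realType} : 'cV[R[i]]_5 := delta_mx 0 0.

Definition solves_system {R : realType} (th : thermo R) (w : profile R)
    (zeta nu : R[i]) (h a : R) (theta : R -> 'cV[R[i]]_5) : Prop :=
  forall x, a <= x ->
    has_derivative_withinC `[a, +oo[ theta x
      ((h^-1)%:C *:
        ((Phi0 th w x zeta + h%:C *: Phi1 th w x nu) *m theta x)).

Definition wkb_factor {R : realType} (h : R) (f : R -> R[i]) (x : R) : R[i] :=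
  expC ((h^-1)%:C * intC f 0 x).

(* Main.v *)
(* Put z = zeta + h nu.  Then Phi_0(zeta) + h Phi_1(nu) = Phi_0(z) + h M, where all
   rows of M = (A_x^-1 B)^t but the last are O(exp (- beta x)), because the
   profile converges exponentially and r_v, r_S vanish at the end state, where
   lambda = 0; the last diagonal entry of M is - r_lambda / u > 0.  In a basis
   R = (T e_1, ...) of (generalized) eigenvectors of Phi_0(z) the system for
   theta = exp (h^-1 int mu_1^#) R Y is Y' = (h^-1 (Lambda - mu_1) + G - G_11) Y with
   G = R^-1 (M R - R') and mu_1^# = mu_1 + h G_11.  As mu_1 stays away from the other
   eigenvalues, a change of unknown Y = X + h X_1 sigma makes e_1 a solution of the
   X-system up to O(h exp (- beta x)).  Writing X = e_1 + exp (- beta x) Z, one is left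
   with an inhomogeneous system for Z whose diagonal coefficients have real part
   at least beta, since Re mu_1 <= Re mu_j; it is solved by Picard iteration,
   integrating from infinity, with weights absorbing the couplings that do not
   decay. *)

Require Import Defs.
From mathcomp Require Import all_boot all_order all_algebra.
From mathcomp Require Import complex.
From mathcomp Require Import all_classical all_reals all_analysis.
From mathcomp Require Import ring lra.

Set Implicit Arguments.
Unset Strict Implicit.
Unset Printing Implicit Defensive.

Import Order.TTheory GRing.Theory Num.Theory.
Import numFieldNormedType.Exports.

Local Open Scope classical_set_scope.
Local Open Scope ring_scope.
Local Open Scope complex_scope.

(** * Real derivatives *)

(** Exponential convergence is assumed for the values of the profile only. The decay of its
    derivatives is read off the steady equations: solved for the derivatives, their right-hand sides
    are multiples of the rate, which vanishes at the end state. That lambda vanishes there is itself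
    a consequence of r_lambda < 0. All bounds must be uniform in h although the symbol is taken at z
    = zeta + h nu, and three points resist. At z = u the eigenvalues mu_2 and z / u coincide, so no
    bounded diagonalization exists and a coupling of size 1 / h is carried to the end. The row of
    lambda does not decay; its coefficient - r_lambda / u has the favourable sign and is kept in the
    divisors of the corrector and in the diagonal of the final system. Separation bounds s away from
    0 for h > 0 and x >= a only, whereas T is evaluated at h = 0 and the exponent is integrated from
    0: the former needs a limit in h, the latter continuity of s at its zeros. Functions on [a, +oo[
    are extended to the left by their value at a, so that solutions live on the whole line and the
    one-sided derivative at a is recovered by continuity. *)

Section RealDerivatives.
Variable R : realType.
Implicit Types (f g : R -> R) (x y l a b : R).

Lemma continuous_forP f x : {for x, continuous f} <->
  forall e : R, 0 < e -> exists2 d : R, 0 < d &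
    forall y, `|y - x| < d -> `|f y - f x| < e.
Proof.
split=> [/cvgrPdist_lt fx e /fx|fx].
  move=> /nbhs_ballP[d /= d0 H]; exists d => // y yx.
  by rewrite distrC; apply: H; rewrite /ball /= distrC.
apply/cvgrPdist_lt => e /fx[d d0 H]; apply/nbhs_ballP; exists d => // y /=.
by rewrite /ball /= distrC => /H; rewrite distrC.
Qed.

(** Free of division, this is the form in which the remainder estimates of series, Taylor expansions
    and the chain rule are delivered. *)
Lemma is_deriveP f x l : is_derive x 1 f l <->
  forall e : R, 0 < e -> exists2 d : R, 0 < d &
    forall y, `|y - x| < d -> `|f y - f x - l * (y - x)| <= e * `|y - x|.
Proof.
rewrite is_derive1_caratheodory; split=> [[g [fg gx gl]] e e0|H].
  have [d d0 Hd] := (continuous_forP g x).1 gx e e0.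
  exists d => // y yx; rewrite fg -mulrBl normrM -gl.
  by rewrite ler_wpM2r // ltW // Hd.
exists (fun z => if z == x then l else (f z - f x) / (z - x)); split.
- move=> z; case: eqP => [->|/eqP zx]; first by rewrite !subrr mulr0.
  by rewrite mulfVK // subr_eq0.
- apply/continuous_forP => e e0; have e20 : 0 < e / 2 by lra.
  have [d d0 Hd] := H _ e20; exists d => // y /Hd.
  rewrite eqxx; case: eqP => [_ _|/eqP yx]; first by rewrite subrr normr0.
  have yx0 : 0 < `|y - x| by rewrite normr_gt0 subr_eq0.
  move=> Hy; have : `|(f y - f x) / (y - x) - l| * `|y - x| <= e / 2 * `|y - x|.
    by rewrite -normrM mulrBl mulfVK // -normr_gt0.
  rewrite ler_pM2r // => /le_lt_trans; apply; lra.
- by rewrite eqxx.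
Qed.

Lemma is_derive_eq_val f x l l' :
  is_derive x 1 f l -> l = l' -> is_derive x 1 f l'.
Proof. by move=> + <-. Qed.

Lemma is_derive_fD f g x l k : is_derive x 1 f l -> is_derive x 1 g k ->
  is_derive x 1 (fun y => f y + g y) (l + k).
Proof. by move=> Hf Hg; exact: (is_deriveD Hf Hg). Qed.

Lemma is_derive_fN f x l : is_derive x 1 f l ->
  is_derive x 1 (fun y => - f y) (- l).
Proof. by move=> Hf; exact: (is_deriveN Hf). Qed.

Lemma is_derive_fB f g x l k : is_derive x 1 f l -> is_derive x 1 g k ->
  is_derive x 1 (fun y => f y - g y) (l - k).
Proof. by move=> Hf Hg; exact: (is_deriveB Hf Hg). Qed.

Lemma is_derive_fM f g x l k : is_derive x 1 f l -> is_derive x 1 g k ->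
  is_derive x 1 (fun y => f y * g y) (l * g x + f x * k).
Proof.
move=> Hf Hg; apply: is_derive_eq_val (is_deriveM Hf Hg) _.
by rewrite /GRing.scale /= addrC mulrC.
Qed.

Lemma is_derive_fV f x l : f x != 0 -> is_derive x 1 f l ->
  is_derive x 1 (fun y => (f y)^-1) (- (l / f x ^+ 2)).
Proof.
move=> f0 Hf; apply: is_derive_eq_val (is_deriveV f0 Hf) _.
by rewrite /GRing.scale /= mulNr mulrC.
Qed.

Lemma is_derive_fexp f x l : is_derive x 1 f l ->
  is_derive x 1 (fun y => expR (f y)) (l * expR (f x)).
Proof.
move=> Hf; apply: is_derive_eq_val (is_derive1_comp (is_derive_expR (f x)) Hf) _.
exact: mulrC.
Qed.

Lemma is_derive_near f g x l : (\near x, f x = g x) ->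
  is_derive x 1 f l -> is_derive x 1 g l.
Proof. by move=> fg Hf; exact: (near_eq_is_derive fg Hf). Qed.

Lemma is_derive_continuous f x l : is_derive x 1 f l -> {for x, continuous f}.
Proof.
by move=> [/derivable1_diffP/differentiable_continuous].
Qed.

Lemma is_derive_within f (df : R -> R) a b :
  (forall x, a <= x <= b -> is_derive x 1 f (df x)) -> {within `[a, b], continuous f}.
Proof.
move=> H; apply: derivable_within_continuous => x; rewrite in_itv /= => xab.
by have [] := H x xab.
Qed.

Lemma mean_value f (df : R -> R) a b : a <= b ->
  (forall x, a <= x <= b -> is_derive x 1 f (df x)) ->
  exists2 c, a <= c <= b & f b - f a = df c * (b - a).
Proof.
move=> ab H.
have [||c] := @MVT_segment R f df a b ab.
- move=> x; rewrite in_itv /= => /andP[ax xb]; apply: H.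
  by rewrite (ltW ax) (ltW xb).
- exact: (@is_derive_within f df).
by rewrite in_itv /= => abc E; exists c.
Qed.

Lemma derive_ge0_le f (df : R -> R) a b : a <= b ->
  (forall x, a <= x <= b -> is_derive x 1 f (df x)) ->
  (forall x, a <= x <= b -> 0 <= df x) -> f a <= f b.
Proof.
move=> ab H H0; have [c cab E] := mean_value ab H.
by rewrite -subr_ge0 E mulr_ge0 ?H0 ?subr_ge0.
Qed.

Lemma derive_bound_lipschitz f (df : R -> R) (K a b : R) :
  (forall x, a <= x <= b -> is_derive x 1 f (df x)) ->
  (forall x, a <= x <= b -> `|df x| <= K) ->
  forall x y, a <= x <= b -> a <= y <= b -> `|f y - f x| <= K * `|y - x|.
Proof.
move=> H HK x y; wlog xy : x y / x <= y.
  move=> W xab yab; have /orP[/W|/W] := le_total x y; first exact.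
  by rewrite distrC (distrC y); exact.
move=> /andP[ax xb] /andP[ay yb].
have [|c /andP[xc cy] ->] := @mean_value f df x y xy.
  by move=> z /andP[xz zy]; apply: H; rewrite (le_trans ax xz) (le_trans zy yb).
rewrite normrM ler_wpM2r // HK //.
by rewrite (le_trans ax xc) (le_trans cy yb).
Qed.

(** By the mean value theorem the difference quotient at [a] is a value of [df] at a point between,
    so continuity of [df] at [a] suffices. This supplies the one-sided derivative at an endpoint
    where the equation is known only to the right. *)
Lemma has_derivative_within_endpoint f (df : R -> R) a :
  (forall e : R, 0 < e -> exists2 d : R, 0 < d &
     forall y, a <= y -> y < a + d -> `|f y - f a| < e) ->
  (forall x, a < x -> is_derive x 1 f (df x)) ->
  (forall e : R, 0 < e -> exists2 d : R, 0 < d &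
     forall y, a <= y -> y < a + d -> `|df y - df a| < e) ->
  has_derivative_within `[a, +oo[ f a (df a).
Proof.
move=> cf H cdf; apply/cvgrPdist_le => e e0.
have [d d0 Hd] := cdf e e0.
rewrite near_withinE /within /=; rewrite near_withinE /=.
near=> y => ya; rewrite /= in_itv /= andbT => ay.
have {ya} ay' : a < y by rewrite lt_neqAle eq_sym ya.
have yad : y < a + d by near: y; apply: lt_nbhsl; rewrite ltrDl.
have [||c] := @MVT_segment R f df a y ay.
- by move=> x; rewrite in_itv /= => /andP[ax _]; apply: H.
- apply/continuous_within_itvP => //; split.
  + move=> x; rewrite in_itv /= => /andP[ax _].
    exact: (is_derive_continuous (H x ax)).
  + apply/cvgrPdist_lt => r r0; have [t t0 Ht] := cf r r0.
    near=> z; rewrite distrC; apply: Ht; first by near: z; exact: nbhs_right_ge.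
    by near: z; apply: nbhs_right_lt; rewrite ltrDl.
  + apply: cvg_at_left_filter.
    exact: (is_derive_continuous (H y ay')).
rewrite in_itv /= => /andP[ac cy] E.
rewrite /diff_quot E mulfK ?subr_eq0 ?gt_eqF // distrC ltW // Hd //.
exact: le_lt_trans cy yad.
Unshelve. all: by end_near. Qed.

Lemma has_derivative_within_interior f a x l : a < x ->
  is_derive x 1 f l -> has_derivative_within `[a, +oo[ f x l.
Proof.
move=> ax /is_deriveP H; apply/cvgrPdist_le => e e0.
have [d d0 Hd] := H e e0.
rewrite near_withinE /within /=; rewrite near_withinE /=.
near=> y => yx _.
have yxd : `|y - x| < d.
  near: y; apply/nbhs_ballP; exists d => //= y; by rewrite /ball /= distrC.
have yx0 : 0 < `|y - x| by rewrite normr_gt0 subr_eq0.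
rewrite distrC -(ler_pM2r yx0) -normrM mulrBl /diff_quot mulfVK; first exact: Hd.
by rewrite subr_eq0.
Unshelve. all: by end_near. Qed.

(** The limit is unique because the points x + d / 2 keep the punctured filter proper, also at the
    endpoint x = a. *)
Lemma has_derivative_within_half_lineP f a x l :
  has_derivative_within `[a, +oo[ f x l -> a <= x ->
  lim (diff_quot f x y @[y --> within `[a, +oo[ x^']) = l.
Proof.
move=> H ax; apply: cvg_lim => //.
apply: Build_ProperFilter_ex => P.
rewrite /within /= => -[d /= d0 HP].
exists (x + d / 2); apply: HP => /=.
- by rewrite opprD addNKr normrN gtr0_norm; lra.
- apply/eqP; lra.
- rewrite in_itv /= andbT; lra.
Qed.

End RealDerivatives.

(** * Complex-valued functions of a real variable *)

Section ComplexModulus.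
Variable R : realType.
Implicit Types (z w : R[i]) (x y : R).

Lemma modcM z w : modc (z * w) = modc z * modc w.
Proof. exact: ComplexField.Normc.normcM. Qed.

Lemma modc_ge0 z : 0 <= modc z.
Proof. by case: z => x y; rewrite /modc /= sqrtr_ge0. Qed.

Lemma modcD z w : modc (z + w) <= modc z + modc w.
Proof. exact: le_normcD. Qed.

Lemma modcN z : modc (- z) = modc z.
Proof. exact: normcN. Qed.

Lemma modcV z : modc z^-1 = (modc z)^-1.
Proof. exact: ComplexField.Normc.normcV. Qed.

Lemma modc0 : modc (0 : R[i]) = 0.
Proof. exact: ComplexField.Normc.normc0. Qed.

Lemma modc1 : modc (1 : R[i]) = 1.
Proof. exact: ComplexField.Normc.normc1. Qed.

Lemma modcR x : modc x%:C = `|x|.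
Proof. by rewrite /modc /= expr0n addr0 sqrtr_sqr. Qed.

Lemma modc_eq0 z : (modc z == 0) = (z == 0).
Proof.
apply/eqP/eqP => [|->]; last exact: modc0.
exact: ComplexField.Normc.eq0_normc.
Qed.

Lemma modc_gt0 z : (0 < modc z) = (z != 0).
Proof. by rewrite lt0r modc_eq0 modc_ge0 andbT. Qed.

Lemma modc_sqr z : modc z ^+ 2 = complex.Re z ^+ 2 + complex.Im z ^+ 2.
Proof. by case: z => x y; rewrite /modc /= sqr_sqrtr // addr_ge0 ?sqr_ge0. Qed.

Lemma Re_le_modc z : `|complex.Re z| <= modc z.
Proof.
by rewrite -(@ler_pXn2r _ 2) ?nnegrE ?modc_ge0 // modc_sqr real_normK ?num_real // lerDl sqr_ge0.
Qed.

Lemma Im_le_modc z : `|complex.Im z| <= modc z.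
Proof.
by rewrite -(@ler_pXn2r _ 2) ?nnegrE ?modc_ge0 // modc_sqr real_normK ?num_real // lerDr sqr_ge0.
Qed.

Lemma modc_le z : modc z <= `|complex.Re z| + `|complex.Im z|.
Proof.
rewrite -(@ler_pXn2r _ 2) ?nnegrE ?modc_ge0 ?addr_ge0 // modc_sqr.
rewrite -(real_normK (num_real (complex.Re z))) -(real_normK (num_real (complex.Im z))).
rewrite sqrrD -addrA lerD2l lerDr mulrn_wge0 // mulr_ge0 //.
Qed.

Lemma modc_sum I (r : seq I) (P : pred I) (F : I -> R[i]) :
  modc (\sum_(i <- r | P i) F i) <= \sum_(i <- r | P i) modc (F i).
Proof.
elim/big_rec2: _ => [|i y z _ H]; first by rewrite modc0.
by apply: le_trans (modcD _ _) _; rewrite lerD2l.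
Qed.

Lemma ReCM z w : complex.Re (z * w) =
  complex.Re z * complex.Re w - complex.Im z * complex.Im w.
Proof. by case: z; case: w. Qed.

Lemma ImCM z w : complex.Im (z * w) =
  complex.Re z * complex.Im w + complex.Im z * complex.Re w.
Proof. by case: z; case: w. Qed.

Lemma ReCD z w : complex.Re (z + w) = complex.Re z + complex.Re w.
Proof. by case: z; case: w. Qed.

Lemma ImCD z w : complex.Im (z + w) = complex.Im z + complex.Im w.
Proof. by case: z; case: w. Qed.

Lemma ReCN z : complex.Re (- z) = - complex.Re z.
Proof. by case: z. Qed.

Lemma ImCN z : complex.Im (- z) = - complex.Im z.
Proof. by case: z. Qed.

Lemma ReCV z : complex.Re z^-1 =
  complex.Re z / (complex.Re z ^+ 2 + complex.Im z ^+ 2).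
Proof. by case: z. Qed.

Lemma ImCV z : complex.Im z^-1 =
  - (complex.Im z / (complex.Re z ^+ 2 + complex.Im z ^+ 2)).
Proof. by case: z => x y /=; rewrite ?mulNr. Qed.

Lemma Re_sum I (r : seq I) (P : pred I) (F : I -> R[i]) :
  complex.Re (\sum_(i <- r | P i) F i) = \sum_(i <- r | P i) complex.Re (F i).
Proof. by elim/big_rec2: _ => // i y z _ <-; rewrite ReCD. Qed.

Lemma Im_sum I (r : seq I) (P : pred I) (F : I -> R[i]) :
  complex.Im (\sum_(i <- r | P i) F i) = \sum_(i <- r | P i) complex.Im (F i).
Proof. by elim/big_rec2: _ => // i y z _ <-; rewrite ImCD. Qed.

Lemma complex_ext z w : complex.Re z = complex.Re w ->
  complex.Im z = complex.Im w -> z = w.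
Proof. by case: z; case: w => a b c d /= -> ->. Qed.

End ComplexModulus.

Section ComplexFunctions.
Variable R : realType.
Implicit Types (f g : R -> R[i]) (x : R).

(** By components, in accordance with [has_derivative_withinC]. *)
Definition is_deriveC f x (l : R[i]) :=
  is_derive x 1 (fun y => complex.Re (f y)) (complex.Re l) /\
  is_derive x 1 (fun y => complex.Im (f y)) (complex.Im l).

Definition continuousC f x :=
  {for x, continuous (fun y => complex.Re (f y))} /\
  {for x, continuous (fun y => complex.Im (f y))}.

Lemma is_deriveC_continuous f x l : is_deriveC f x l -> continuousC f x.
Proof. by move=> [/is_derive_continuous ? /is_derive_continuous ?]. Qed.

Lemma is_deriveC_cst (c : R[i]) x : is_deriveC (fun=> c) x 0.
Proof. by split; exact: is_derive_cst. Qed.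

Lemma is_deriveC_real (f : R -> R) x l :
  is_derive x 1 f l -> is_deriveC (fun y => (f y)%:C) x l%:C.
Proof. by move=> H; split => //=; exact: is_derive_cst. Qed.

Lemma is_deriveCD f g x l k : is_deriveC f x l -> is_deriveC g x k ->
  is_deriveC (fun y => f y + g y) x (l + k).
Proof.
move=> [f1 f2] [g1 g2]; split.
- rewrite ReCD; under eq_fun do rewrite ReCD; exact: is_deriveD.
- rewrite ImCD; under eq_fun do rewrite ImCD; exact: is_deriveD.
Qed.

Lemma is_deriveCN f x l : is_deriveC f x l -> is_deriveC (fun y => - f y) x (- l).
Proof.
move=> [f1 f2]; split.
- rewrite ReCN; under eq_fun do rewrite ReCN; exact: is_deriveN.
- rewrite ImCN; under eq_fun do rewrite ImCN; exact: is_deriveN.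
Qed.

Lemma is_deriveCM f g x l k : is_deriveC f x l -> is_deriveC g x k ->
  is_deriveC (fun y => f y * g y) x (l * g x + f x * k).
Proof.
move=> [f1 f2] [g1 g2]; split.
- under eq_fun do rewrite ReCM.
  apply: is_derive_eq_val (is_deriveB (is_deriveM f1 g1) (is_deriveM f2 g2)) _.
  by rewrite ReCD !ReCM /GRing.scale /=; ring.
- under eq_fun do rewrite ImCM.
  apply: is_derive_eq_val (is_deriveD (is_deriveM f1 g2) (is_deriveM f2 g1)) _.
  by rewrite ImCD !ImCM /GRing.scale /=; ring.
Qed.

Lemma is_deriveC_sum n (F : 'I_n -> R -> R[i]) (l : 'I_n -> R[i]) x :
  (forall i, is_deriveC (F i) x (l i)) ->
  is_deriveC (fun y => \sum_i F i y) x (\sum_i l i).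
Proof.
move=> H; split.
- rewrite Re_sum; under eq_fun do rewrite Re_sum.
  rewrite (_ : (fun y => _) = \sum_i (fun y => complex.Re (F i y))).
    by apply: is_derive_sum => i; have [] := H i.
  by apply/funext => y; rewrite fct_sumE.
- rewrite Im_sum; under eq_fun do rewrite Im_sum.
  rewrite (_ : (fun y => _) = \sum_i (fun y => complex.Im (F i y))).
    by apply: is_derive_sum => i; have [] := H i.
  by apply/funext => y; rewrite fct_sumE.
Qed.

Lemma is_deriveC_near f g x l : (\near x, f x = g x) ->
  is_deriveC f x l -> is_deriveC g x l.
Proof.
by move=> fg [f1 f2]; split;
   [apply: near_eq_is_derive f1|apply: near_eq_is_derive f2];
   apply: filterS fg => y ->.
Qed.

Lemma Re_Im_sq_neq0 (z : R[i]) : z != 0 -> complex.Re z ^+ 2 + complex.Im z ^+ 2 != 0.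
Proof. by rewrite -modc_sqr sqrf_eq0 modc_eq0. Qed.

Lemma is_deriveCV f x l : f x != 0 -> is_deriveC f x l ->
  is_deriveC (fun y => (f y)^-1) x (- (l * (f x)^-1 * (f x)^-1)).
Proof.
move=> fx0 [f1 f2].
have f3 := is_deriveD (is_deriveM f1 f1) (is_deriveM f2 f2).
have n0 := Re_Im_sq_neq0 fx0.
have f4 := is_deriveV (f := (fun y => complex.Re (f y) * complex.Re (f y) +
   complex.Im (f y) * complex.Im (f y))) _ f3.
have {}f4 := f4 n0; split.
- under eq_fun do rewrite ReCV !expr2.
  apply: is_derive_eq_val (is_deriveM f1 f4) _.
  rewrite ReCN !ReCM !ImCM ReCV ImCV /GRing.scale /=; field.
  exact: n0.
- under eq_fun do rewrite ImCV !expr2.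
  apply: is_derive_eq_val (is_deriveN (is_deriveM f2 f4)) _.
  rewrite ImCN !ImCM !ReCM ReCV ImCV /GRing.scale /=; field.
  exact: n0.
Qed.

Lemma eq_continuous_for (p q : R -> R) x : p =1 q ->
  {for x, continuous p} -> {for x, continuous q}.
Proof. by move=> /funext ->. Qed.

Lemma continuousC_cst (c : R[i]) x : continuousC (fun=> c) x.
Proof. by split; exact: cvg_cst. Qed.

Lemma continuousC_real (f : R -> R) x :
  {for x, continuous f} -> continuousC (fun y => (f y)%:C) x.
Proof. by move=> H; split => //=; exact: cvg_cst. Qed.

Lemma continuousCD f g x : continuousC f x -> continuousC g x ->
  continuousC (fun y => f y + g y) x.
Proof.
move=> [f1 f2] [g1 g2]; split.
- apply: (@eq_continuous_for (fun y => complex.Re (f y) + complex.Re (g y))).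
    by move=> y; rewrite ReCD.
  exact: cvgD.
- apply: (@eq_continuous_for (fun y => complex.Im (f y) + complex.Im (g y))).
    by move=> y; rewrite ImCD.
  exact: cvgD.
Qed.

Lemma continuousCN f x : continuousC f x -> continuousC (fun y => - f y) x.
Proof.
move=> [f1 f2]; split.
- apply: (@eq_continuous_for (fun y => - complex.Re (f y))).
    by move=> y; rewrite ReCN.
  exact: cvgN.
- apply: (@eq_continuous_for (fun y => - complex.Im (f y))).
    by move=> y; rewrite ImCN.
  exact: cvgN.
Qed.

Lemma continuousCM f g x : continuousC f x -> continuousC g x ->
  continuousC (fun y => f y * g y) x.
Proof.
move=> [f1 f2] [g1 g2]; split.
- apply: (@eq_continuous_for (fun y => complex.Re (f y) * complex.Re (g y)
     - complex.Im (f y) * complex.Im (g y))).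
    by move=> y; rewrite ReCM.
  by apply: cvgB; exact: cvgM.
- apply: (@eq_continuous_for (fun y => complex.Re (f y) * complex.Im (g y)
     + complex.Im (f y) * complex.Re (g y))).
    by move=> y; rewrite ImCM.
  by apply: cvgD; exact: cvgM.
Qed.

Lemma continuousCV f x : f x != 0 -> continuousC f x ->
  continuousC (fun y => (f y)^-1) x.
Proof.
move=> fx0 [f1 f2]; have n0 := Re_Im_sq_neq0 fx0.
have c : {for x, continuous (fun y =>
    (complex.Re (f y) * complex.Re (f y) + complex.Im (f y) * complex.Im (f y))^-1)}.
  by apply: cvgV; rewrite -?expr2 //; apply: cvgD; exact: cvgM.
split.
- apply: (@eq_continuous_for (fun y => complex.Re (f y) *
    (complex.Re (f y) * complex.Re (f y) + complex.Im (f y) * complex.Im (f y))^-1)).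
    by move=> y; rewrite ReCV !expr2.
  exact: cvgM.
- apply: (@eq_continuous_for (fun y => - (complex.Im (f y) *
    (complex.Re (f y) * complex.Re (f y) + complex.Im (f y) * complex.Im (f y))^-1))).
    by move=> y; rewrite ImCV !expr2.
  by apply: cvgN; exact: cvgM.
Qed.

Lemma continuousC_sum n (F : 'I_n -> R -> R[i]) x :
  (forall i, continuousC (F i) x) -> continuousC (fun y => \sum_i F i y) x.
Proof.
move=> H; pose G s := fun y => \sum_(i <- s) F i y.
suff : forall s, continuousC (G s) x by move=> /(_ (index_enum _)).
elim => [|i s IH].
  rewrite (_ : G [::] = fun=> 0); first exact: continuousC_cst.
  by apply/funext => y; rewrite /G big_nil.
rewrite (_ : G (i :: s) = fun y => F i y + G s y); first exact: continuousCD.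
by apply/funext => y; rewrite /G big_cons.
Qed.

Lemma expC_modc (z : R[i]) : modc (expC z) = expR (complex.Re z).
Proof.
rewrite /expC modcM modcR ger0_norm ?expR_ge0 //.
by rewrite /modc /= cos2Dsin2 sqrtr1 mulr1.
Qed.

Lemma expCN (z : R[i]) : expC z * expC (- z) = 1.
Proof.
case: z => x y; rewrite /expC /= cosN sinN expRN.
apply: complex_ext; rewrite ?ReCM ?ImCM /=; have := cos2Dsin2 y;
 have : expR x != 0 by rewrite gt_eqF ?expR_gt0.
  move=> ? H; rewrite !mul0r !subr0 !addr0 -[RHS]H; field => //.
by move=> ? H; field.
Qed.

Lemma is_deriveC_exp f x l : is_deriveC f x l ->
  is_deriveC (fun y => expC (f y)) x (l * expC (f x)).
Proof.
move=> [f1 f2].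
have e := is_derive1_comp (is_derive_expR (complex.Re (f x))) f1.
have c := is_derive1_comp (is_derive_cos (complex.Im (f x))) f2.
have s := is_derive1_comp (is_derive_sin (complex.Im (f x))) f2.
split.
- rewrite (_ : (fun y => _) = (expR \o (fun y => complex.Re (f y))) *
    (cos \o (fun y => complex.Im (f y)))).
    apply: is_derive_eq_val (is_deriveM e c) _.
    by rewrite /expC ReCM /= /GRing.scale /=; ring.
  by apply/funext => y; rewrite /expC ReCM /= mul0r subr0.
- rewrite (_ : (fun y => _) = (expR \o (fun y => complex.Re (f y))) *
    (sin \o (fun y => complex.Im (f y)))).
    apply: is_derive_eq_val (is_deriveM e s) _.
    by rewrite /expC ImCM /= /GRing.scale /=; ring.
  by apply/funext => y; rewrite /expC ImCM /= mul0r addr0.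
Qed.

End ComplexFunctions.

(** * Antiderivatives *)

Section Antiderivatives.
Variable R : realType.
Implicit Types (f : R -> R).

Lemma integrable_segment f (a b : R) : continuous f ->
  lebesgue_measure.-integrable `[a, b] (EFin \o f).
Proof.
move=> cf; apply: continuous_compact_integrable; first exact: segment_compact.
exact: continuous_subspaceT.
Qed.

Lemma is_derive_integral f (b x : R) : continuous f -> b < x ->
  is_derive x 1 (fun y => \int[lebesgue_measure]_(t in `[b, y]) f t) (f x).
Proof.
move=> cf bx.
have xx1 : x < x + 1 by lra.
have [d e] := continuous_FTC1_closed xx1 (@integrable_segment f b (x + 1) cf) bx (cf x).
by split; [exact: d|rewrite -derive1E; exact: e].
Qed.

Lemma derive0_eq f (a b : R) : a <= b ->
  (forall x, a <= x <= b -> is_derive x 1 f 0) -> f a = f b.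
Proof.
move=> ab H; have [c _ /eqP] := mean_value (df := fun=> 0) ab H.
by rewrite mul0r subr_eq0 eq_sym => /eqP.
Qed.

(** The fundamental theorem of calculus differentiates an integral only to the right of its base
    point, so the base - n moves left with x. Normalized to vanish at 0, the integrals [G n] agree
    where both are differentiable, their difference having derivative 0. *)
Lemma antiderivative f : continuous f -> exists F : R -> R,
  (forall x : R, is_derive x 1 F (f x)) /\
  (forall x : R, 0 <= x -> \int[lebesgue_measure]_(t in `[0, x]) f t = F x).
Proof.
move=> cf.
pose G (n : nat) (x : R) := \int[lebesgue_measure]_(t in `[- n%:R, x]) f t
  - \int[lebesgue_measure]_(t in `[- n%:R, 0]) f t.
have dG n (x : R) : - n%:R < x -> is_derive x 1 (G n) (f x).
  move=> nx; rewrite -[f x]subr0.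
  exact: (is_derive_fB (is_derive_integral cf nx) (is_derive_cst _ _ _)).
have GE n m (x : R) : (0 < n)%N -> (0 < m)%N -> - n%:R < x -> - m%:R < x ->
    G n x = G m x.
  move=> n0 m0 nx mx; apply/eqP; rewrite -subr_eq0; apply/eqP.
  have n0' : - n%:R < 0 :> R by rewrite oppr_lt0 ltr0n.
  have m0' : - m%:R < 0 :> R by rewrite oppr_lt0 ltr0n.
  have H0 : G n 0 - G m 0 = 0 by rewrite /G !subrr.
  have dz (y : R) : - n%:R < y -> - m%:R < y ->
      is_derive y 1 (fun z => G n z - G m z) 0.
    by move=> ny my; rewrite -(subrr (f y)); exact: (is_derive_fB (dG _ _ ny) (dG _ _ my)).
  rewrite -H0; have /orP[x0|x0] := le_total x 0.
    apply: (@derive0_eq (fun z => G n z - G m z)) => // y /andP[xy _].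
    by apply: dz; exact: lt_le_trans xy.
  apply/esym; apply: (@derive0_eq (fun z => G n z - G m z)) => // y /andP[xy _].
  by apply: dz; exact: lt_le_trans xy.
(* The margin 1 makes [G (N x)] an antiderivative on the whole unit ball around x, where it can
   replace [G (N y)]. *)
pose N (x : R) := (Num.truncn (`|x| + 1)).+1.
have Nx (x : R) : `|x| + 1 < (N x)%:R by rewrite /N truncnS_gt.
have Nlt (x y : R) : `|x - y| < 1 -> - (N x)%:R < y.
  move=> xy; have := Nx x; have := ler_norm (- x); have := ler_norm (x - y).
  rewrite normrN; lra.
exists (fun x => G (N x) x); split=> [x|x x0].
  have : is_derive x 1 (G (N x)) (f x).
    by apply: dG; apply: Nlt; rewrite subrr normr0.
  move=> HG; apply: (is_derive_near _ HG); apply/nbhs_ballP.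
  exists 1; first exact: ltr01.
  move=> y; rewrite /ball /= => xy.
  have Nxy := Nlt _ _ xy.
  have Nyy : - (N y)%:R < y by apply: Nlt; rewrite subrr normr0.
  exact: (GE _ _ _ (ltn0Sn _) (ltn0Sn _) Nxy Nyy).
have N0 : - (N x)%:R <= 0 :> R by rewrite oppr_le0.
rewrite /G.
rewrite (@Rintegral_itvB R f (BLeft (- (N x)%:R)) (BRight x) 0); first last.
- by rewrite bnd_simp.
- by rewrite bnd_simp.
- exact: integrable_segment.
rewrite Rintegral_itv_obnd_cbnd //.
by apply: integrableS (@integrable_segment f 0 x cf) => //; exact: subset_itv_oc_cc.
Qed.

Lemma antiderivativeC (f : R -> R[i]) : (forall x, continuousC f x) ->
  exists F : R -> R[i],
  (forall x, is_deriveC F x (f x)) /\ (forall x : R, 0 <= x -> intC f 0 x = F x).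
Proof.
move=> cf; have [|F [dF iF]] := @antiderivative (fun x => complex.Re (f x)).
  by move=> x; have [] := cf x.
have [|G [dG iG]] := @antiderivative (fun x => complex.Im (f x)).
  by move=> x; have [] := cf x.
exists (fun x => F x +i* G x); split=> [x|x x0].
  by split; [exact: dF|exact: dG].
by rewrite /intC iF // iG.
Qed.

(* Without limits: [F - G] is nondecreasing, [F + G] nonincreasing and
   [F - G <= F + G], so a constant separates them. *)
Lemma tail_antiderivative f (G G' : R -> R) : continuous f ->
  (forall x : R, is_derive x 1 G (G' x)) -> (forall x : R, `|f x| <= - G' x) ->
  (forall x : R, 0 <= G x) ->
  exists F : R -> R, forall x : R, is_derive x 1 F (f x) /\ `|F x| <= G x.
Proof.
move=> cf dG fG G0; have [F [dF _]] := antiderivative cf.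
have up (x y : R) : x <= y -> F x - G x <= F y - G y.
  move=> xy; apply: (@derive_ge0_le R (fun z => F z - G z) (fun z => f z - G' z)) => //.
  by move=> z _; have := fG z; rewrite ler_norml => /andP[]; lra.
have dn (x y : R) : x <= y -> F y + G y <= F x + G x.
  move=> xy; rewrite -lerN2.
  apply: (@derive_ge0_le R (fun z => - (F z + G z)) (fun z => - (f z + G' z))) => //.
  by move=> z _; have := fG z; rewrite ler_norml => /andP[]; lra.
have sep (x y : R) : F x - G x <= F y + G y.
  apply: (@le_trans _ _ (F (Num.max x y) - G (Num.max x y))).
    by apply: up; rewrite le_max lexx.
  apply: (@le_trans _ _ (F (Num.max x y) + G (Num.max x y))).
    by have := G0 (Num.max x y); lra.
  by apply: dn; rewrite le_max lexx orbT.
pose A := [set F x - G x | x in [set: R]].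
have A0 : A !=set0 by exists (F 0 - G 0), 0.
have Aub y : ubound A (F y + G y) by move=> _ [x _ <-].
exists (fun x => F x - sup A) => x; split.
  by rewrite -[f x]subr0; exact: (is_derive_fB (dF x) (is_derive_cst _ _ _)).
rewrite ler_norml; apply/andP; split.
  have : sup A <= F x + G x by apply: ge_sup.
  lra.
have : F x - G x <= sup A by apply: ub_le_sup; [exists (F x + G x)|exists x].
lra.
Qed.

(** Real and imaginary parts are treated separately, whence the factor 2. *)
Lemma tail_antiderivativeC (f : R -> R[i]) (G G' : R -> R) :
  (forall x, continuousC f x) ->
  (forall x : R, is_derive x 1 G (G' x)) -> (forall x, modc (f x) <= - G' x) ->
  (forall x : R, 0 <= G x) ->
  exists F : R -> R[i], forall x : R, is_deriveC F x (f x) /\ modc (F x) <= 2 * G x.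
Proof.
move=> cf dG fG G0.
have [|x|F HF] := @tail_antiderivative (fun x => complex.Re (f x)) G G' _ dG _ G0.
- by move=> x; have [] := cf x.
- exact: le_trans (Re_le_modc _) (fG x).
have [|x|H HH] := @tail_antiderivative (fun x => complex.Im (f x)) G G' _ dG _ G0.
- by move=> x; have [] := cf x.
- exact: le_trans (Im_le_modc _) (fG x).
exists (fun x => F x +i* H x) => x; split.
  by split; [exact: (HF x).1|exact: (HH x).1].
apply: le_trans (modc_le _) _ => /=.
by have := (HF x).2; have := (HH x).2; lra.
Qed.

End Antiderivatives.

(** * Uniformly convergent series *)

Section GeometricSeries.
Variable R : realType.

Lemma limn_dist_le (u : nat -> R) (l x B : R) (N : nat) : u @ \oo --> l ->
  (forall M, (N <= M)%N -> `|u M - x| <= B) -> `|l - x| <= B.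
Proof.
move=> ul H.
have c : (fun M => `|u M - x|) @ \oo --> `|l - x|.
  by apply: cvg_norm; apply: cvgB => //; exact: cvg_cst.
rewrite -(cvg_lim _ c) //; apply: limr_le; first exact: cvgP c.
by near=> M; apply: H; near: M; exact: nbhs_infty_ge.
Unshelve. all: by end_near. Qed.

(** The explicit tail bound serves twice: for termwise differentiation and, at N = 0, for the size
    of the sum. *)
Lemma geometric_dominated (u : nat -> R) (K q : R) : 0 <= q < 1 ->
  (forall n, `|u n| <= K * q ^+ n) ->
  cvgn (series u) /\ forall N, `|limn (series u) - series u N| <= K * q ^+ N / (1 - q).
Proof.
move=> /andP[q0 q1] uK.
have K0 : 0 <= K by have := le_trans (normr_ge0 _) (uK 0%N); rewrite expr0 mulr1.
have q1' : `|q| < 1 by rewrite ger0_norm.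
have cg : cvgn (series (geometric K q)) by exact: is_cvg_geometric_series.
have cu : cvgn (series u).
  apply: normed_cvg; apply: series_le_cvg uK cg => [n|n].
    exact: normr_ge0.
  by rewrite /= mulr_ge0 // exprn_ge0.
split => // N; have q1q : 0 < 1 - q by lra.
apply: (@limn_dist_le _ _ _ _ N) cu _ => M NM.
rewrite (sub_series_geq u NM); apply: le_trans (ler_norm_sum _ _ _) _.
apply: (@le_trans _ _ (\sum_(N <= k < M) K * q ^+ k)); first exact: ler_sum.
rewrite -(subnKC NM); move: (M - N)%N => m.
have -> : \sum_(N <= k < N + m) K * q ^+ k = K * q ^+ N * (1 - q ^+ m) / (1 - q).
  elim: m => [|m IH]; first by rewrite addn0 big_geq // expr0 subrr mulr0 mul0r.
  rewrite addnS big_nat_recr ?leq_addr //= IH exprD exprS; field.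
  by rewrite gt_eqF.
rewrite ler_pM2r ?invr_gt0 // ler_piMr ?mulr_ge0 ?exprn_ge0 //.
by rewrite gerBl exprn_ge0.
Qed.

Lemma geometric_small (K q e : R) : 0 <= q < 1 -> 0 < e ->
  exists N, K * q ^+ N <= e.
Proof.
move=> /andP[q0 q1] e0.
have : (fun n => K * q ^+ n) @ \oo --> K * 0.
  by apply: cvgM; [exact: cvg_cst|apply: cvg_expr; rewrite ger0_norm].
rewrite mulr0 => /cvgr0Pnorm_le /(_ _ e0) [N _ H]; exists N.
by apply: le_trans (ler_norm _) _; apply: H => /=.
Qed.

Lemma is_derive_fsum n (f : nat -> R -> R) (l : nat -> R) (x : R) :
  (forall k, is_derive x 1 (f k) (l k)) ->
  is_derive x 1 (fun y => \sum_(0 <= k < n) f k y) (\sum_(0 <= k < n) l k).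
Proof.
move=> H; elim: n => [|n IH].
  rewrite big_nil; under eq_fun do rewrite big_nil; exact: is_derive_cst.
rewrite big_nat_recr //=; under eq_fun do rewrite big_nat_recr //=.
exact: is_derive_fD.
Qed.

(** The increment splits into a finite sum, which is differentiable, and two tails. The mean value
    inequality bounds [f n y - f n x] by K B |y - x| q^n, so both tails are O(q^N |y - x|) and N can
    be chosen before the radius d. [K] depends on the radius because the bounds are only locally
    uniform. *)
Lemma is_derive_series (f df : nat -> R -> R) (K : R -> R) (q : R) : 0 <= q < 1 ->
  (forall n (x : R), is_derive x 1 (f n) (df n x)) ->
  (forall n x, `|f n x| <= K `|x| * q ^+ n) ->
  (forall n B x, `|x| <= B -> `|df n x| <= K B * q ^+ n) ->
  forall x : R, is_derive x 1 (fun y => limn (series (f^~ y))) (limn (series (df^~ x))).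
Proof.
move=> q01 dF bF bdF x.
have [q0 q1] := andP q01; have q1q : 0 < 1 - q by lra.
set B := `|x| + 1; have xB : `|x| <= B by rewrite /B; lra.
have K0 : 0 <= K B by have := le_trans (normr_ge0 _) (bdF 0%N B x xB); rewrite expr0 mulr1.
apply/is_deriveP => e e0.
have e3 : 0 < e / 3 by lra.
have [N HN] := geometric_small (K B / (1 - q)) q01 e3.
have {}HN : K B * q ^+ N / (1 - q) <= e / 3 by apply: le_trans HN => //; rewrite mulrAC.
have [cdx /(_ N) Ldx] := geometric_dominated q01 (fun n => bdF n B x xB).
have [cx _] := geometric_dominated q01 (fun n => bF n x).
have [d d0 Hd] := (is_deriveP _ _ _).1 (is_derive_fsum N (fun k => dF k x)) (e / 3) e3.
exists (Num.min d 1); first by rewrite lt_min d0 ltr01.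
move=> y; rewrite lt_min => /andP[/Hd{}Hd yx1].
have yB : `|y| <= B.
  by have := ler_normD x (y - x); rewrite addrC subrK /B; lra.
have [cy _] := geometric_dominated q01 (fun n => bF n y).
have lip n : `|f n y - f n x| <= K B * `|y - x| * q ^+ n.
  rewrite mulrAC; apply: (@derive_bound_lipschitz R (f n) (df n) _ (- B) B).
  - by move=> z zB; apply: bdF; rewrite ler_norml.
  - by rewrite -ler_norml.
  - by rewrite -ler_norml.
have [_ /(_ N)] := geometric_dominated q01 lip.
have -> : series (fun n => f n y - f n x) = (series (f^~ y)) - (series (f^~ x)).
  by apply/funext => n; rewrite /series /= sumrB.
rewrite limB // => H.
rewrite /series /= in H Ldx Hd *.
set Sy := limn _ in H *; set Sx := limn _ in H *; set D := limn _ in Ldx *.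
rewrite (_ : Sy - Sx - D * (y - x) = (Sy - Sx - (\sum_(0 <= k < N) f k y - \sum_(0 <= k < N) f k x))
  + (\sum_(0 <= k < N) f k y - \sum_(0 <= k < N) f k x - (\sum_(0 <= k < N) df k x) * (y - x))
  - (D - \sum_(0 <= k < N) df k x) * (y - x)); last by ring.
apply: le_trans (ler_normB _ _) _; rewrite normrM.
apply: le_trans (lerD (ler_normD _ _) (lexx _)) _.
have H1 : `|Sy - Sx - (\sum_(0 <= k < N) f k y - \sum_(0 <= k < N) f k x)| <= e / 3 * `|y - x|.
  apply: le_trans H _; rewrite [leLHS](_ : _ = K B * q ^+ N / (1 - q) * `|y - x|).
    by rewrite ler_wpM2r.
  by ring.
have H2 : `|D - \sum_(0 <= k < N) df k x| * `|y - x| <= e / 3 * `|y - x|.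
  by rewrite ler_wpM2r // (le_trans Ldx).
by move: Hd H1 H2; lra.
Qed.

Lemma eq_cvgn (u v : nat -> R) (l : R) : u =1 v -> u @ \oo --> l -> v @ \oo --> l.
Proof. by move=> /funext ->. Qed.

Definition is_sumC (u : nat -> R[i]) (l : R[i]) :=
  series (fun n => complex.Re (u n)) @ \oo --> complex.Re l /\
  series (fun n => complex.Im (u n)) @ \oo --> complex.Im l.

Lemma is_sumC_unique u l k : is_sumC u l -> is_sumC u k -> l = k.
Proof.
move=> [l1 l2] [k1 k2]; apply: complex_ext.
  by rewrite -(cvg_lim _ l1) // -(cvg_lim _ k1).
by rewrite -(cvg_lim _ l2) // -(cvg_lim _ k2).
Qed.

Lemma is_sumC0 : is_sumC (fun=> 0) 0.
Proof.
have E : series (fun=> 0) = cst 0 :> (nat -> R).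
  by apply/funext => n; rewrite /series /= big1.
by split; rewrite /= E; exact: cvg_cst.
Qed.

Lemma is_sumCD u v l k : is_sumC u l -> is_sumC v k ->
  is_sumC (fun n => u n + v n) (l + k).
Proof.
move=> [u1 u2] [v1 v2]; split.
- rewrite ReCD; apply: eq_cvgn (cvgD u1 v1) => n.
  by rewrite !fctE /series /= -big_split; apply: eq_bigr => i _; rewrite ReCD.
- rewrite ImCD; apply: eq_cvgn (cvgD u2 v2) => n.
  by rewrite !fctE /series /= -big_split; apply: eq_bigr => i _; rewrite ImCD.
Qed.

Lemma is_sumCZ (c : R[i]) u l : is_sumC u l -> is_sumC (fun n => c * u n) (c * l).
Proof.
move=> [u1 u2]; split.
- rewrite ReCM.
  apply: eq_cvgn (cvgB (cvgM (cvg_cst (complex.Re c)) u1) (cvgM (cvg_cst (complex.Im c)) u2)) => n.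
  rewrite !fctE /series /= !mulr_sumr -sumrB.
  by apply: eq_bigr => i _; rewrite ReCM.
- rewrite ImCM.
  apply: eq_cvgn (cvgD (cvgM (cvg_cst (complex.Re c)) u2) (cvgM (cvg_cst (complex.Im c)) u1)) => n.
  rewrite !fctE /series /= !mulr_sumr -big_split.
  by apply: eq_bigr => i _; rewrite ImCM.
Qed.

Lemma is_sumC_sum m (u : 'I_m -> nat -> R[i]) (l : 'I_m -> R[i]) :
  (forall k, is_sumC (u k) (l k)) ->
  is_sumC (fun n => \sum_k u k n) (\sum_k l k).
Proof.
move=> H; suff : forall s : seq 'I_m,
    is_sumC (fun n => \sum_(k <- s) u k n) (\sum_(k <- s) l k).
  by move=> /(_ (index_enum _)).
elim => [|k s IH].
  by rewrite big_nil; under eq_fun do rewrite big_nil; exact: is_sumC0.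
by rewrite big_cons; under eq_fun do rewrite big_cons; exact: is_sumCD.
Qed.

Lemma is_sumC_shift u l : is_sumC (fun n => u n.+1) l -> is_sumC u (u 0%N + l).
Proof.
have E (v : nat -> R) k : (series (fun n => v n.+1) @ \oo --> k) ->
    series v @ \oo --> v 0%N + k.
  move=> H; rewrite -cvg_shiftS.
  apply: eq_cvgn (cvgD (cvg_cst (v 0%N)) H) => n.
  by rewrite !fctE /series /= big_nat_recl.
move=> [H1 H2]; rewrite /is_sumC ReCD ImCD; split.
  exact: (E (fun n => complex.Re (u n))).
exact: (E (fun n => complex.Im (u n))).
Qed.

Lemma is_deriveC_series (f df : nat -> R -> R[i]) (K : R -> R) (q : R) : 0 <= q < 1 ->
  (forall n (x : R), is_deriveC (f n) x (df n x)) ->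
  (forall n x, modc (f n x) <= K `|x| * q ^+ n) ->
  (forall n B x, `|x| <= B -> modc (df n x) <= K B * q ^+ n) ->
  exists g dg : R -> R[i], forall x : R,
    [/\ is_sumC (f^~ x) (g x), is_sumC (df^~ x) (dg x) & is_deriveC g x (dg x)].
Proof.
move=> q01 dF bF bdF.
pose limC (u : nat -> R[i]) := limn (series (fun n => complex.Re (u n))) +i*
     limn (series (fun n => complex.Im (u n))).
exists (fun y => limC (f^~ y)), (fun y => limC (df^~ y)) => x; split.
- have [H1 _] := geometric_dominated q01 (fun n => le_trans (Re_le_modc _) (bF n x)).
  by have [H2 _] := geometric_dominated q01 (fun n => le_trans (Im_le_modc _) (bF n x)).
- have [H1 _] := geometric_dominated q01 (fun n => le_trans (Re_le_modc _) (bdF n _ x (lexx _))).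
  by have [H2 _] := geometric_dominated q01 (fun n => le_trans (Im_le_modc _) (bdF n _ x (lexx _))).
- split.
  + apply: (is_derive_series (f := fun n y => complex.Re (f n y))
      (df := fun n y => complex.Re (df n y)) (K := K) q01).
    * by move=> n y; have [] := dF n y.
    * by move=> n y; exact: le_trans (Re_le_modc _) (bF n y).
    * by move=> n B y yB; exact: le_trans (Re_le_modc _) (bdF n B y yB).
  + apply: (is_derive_series (f := fun n y => complex.Im (f n y))
      (df := fun n y => complex.Im (df n y)) (K := K) q01).
    * by move=> n y; have [] := dF n y.
    * by move=> n y; exact: le_trans (Im_le_modc _) (bF n y).
    * by move=> n B y yB; exact: le_trans (Im_le_modc _) (bdF n B y yB).
Qed.

Lemma is_sumC_bound u l (K q : R) : 0 <= q < 1 ->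
  (forall n, modc (u n) <= K * q ^+ n) -> is_sumC u l ->
  modc l <= 2 * (K / (1 - q)).
Proof.
move=> q01 uK [u1 u2]; apply: le_trans (modc_le _) _.
have [_ /(_ 0%N) H1] := geometric_dominated q01 (fun n => le_trans (Re_le_modc _) (uK n)).
have [_ /(_ 0%N) H2] := geometric_dominated q01 (fun n => le_trans (Im_le_modc _) (uK n)).
move: H1 H2; rewrite (cvg_lim _ u1) // (cvg_lim _ u2) // /series /= big_geq // big_geq //.
by rewrite !subr0 expr0 mulr1; lra.
Qed.

End GeometricSeries.

(** * Linear systems with decaying coupling *)

Section DecayingPerturbation.
Variable R : realType.

(** The exponential of the integral of L exp (- beta t) over [x, +oo[; it lies between 1 and exp (L
    / beta) for x >= 0 when L >= 0. *)
Definition decay_weight (beta L x : R) : R := expR (L / beta * expR (- beta * x)).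

Lemma decay_weight_gt0 beta L x : 0 < decay_weight beta L x.
Proof. exact: expR_gt0. Qed.

Lemma is_derive_expRM (c x : R) :
  is_derive x 1 (fun y => expR (c * y)) (c * expR (c * x)).
Proof.
apply: is_derive_fexp; apply: is_derive_eq_val (is_derive_fM (is_derive_cst c _ _) (is_derive_id _ _)) _.
by rewrite mul0r add0r mulr1.
Qed.

Lemma is_derive_decay_weight (beta L x : R) : 0 < beta ->
  is_derive x 1 (decay_weight beta L)
    (- (L * expR (- beta * x)) * decay_weight beta L x).
Proof.
move=> b0; apply: is_derive_fexp.
apply: is_derive_eq_val (is_derive_fM (is_derive_cst (L / beta) _ _) (is_derive_expRM _ _)) _.
by rewrite /=; field; rewrite gt_eqF.
Qed.

(** Variation of constants from infinity: S = exp(P) F with P' = p and F' = exp(-P) V. The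
    hypothesis on V says exactly that |F'| <= - G' for G = K exp (- Re P) W, where W is the decay
    weight, so F can be taken of modulus at most 2 G. *)
Lemma scalar_backward_solution (p V : R -> R[i]) (beta L K : R) :
  0 < beta -> 0 <= K -> (forall x, continuousC p x) -> (forall x, continuousC V x) ->
  (forall x, modc (V x) <=
     K * (complex.Re (p x) + L * expR (- beta * x)) * decay_weight beta L x) ->
  exists S : R -> R[i], forall x,
    is_deriveC S x (p x * S x + V x) /\ modc (S x) <= 2 * K * decay_weight beta L x.
Proof.
move=> b0 K0 cp cV VK.
have [P [dP _]] := antiderivativeC cp.
pose W := decay_weight beta L.
pose f x := expC (- P x) * V x.
pose G x := K * (expR (- complex.Re (P x)) * W x).
pose G' x := K * (- complex.Re (p x) * expR (- complex.Re (P x)) * W x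
   + expR (- complex.Re (P x)) * (- (L * expR (- beta * x)) * W x)).
have [||x|x|F HF] := @tail_antiderivativeC R f G G'.
- move=> x; apply: continuousCM => //.
  exact: (is_deriveC_continuous (is_deriveC_exp (is_deriveCN (dP x)))).
- move=> x; apply: is_derive_eq_val (is_derive_fM (is_derive_cst K _ _)
    (is_derive_fM (is_derive_fexp (is_derive_fN (dP x).1)) (is_derive_decay_weight L x b0))) _.
  by rewrite mul0r add0r.
- rewrite modcM expC_modc ReCN.
  apply: le_trans (ler_wpM2l (expR_ge0 _) (VK x)) _.
  by rewrite /G' -/(W x) le_eqVlt; apply/orP; left; apply/eqP; ring.
- by rewrite !mulr_ge0 // ?expR_ge0.
exists (fun x => expC (P x) * F x) => x; have [dF bF] := HF x; split.
  have := is_deriveCM (is_deriveC_exp (dP x)) dF.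
  rewrite /f; congr (is_deriveC _ _ _).
  by rewrite -mulrA; congr (_ + _); rewrite mulrA expCN mul1r.
rewrite modcM expC_modc.
apply: le_trans (ler_wpM2l (expR_ge0 _) bF) _.
rewrite /G -/(W x) expRN le_eqVlt; apply/orP; left; apply/eqP; field.
by rewrite gt_eqF // expR_gt0.
Qed.

Lemma continuousC_bounded (f : R -> R[i]) : (forall x, continuousC f x) ->
  exists M : R -> R, forall B, 0 <= M B /\ forall x, `|x| <= B -> modc (f x) <= M B.
Proof.
move=> cf.
have bnd (g : R -> R) : continuous g -> forall B, exists M, forall x, `|x| <= B -> `|g x| <= M.
  move=> cg B; have [B0|B0] := leP 0 B; last first.
    by exists 0 => x /le_lt_trans /(_ B0); rewrite normr_lt0.
  have [||c _ Hc] := @EVT_max R (fun x => `|g x|) (- B) B; first by lra.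
    apply: continuous_subspaceT => x; apply: continuous_comp; first exact: cg.
    exact: norm_continuous.
  by exists `|g c| => x xB; apply: Hc; rewrite in_itv /= -ler_norml.
have [|M1 H1] := choice (bnd (fun x => complex.Re (f x)) _).
  by move=> x; have [] := cf x.
have [|M2 H2] := choice (bnd (fun x => complex.Im (f x)) _).
  by move=> x; have [] := cf x.
exists (fun B => `|M1 B| + `|M2 B|) => B; split; first by rewrite addr_ge0.
move=> x xB; apply: le_trans (modc_le _) _; apply: lerD.
  by apply: le_trans (H1 _ _ xB) _; exact: ler_norm.
by apply: le_trans (H2 _ _ xB) _; exact: ler_norm.
Qed.

(* Picard iteration for the integral equation from infinity; the weight
   [decay_weight] absorbs the decaying part of the coupling, as in the usual
   proof of Volterra's theorem, and [Re (p j)] the rest. *)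
Lemma decaying_perturbation_solution n (beta L F0 : R) (d : 'I_n -> R)
    (p F : 'I_n -> R -> R[i]) (N : 'I_n -> 'I_n -> R -> R[i]) :
  0 < beta -> 0 <= L -> 0 <= F0 -> (forall j, 0 < d j) ->
  (forall j x, continuousC (p j) x) -> (forall j x, continuousC (F j) x) ->
  (forall j k x, continuousC (N j k) x) ->
  (forall j x, 0 <= complex.Re (p j x)) ->
  (forall j x, \sum_k modc (N j k x) * d k <=
     8^-1 * d j * (complex.Re (p j x) + L * expR (- beta * x))) ->
  (forall j x, modc (F j x) <= F0 * d j * (complex.Re (p j x) + L * expR (- beta * x))) ->
  exists Z : 'I_n -> R -> R[i], forall j x,
    is_deriveC (Z j) x (p j x * Z j x + \sum_k N j k x * Z k x + F j x) /\
    modc (Z j x) <= 6 * F0 * d j * decay_weight beta L x.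
Proof.
move=> b0 L0 F00 d0 cp cF cN p0 bN bF.
pose W := decay_weight beta L.
have W0 x : 0 < W x := decay_weight_gt0 beta L x.
pose g j x := complex.Re (p j x) + L * expR (- beta * x).
have g0 j x : 0 <= g j x by rewrite addr_ge0 ?mulr_ge0 ?expR_ge0.
(* The solution operator is made total by the zero function, so that the iterates form a plain
   recursion whose estimates are proved afterwards. *)
have /choice[S HS] : forall t : 'I_n * (R -> R[i]) * R, exists S : R -> R[i],
    0 <= t.2 -> (forall x, continuousC t.1.2 x) ->
    (forall x, modc (t.1.2 x) <= t.2 * g t.1.1 x * W x) ->
    forall x, is_deriveC S x (p t.1.1 x * S x + t.1.2 x) /\
       modc (S x) <= 2 * t.2 * W x.
  move=> [[j V] K] /=.
  have [[K0 cV HV]|nH] := pselect [/\ 0 <= K, forall x, continuousC V x &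
    forall x, modc (V x) <= K * g j x * W x].
    have [S HS] := scalar_backward_solution b0 K0 (cp j) cV HV.
    by exists S => _ _ _ x; exact: HS.
  by exists (fun=> 0) => K0 cV HV; case: nH.
(* Ratio of the iteration: the factor 2 of the scalar solution times the factor 1/8 allowed to the
   coupling. *)
pose q : R := 4^-1.
have q01 : 0 <= q < 1 by rewrite /q; lra.
have [q0 _] := andP q01.
(* [D m] is the increment of the m-th iterate: [D 0] answers the source F, and [D m.+1] the coupling
   applied to [D m]. The solution is the sum of all of them. *)
pose D := fix D (m : nat) (j : 'I_n) {struct m} : R -> R[i] :=
  S (j, (if m is m'.+1 then fun x => \sum_k N j k x * D m' k x else F j),
     F0 * d j * q ^+ m).
pose V m j : R -> R[i] :=
  if m is m'.+1 then fun x => \sum_k N j k x * D m' k x else F j.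
have K0 k m : 0 <= F0 * d k * q ^+ m.
  by rewrite mulr_ge0 ?exprn_ge0 // mulr_ge0 // ltW.
have DE m j : D m j = S (j, V m j, F0 * d j * q ^+ m) by case: m.
have HV m : forall j, (forall x, continuousC (V m j) x) /\
    (forall x, modc (V m j x) <= F0 * d j * q ^+ m * g j x * W x).
  elim: m => [|m IH] j.
    split=> [x|x]; first exact: cF.
    rewrite expr0 mulr1 /=; apply: le_trans (bF j x) _.
    have W1 : 1 <= W x.
      by rewrite /W /decay_weight -expR0 ler_expR mulr_ge0 ?expR_ge0 // divr_ge0 // ltW.
    have E0 : 0 <= F0 * d j * g j x by rewrite !mulr_ge0 // ltW.
    exact: ler_peMr.
  have HD k x : is_deriveC (D m k) x (p k x * D m k x + V m k x) /\
      modc (D m k x) <= 2 * (F0 * d k * q ^+ m) * W x.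
    rewrite DE; have [cV bV] := IH k.
    by apply: (HS (k, V m k, F0 * d k * q ^+ m)) => //=; exact: K0.
  split=> x /=.
    apply: continuousC_sum => k; apply: continuousCM => //.
    exact: is_deriveC_continuous (HD k x).1.
  apply: le_trans (modc_sum _ _ _) _.
  apply: (@le_trans _ _ (\sum_k modc (N j k x) * d k * (2 * F0 * q ^+ m * W x))).
    apply: ler_sum => k _; rewrite modcM -mulrA ler_wpM2l ?modc_ge0 //.
    apply: le_trans (HD k x).2 _; rewrite le_eqVlt; apply/orP; left; apply/eqP; ring.
  rewrite -mulr_suml.
  apply: le_trans (ler_wpM2r _ (bN j x)) _.
    by rewrite !mulr_ge0 ?exprn_ge0 // ltW.
  by rewrite exprS /q /g le_eqVlt; apply/orP; left; apply/eqP; field.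
have HD m k x : is_deriveC (D m k) x (p k x * D m k x + V m k x) /\
    modc (D m k x) <= 2 * (F0 * d k * q ^+ m) * W x.
  rewrite DE; have [cV bV] := HV m k.
  by apply: (HS (k, V m k, F0 * d k * q ^+ m)) => //=; exact: K0.
have W_mono x y : x <= y -> W y <= W x.
  move=> xy; rewrite /W /decay_weight ler_expR ler_wpM2l //.
    by rewrite divr_ge0 // ltW.
  by rewrite ler_expR !mulNr lerN2 ler_pM2l.
have HZ j : exists Z dZ : R -> R[i], forall x,
    [/\ is_sumC (fun m => D m j x) (Z x),
        is_sumC (fun m => p j x * D m j x + V m j x) (dZ x) & is_deriveC Z x (dZ x)].
  have [M HM] := continuousC_bounded (cp j).
  (* A common bound on |x| <= B for both series: 2 for [D m], 2 M for p D, and M + L exp (beta B)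
     for V. The weight decreases, so its value at - B dominates. *)
  pose K B := F0 * d j * W (- B) * (3 * M B + L * expR (- beta * - B) + 2).
  have KE B x : `|x| <= B -> F0 * d j * W x <= F0 * d j * W (- B).
    rewrite ler_norml => /andP[xB _].
    by rewrite ler_wpM2l ?mulr_ge0 // ?(ltW (d0 j)) // W_mono.
  apply: (is_deriveC_series (f := fun m x => D m j x)
    (df := fun m x => p j x * D m j x + V m j x) (K := K) q01).
  - by move=> m x; exact: (HD m j x).1.
  - move=> m x; apply: le_trans (HD m j x).2 _.
    rewrite [leLHS](_ : _ = 2 * (F0 * d j * W x) * q ^+ m); last by ring.
    rewrite ler_wpM2r ?exprn_ge0 // /K [leRHS]mulrC.
    have [MB _] := HM `|x|.
    have E1 : 2 <= 3 * M `|x| + L * expR (- beta * - `|x|) + 2.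
      by rewrite lerDr addr_ge0 ?mulr_ge0 ?expR_ge0.
    have E3 : 0 <= F0 * d j * W x by rewrite !mulr_ge0 // ltW.
    exact: ler_pM (ler0n _ 2) E3 E1 (KE _ _ (lexx _)).
  - move=> m B x xB; have [MB /(_ x xB) px] := HM B.
    have bD := (HD m j x).2; have bV := (HV m j).2 x.
    apply: le_trans (modcD _ _) _; rewrite modcM.
    have gB : g j x <= M B + L * expR (- beta * - B).
      apply: lerD; first exact: le_trans (ler_norm _) (le_trans (Re_le_modc _) px).
      rewrite ler_wpM2l // ler_expR !mulNr lerN2 ler_pM2l //.
      by move: xB; rewrite ler_norml => /andP[].
    have E0 : 0 <= F0 * d j * W x by rewrite !mulr_ge0 // ltW.
    have H1 : modc (p j x) * modc (D m j x) <= M B * (2 * (F0 * d j * W x) * q ^+ m).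
      apply: ler_pM; rewrite ?modc_ge0 //; apply: le_trans bD _.
      by rewrite le_eqVlt; apply/orP; left; apply/eqP; ring.
    have H2 : modc (V m j x) <= (M B + L * expR (- beta * - B)) * ((F0 * d j * W x) * q ^+ m).
      apply: le_trans bV _.
      rewrite [leLHS](_ : _ = g j x * ((F0 * d j * W x) * q ^+ m)); last by ring.
      by rewrite ler_wpM2r // mulr_ge0 // exprn_ge0.
    apply: le_trans (lerD H1 H2) _.
    rewrite [leLHS](_ : _ = (3 * M B + L * expR (- beta * - B)) * (F0 * d j * W x) * q ^+ m); last by ring.
    rewrite ler_wpM2r ?exprn_ge0 // /K [leRHS]mulrC.
    apply: ler_pM; [| | |exact: KE].
    + by apply: addr_ge0; [apply: mulr_ge0|apply: mulr_ge0; last exact: expR_ge0].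
    + by rewrite mulr_ge0 // ?(ltW (W0 x)) // mulr_ge0 // ltW.
    + by rewrite lerDl.
have [Z HZZ] := choice HZ.
exists Z => j x; have [dZ /(_ x) [sZ sdZ dZx]] := HZZ j; split; last first.
  have := is_sumC_bound q01 (K := 2 * (F0 * d j) * W x) _ sZ.
  rewrite /q => H; apply: le_trans (H _) _.
    move=> m; apply: le_trans (HD m j x).2 _.
    by rewrite /q le_eqVlt; apply/orP; left; apply/eqP; ring.
  (* The series gives 2 * 2 / (1 - 1/4) = 16/3, which is at most 6. *)
  rewrite -subr_ge0 [leRHS](_ : _ = (2 / 3) * (F0 * d j * W x)); last by rewrite /W; field.
  by rewrite !mulr_ge0 // ltW.
suff -> : p j x * Z j x + \sum_k N j k x * Z k x + F j x = dZ x by [].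
apply: is_sumC_unique sdZ.
rewrite -addrA; apply: is_sumCD; first exact: is_sumCZ.
(* The sources are F followed by the coupling applied to the iterates, so summing them shifts the
   index by one. *)
rewrite addrC; apply: (is_sumC_shift (u := fun m => V m j x)) => /=.
apply: is_sumC_sum => k; apply: is_sumCZ.
by have [dZk /(_ x) []] := HZZ k.
Qed.

End DecayingPerturbation.

(** * Triple power series *)

Section TripleSeries.
Variable R : realType.
Implicit Types (T c : nat -> nat -> nat -> R).

Definition box_sum T (l m n : nat) : R :=
  \sum_(i < l) \sum_(j < m) \sum_(k < n) T i j k.

(** All its box sums are at most 8 = 2^3: domination by a multiple of it gives convergence and a
    bound together. *)
Definition half_pow (i j k : nat) : R := 2^-1 ^+ i * 2^-1 ^+ j * 2^-1 ^+ k.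

Lemma half_pow_ge0 i j k : 0 <= half_pow i j k.
Proof. by rewrite !mulr_ge0 // exprn_ge0. Qed.

Lemma sum_half_le n : \sum_(i < n) (2^-1 : R) ^+ i <= 2.
Proof.
suff -> : \sum_(i < n) (2^-1 : R) ^+ i = 2 - 2 * 2^-1 ^+ n.
  by rewrite gerBl mulr_ge0 // exprn_ge0.
elim: n => [|n IH]; first by rewrite big_ord0 expr0 mulr1 subrr.
by rewrite big_ord_recr /= IH exprS; field.
Qed.

Lemma box_sum_half_le l m n : box_sum half_pow l m n <= 8.
Proof.
have -> : box_sum half_pow l m n = (\sum_(i < l) 2^-1 ^+ i) *
    (\sum_(j < m) 2^-1 ^+ j) * (\sum_(k < n) 2^-1 ^+ k).
  rewrite /box_sum /half_pow -mulrA mulr_suml; apply: eq_bigr => i _.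
  rewrite mulr_suml mulr_sumr; apply: eq_bigr => j _.
  by rewrite !mulr_sumr; apply: eq_bigr => k _; rewrite mulrA.
have g0 p : 0 <= \sum_(i < p) (2^-1 : R) ^+ i by rewrite sumr_ge0 // => i _; rewrite exprn_ge0.
rewrite [leRHS](_ : _ = 2 * 2 * 2); last by ring.
by apply: ler_pM; rewrite ?mulr_ge0 ?g0 ?sum_half_le //; apply: ler_pM; rewrite ?g0 ?sum_half_le.
Qed.

Lemma box_sum_le_norm T U l m n : (forall i j k, `|T i j k| <= U i j k) ->
  `|box_sum T l m n| <= box_sum U l m n.
Proof.
move=> H; apply: le_trans (ler_norm_sum _ _ _) _; apply: ler_sum => i _.
apply: le_trans (ler_norm_sum _ _ _) _; apply: ler_sum => j _.
by apply: le_trans (ler_norm_sum _ _ _) _; apply: ler_sum => k _.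
Qed.

Lemma box_sumZ (b : R) T l m n : box_sum (fun i j k => b * T i j k) l m n = b * box_sum T l m n.
Proof.
rewrite /box_sum mulr_sumr; apply: eq_bigr => i _.
rewrite mulr_sumr; apply: eq_bigr => j _; by rewrite mulr_sumr.
Qed.

Lemma box_sumD T U l m n : box_sum (fun i j k => T i j k + U i j k) l m n =
  box_sum T l m n + box_sum U l m n.
Proof.
rewrite /box_sum -big_split; apply: eq_bigr => i _.
rewrite -big_split; apply: eq_bigr => j _; by rewrite -big_split.
Qed.

Lemma eq_box_sum T U l m n : (forall i j k, T i j k = U i j k) ->
  box_sum T l m n = box_sum U l m n.
Proof.
by move=> H; apply: eq_bigr => i _; apply: eq_bigr => j _; apply: eq_bigr => k _.
Qed.

Lemma box_sum_bound T (B : R) l m n : 0 <= B ->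
  (forall i j k, `|T i j k| <= B * half_pow i j k) -> `|box_sum T l m n| <= 8 * B.
Proof.
move=> B0 H; apply: le_trans (box_sum_le_norm _ _ _ H) _.
by rewrite box_sumZ mulrC ler_wpM2r // box_sum_half_le.
Qed.

Lemma box_sum_nondecreasing T : (forall i j k, 0 <= T i j k) ->
  nondecreasing_seq (fun n => box_sum T n n n).
Proof.
move=> T0; apply/nondecreasing_seqP => n; rewrite /box_sum big_ord_recr /=.
rewrite -[leLHS]addr0; apply: lerD; last first.
  by rewrite sumr_ge0 // => j _; rewrite sumr_ge0.
apply: ler_sum => i _; rewrite big_ord_recr /= -[leLHS]addr0; apply: lerD; last first.
  by rewrite sumr_ge0.
by apply: ler_sum => j _; rewrite big_ord_recr /= lerDl.
Qed.

Lemma box_sum_cvg_ge0 T (B : R) : (forall i j k, 0 <= T i j k) ->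
  (forall i j k, T i j k <= B * half_pow i j k) -> cvgn (fun n => box_sum T n n n).
Proof.
move=> T0 TB; apply: nondecreasing_is_cvgn; first exact: box_sum_nondecreasing.
have B0 : 0 <= B.
  by have := le_trans (T0 0%N 0%N 0%N) (TB 0%N 0%N 0%N); rewrite /half_pow !expr0 !mulr1.
exists (8 * B) => _ [n _ <-]; apply: le_trans (ler_norm _) _.
by apply: box_sum_bound => // i j k; rewrite ger0_norm.
Qed.

Lemma box_sum_cvg T (B : R) : (forall i j k, `|T i j k| <= B * half_pow i j k) ->
  cvgn (fun n => box_sum (fun i j k => `|T i j k|) n n n) /\
  cvgn (fun n => box_sum T n n n).
Proof.
move=> TB.
have H1 : cvgn (fun n => box_sum (fun i j k => `|T i j k|) n n n).
  exact: box_sum_cvg_ge0 TB.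
split => //.
have H2 : cvgn (fun n => box_sum (fun i j k => T i j k + `|T i j k|) n n n).
  apply: (@box_sum_cvg_ge0 _ (2 * B)) => i j k.
    by have := ler_norm (- T i j k); rewrite normrN; lra.
  by have := ler_norm (T i j k); have := TB i j k; lra.
have -> : (fun n => box_sum T n n n) =
    (fun n => box_sum (fun i j k => T i j k + `|T i j k|) n n n) \-
    (fun n => box_sum (fun i j k => `|T i j k|) n n n).
  by apply/funext => n /=; rewrite box_sumD addrK.
exact: is_cvgB.
Qed.

Definition mono c (x y z : R) (i j k : nat) : R := c i j k * x ^+ i * y ^+ j * z ^+ k.

(** Cauchy's estimates on the polydisc of radius r. *)
Definition geometric_coeff c (r A : R) :=
  forall i j k, `|c i j k| * (r ^+ i * r ^+ j * r ^+ k) <= A.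

Lemma geometric_coeff_ge0 c r A : 0 < r -> geometric_coeff c r A -> 0 <= A.
Proof.
move=> r0 /(_ 0%N 0%N 0%N); rewrite !expr0 !mulr1; exact: le_trans.
Qed.

Lemma mono_bound c (r A s x y z : R) i j k : 0 < r -> geometric_coeff c r A ->
  0 <= s -> `|x| <= s * r -> `|y| <= s * r -> `|z| <= s * r ->
  `|mono c x y z i j k| <= A * (s ^+ i * s ^+ j * s ^+ k).
Proof.
move=> r0 cA s0 xr yr zr; rewrite /mono !normrM !normrX.
have pw (t : R) n : `|t| <= s * r -> `|t| ^+ n <= (s * r) ^+ n.
  by move=> H; rewrite lerXn2r ?nnegrE ?mulr_ge0 // ltW.
apply: (@le_trans _ _ (`|c i j k| * (s * r) ^+ i * (s * r) ^+ j * (s * r) ^+ k)).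
  by rewrite !ler_pM ?mulr_ge0 ?exprn_ge0 ?pw.
rewrite [leLHS](_ : _ = (`|c i j k| * (r ^+ i * r ^+ j * r ^+ k)) * (s ^+ i * s ^+ j * s ^+ k)).
  by rewrite ler_wpM2r // !mulr_ge0 ?exprn_ge0.
by rewrite !exprMn; ring.
Qed.

(** The remainder is at most n^2 M^(n-2) (y - x)^2; the factor M^2 on the left avoids the exponent n
    - 2 and a division by M. *)
Lemma pow_diff_bound (M x y : R) n : 0 <= M -> `|x| <= M -> `|y| <= M ->
  M ^+ 2 * `|y ^+ n - x ^+ n - (y - x) * (n%:R * x ^+ n.-1)| <= n%:R ^+ 2 * M ^+ n * (y - x) ^+ 2.
Proof.
move=> M0 xM yM.
have E m : `|m.+1%:R * x ^+ m| * M <= m.+1%:R * M ^+ m.+1.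
  rewrite normrM normrX ger0_norm // -mulrA exprSr.
  by rewrite ler_wpM2l // ler_wpM2r // lerXn2r ?nnegrE.
elim: n => [|n IH]; first by rewrite !expr0 subrr mul0r mulr0 subr0 normr0 mulr0 expr0n !mul0r.
have -> : y ^+ n.+1 - x ^+ n.+1 - (y - x) * (n.+1%:R * x ^+ n.+1.-1) =
    y * (y ^+ n - x ^+ n - (y - x) * (n%:R * x ^+ n.-1)) +
    (y - x) ^+ 2 * (n%:R * x ^+ n.-1).
  case: n {IH} => [|n]; first by rewrite /= !expr0 expr1; ring.
  by rewrite /= -(natr1 n.+1) !exprS; ring.
apply: le_trans (ler_wpM2l (exprn_ge0 2 M0) (ler_normD _ _)) _.
rewrite mulrDr (normrM y) mulrCA (normrM ((y - x) ^+ 2)) (ger0_norm (sqr_ge0 _)).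
have H1 : `|y| * (M ^+ 2 * `|y ^+ n - x ^+ n - (y - x) * (n%:R * x ^+ n.-1)|) <=
    M * (n%:R ^+ 2 * M ^+ n * (y - x) ^+ 2).
  by apply: ler_pM; rewrite ?mulr_ge0 ?exprn_ge0.
have H2 : M ^+ 2 * ((y - x) ^+ 2 * `|n%:R * x ^+ n.-1|) <= n%:R * M ^+ n.+1 * (y - x) ^+ 2.
  case: n {IH H1} => [|n]; first by rewrite !mul0r normr0 !mulr0.
  rewrite [leLHS](_ : _ = (`|n.+1%:R * x ^+ n| * M) * (M * (y - x) ^+ 2)); last by ring.
  apply: le_trans (ler_wpM2r _ (E n)) _; first by rewrite mulr_ge0 ?sqr_ge0.
  by rewrite (exprSr M n.+1) le_eqVlt; apply/orP; left; apply/eqP; ring.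
apply: le_trans (lerD H1 H2) _.
have -> : M * (n%:R ^+ 2 * M ^+ n * (y - x) ^+ 2) + n%:R * M ^+ n.+1 * (y - x) ^+ 2 =
    (n%:R ^+ 2 + n%:R) * (M ^+ n.+1 * (y - x) ^+ 2) by rewrite (exprS M n); ring.
rewrite -[leRHS]mulrA; apply: ler_wpM2r; first by rewrite mulr_ge0 ?sqr_ge0 ?exprn_ge0.
by rewrite -natr1; have : 0 <= n%:R :> R by []; nra.
Qed.

Lemma sqr_half_pow n : n%:R ^+ 2 * (4^-1 : R) ^+ n <= 2 * 2^-1 ^+ n.
Proof.
have -> : (4^-1 : R) = 2^-1 * 2^-1 by field.
rewrite exprMn mulrA ler_wpM2r ?exprn_ge0 //.
have H m : (m%:R ^+ 2 <= 2 * 2 ^+ m :> R).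
  case: m => [|[|[|m]]]; rewrite ?expr0 ?expr1; [lra|lra|lra|].
  (* From 3 on, (n + 1)^2 <= 2 n^2. *)
  elim: m => [|m IH]; first by lra.
  have : (3 : R) <= m.+3%:R by rewrite ler_nat.
  rewrite (exprS _ m.+3) -(natr1 m.+3); nra.
have p0 : 0 < (2 : R) ^+ n by rewrite exprn_gt0.
rewrite -(ler_pM2r p0) -mulrA -exprMn mulVf ?pnatr_eq0 // expr1n mulr1.
exact: H.
Qed.

Definition diff_coeff c i j k : R := i.+1%:R * c i.+1 j k.

(** Halving the radius absorbs the new factor: (i + 1) / 2^i <= 2. *)
Lemma geometric_coeff_diff c (r A : R) : 0 < r -> geometric_coeff c r A ->
  geometric_coeff (diff_coeff c) (r / 2) (A * 2 / r).
Proof.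
move=> r0 cA i j k; have A0 := geometric_coeff_ge0 r0 cA.
rewrite /diff_coeff normrM ger0_norm // !exprMn.
have hp n : (2^-1 : R) ^+ n <= 1 by rewrite exprn_ile1 // invf_le1 // ler1n.
have nb : i.+1%:R * (2^-1 : R) ^+ i <= 2.
  elim: i => [|i IH]; first by rewrite expr0; lra.
  have : 0 <= (2^-1 : R) ^+ i by rewrite exprn_ge0.
  have : 1 <= i.+1%:R :> R by rewrite ler1n.
  rewrite -natr1 exprS; move: IH; nra.
rewrite [leLHS](_ : _ = (`|c i.+1 j k| * (r ^+ i.+1 * r ^+ j * r ^+ k)) / r *
  ((i.+1%:R * 2^-1 ^+ i) * 2^-1 ^+ j * 2^-1 ^+ k)).
  rewrite [leRHS](_ : _ = A / r * 2); last by ring.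
  apply: ler_pM.
  - by rewrite divr_ge0 ?mulr_ge0 ?exprn_ge0 ?(ltW r0) //.
  - by rewrite !mulr_ge0 ?exprn_ge0.
  - by rewrite ler_pM2r ?invr_gt0.
  - rewrite -[leRHS]mulr1 -[leRHS]mulr1; apply: ler_pM; rewrite ?mulr_ge0 ?exprn_ge0 //.
    by apply: ler_pM; rewrite ?mulr_ge0 ?exprn_ge0.
rewrite exprS; field; by rewrite gt_eqF.
Qed.

Lemma box_sum_recl T l m n : box_sum T l.+1 m n =
  \sum_(j < m) \sum_(k < n) T 0%N j k + box_sum (fun i j k => T i.+1 j k) l m n.
Proof. by rewrite /box_sum big_ord_recl. Qed.

(** Differentiation in the first variable lowers its degree, so a cubic box of the derivative
    belongs to a box of the series longer by one slab. The slab has size O(2^-n). *)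
Lemma box_sum_slab_cvg c (r A x y z l : R) : 0 < r -> geometric_coeff c r A ->
  `|x| <= r / 2 -> `|y| <= r / 2 -> `|z| <= r / 2 ->
  (fun n => box_sum (mono c x y z) n n n) @ \oo --> l ->
  (fun n => box_sum (mono c x y z) n.+1 n n) @ \oo --> l.
Proof.
move=> r0 cA xr yr zr cl; have A0 := geometric_coeff_ge0 r0 cA.
have mb i j k : `|mono c x y z i j k| <= A * half_pow i j k.
  by apply: (mono_bound (r := r)); rewrite // mulrC.
pose D n := \sum_(j < n) \sum_(k < n) mono c x y z n j k.
have DB n : `|D n| <= 8 * A * 2^-1 ^+ n.
  have -> : D n = box_sum (fun i j k => mono c x y z (n + i) j k) 1 n n.
    by rewrite /box_sum big_ord1 addn0.
  rewrite -mulrA; apply: box_sum_bound; first by rewrite mulr_ge0 ?exprn_ge0.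
  by move=> i j k; apply: le_trans (mb _ _ _) _; rewrite /half_pow exprD !mulrA.
have D0 : D @ \oo --> 0.
  apply/cvgr0Pnorm_le => e e0.
  have h01 : 0 <= (2^-1 : R) < 1 by lra.
  have [N HN] := geometric_small (8 * A) h01 e0.
  near=> n; apply: le_trans (DB n) _; apply: le_trans HN.
  rewrite ler_wpM2l ?mulr_ge0 // ler_wiXn2l //; first by lra.
  by near: n; exact: nbhs_infty_ge.
have H : (fun n => box_sum (mono c x y z) n n n + D n) @ \oo --> l.
  by rewrite -[l]addr0; exact: cvgD.
apply: eq_cvgn H => n.
by rewrite /box_sum big_ord_recr.
Unshelve. all: by end_near. Qed.

(** Unlike the expansion at the centre, this compares two points x and t of the polydisc and so
    identifies the differentiated series with the derivative throughout. In the constant 16 A / (r /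
    4)^2, 8 is the sum of the dominating series and 2 comes from n^2 / 4^n <= 2 / 2^n. *)
Lemma triple_series_quad c (r A x y z t lx lt d : R) : 0 < r -> geometric_coeff c r A ->
  `|x| <= r / 4 -> `|t| <= r / 4 -> `|y| <= r / 4 -> `|z| <= r / 4 ->
  (fun n => box_sum (mono c x y z) n n n) @ \oo --> lx ->
  (fun n => box_sum (mono c t y z) n n n) @ \oo --> lt ->
  (fun n => box_sum (mono (diff_coeff c) x y z) n n n) @ \oo --> d ->
  `|lt - lx - (t - x) * d| <= 16 * A / (r / 4) ^+ 2 * (t - x) ^+ 2.
Proof.
move=> r0 cA xr tr yr zr cx ct cd; have A0 := geometric_coeff_ge0 r0 cA.
have {}cx := box_sum_slab_cvg r0 cA (_ : `|x| <= r / 2) (_ : `|y| <= r / 2) (_ : `|z| <= r / 2) cx.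
have {}cx : (fun n => box_sum (mono c x y z) n.+1 n n) @ \oo --> lx by apply: cx; lra.
have {}ct := box_sum_slab_cvg r0 cA (_ : `|t| <= r / 2) (_ : `|y| <= r / 2) (_ : `|z| <= r / 2) ct.
have {}ct : (fun n => box_sum (mono c t y z) n.+1 n n) @ \oo --> lt by apply: ct; lra.
have cu : (fun n => box_sum (mono c t y z) n.+1 n n - box_sum (mono c x y z) n.+1 n n -
    (t - x) * box_sum (mono (diff_coeff c) x y z) n n n) @ \oo --> lt - lx - (t - x) * d.
  by apply: cvgB; [exact: cvgB|apply: cvgM => //; exact: cvg_cst].
rewrite -[X in `|X|]subr0; apply: (@limn_dist_le _ _ _ _ _ 0%N) cu _ => n _.
rewrite subr0.
pose U i j k := c i j k * (t ^+ i - x ^+ i - (t - x) * (i%:R * x ^+ i.-1)) * y ^+ j * z ^+ k.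
have -> : box_sum (mono c t y z) n.+1 n n - box_sum (mono c x y z) n.+1 n n -
    (t - x) * box_sum (mono (diff_coeff c) x y z) n n n = box_sum U n.+1 n n.
  have -> : box_sum (mono (diff_coeff c) x y z) n n n =
      box_sum (fun i j k => c i j k * (i%:R * x ^+ i.-1) * y ^+ j * z ^+ k) n.+1 n n.
    rewrite box_sum_recl big1 ?add0r; last first.
      by move=> j _; rewrite big1 // => k _; rewrite !mul0r mulr0 !mul0r.
    by apply: eq_box_sum => i j k; rewrite /mono /diff_coeff /=; ring.
  rewrite -box_sumZ -[- box_sum (mono c x y z) _ _ _]mulN1r -box_sumZ.
  rewrite -[- box_sum _ _ _ _]mulN1r -box_sumZ -!box_sumD.
  by apply: eq_box_sum => i j k; rewrite /U /mono; ring.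
have M0 : 0 < (r / 4) ^+ 2 by rewrite exprn_gt0 // divr_gt0.
rewrite [leRHS](_ : _ = 8 * (2 * A / (r / 4) ^+ 2 * (t - x) ^+ 2)); last by ring.
apply: box_sum_bound => [|i j k].
  by rewrite mulr_ge0 ?sqr_ge0 // divr_ge0 ?mulr_ge0 // ltW.
rewrite /U !normrM !normrX -(ler_pM2l M0).
have r40 : 0 <= r / 4 by rewrite divr_ge0 // ltW.
have pd := pow_diff_bound i r40 xr tr.
have yj : `|y| ^+ j <= (r / 4) ^+ j by rewrite lerXn2r ?nnegrE.
have zk : `|z| ^+ k <= (r / 4) ^+ k by rewrite lerXn2r ?nnegrE.
apply: (@le_trans _ _ (`|c i j k| * (i%:R ^+ 2 * (r / 4) ^+ i * (t - x) ^+ 2) *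
    (r / 4) ^+ j * (r / 4) ^+ k)).
  rewrite [leLHS](_ : _ = `|c i j k| * ((r / 4) ^+ 2 *
    `|t ^+ i - x ^+ i - (t - x) * (i%:R * x ^+ i.-1)|) * `|y| ^+ j * `|z| ^+ k).
    have HA := ler_wpM2l (normr_ge0 (c i j k)) pd.
    apply: (ler_pM _ _ (ler_pM _ _ HA yj) zk); rewrite ?mulr_ge0 ?exprn_ge0 ?(ltW r0) //.
  by ring.
rewrite !exprMn [leLHS](_ : _ = (`|c i j k| * (r ^+ i * r ^+ j * r ^+ k)) *
   (i%:R ^+ 2 * 4^-1 ^+ i * (4^-1 ^+ j * 4^-1 ^+ k)) * (t - x) ^+ 2); last by ring.
rewrite [leRHS](_ : _ = A * (2 * 2^-1 ^+ i * (2^-1 ^+ j * 2^-1 ^+ k)) * (t - x) ^+ 2); last first.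
  by rewrite /half_pow; field; rewrite gt_eqF.
rewrite ler_wpM2r ?sqr_ge0 //.
have q4 m : (4^-1 : R) ^+ m <= 2^-1 ^+ m by rewrite lerXn2r ?nnegrE //; lra.
have H1 : i%:R ^+ 2 * (4^-1 : R) ^+ i * (4^-1 ^+ j * 4^-1 ^+ k) <=
    2 * 2^-1 ^+ i * (2^-1 ^+ j * 2^-1 ^+ k).
  have H2 : (4^-1 : R) ^+ j * 4^-1 ^+ k <= 2^-1 ^+ j * 2^-1 ^+ k.
    by apply: ler_pM; rewrite ?exprn_ge0.
  by apply: ler_pM (sqr_half_pow i) H2; rewrite !mulr_ge0 ?exprn_ge0.
by apply: ler_pM (cA i j k) H1; rewrite !mulr_ge0 ?exprn_ge0 ?(ltW r0).
Qed.

Lemma sum_ord_first2 (g : nat -> R) n : (forall k, g k.+2 = 0) ->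
  \sum_(k < n.+2) g k = g 0%N + g 1%N.
Proof.
by move=> g0; rewrite big_ord_recl big_ord_recl big1 ?addr0 // => k _; exact: g0.
Qed.

(** With s = (|x| + |y| + |z|) / r <= 1/2, the terms of degree at least 2 are at most 4 A s^2 times
    those of [half_pow], whose sum is at most 8; hence the constant 32. *)
Lemma triple_series_taylor c (r A x y z l : R) : 0 < r -> geometric_coeff c r A ->
  `|x| + `|y| + `|z| <= r / 2 ->
  (fun n => box_sum (mono c x y z) n n n) @ \oo --> l ->
  `|l - (c 0%N 0%N 0%N + c 1%N 0%N 0%N * x + c 0%N 1%N 0%N * y + c 0%N 0%N 1%N * z)|
    <= 32 * A / r ^+ 2 * (`|x| + `|y| + `|z|) ^+ 2.
Proof.
move=> r0 cA hs cl; have A0 := geometric_coeff_ge0 r0 cA.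
set sg := `|x| + `|y| + `|z| in hs *.
pose s := sg / r.
have sg0 : 0 <= sg by rewrite !addr_ge0.
have s0 : 0 <= s by rewrite divr_ge0 // ltW.
have s2 : s <= 2^-1 by rewrite ler_pdivrMr // mulrC.
have sr : s * r = sg by rewrite /s mulfVK // gt_eqF.
have mb i j k : `|mono c x y z i j k| <= A * (s ^+ i * s ^+ j * s ^+ k).
  apply: (mono_bound (r := r)) => //; rewrite sr /sg; have := normr_ge0 x; have := normr_ge0 y; have := normr_ge0 z; lra.
apply: (@limn_dist_le _ _ _ _ _ 2%N) cl _ => n; case: n => [|[|n]] // _.
pose T i j k := if (i + j + k < 2)%N then 0 else mono c x y z i j k.
pose L i j k := if (i + j + k < 2)%N then mono c x y z i j k else 0.
have -> : box_sum (mono c x y z) n.+2 n.+2 n.+2 = box_sum L n.+2 n.+2 n.+2 + box_sum T n.+2 n.+2 n.+2.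
  rewrite -box_sumD; apply: eq_box_sum => i j k; rewrite /L /T.
  by case: ifP; rewrite ?addr0 ?add0r.
have -> : box_sum L n.+2 n.+2 n.+2 = c 0%N 0%N 0%N + c 1%N 0%N 0%N * x + c 0%N 1%N 0%N * y + c 0%N 0%N 1%N * z.
  have L3 i j k : L i j k.+2 = 0 by rewrite /L !addnS.
  have L2 i j k : L i j.+2 k = 0 by rewrite /L !addnS.
  have L1 i j k : L i.+2 j k = 0 by rewrite /L !addSn.
  rewrite /box_sum (sum_ord_first2 (g := fun i => \sum_(j < n.+2) \sum_(k < n.+2) L i j k)); last first.
    by move=> i; rewrite big1 // => j _; rewrite big1.
  rewrite !(sum_ord_first2 (g := fun j => \sum_(k < n.+2) L _ j k)); try by move=> j; rewrite big1.
  rewrite !(sum_ord_first2 (g := fun k => L _ _ k)) //.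
  by rewrite /L /mono /= !expr0 !expr1; ring.
rewrite addrAC subrr add0r.
rewrite [leRHS](_ : _ = 8 * (4 * A * s ^+ 2)); last first.
  by rewrite /s expr_div_n; ring.
have As : 0 <= 4 * A * s ^+ 2 by rewrite mulr_ge0 ?exprn_ge0 // mulr_ge0.
apply: box_sum_bound => // i j k.
rewrite /T; case: ltnP => [_|ge2]; first by rewrite normr0; exact: mulr_ge0 As (half_pow_ge0 _ _ _).
have ge : s ^+ (i + j + k) <= 4 * s ^+ 2 * 2^-1 ^+ (i + j + k).
  rewrite -(subnKC ge2); move: (i + j + k - 2)%N => m; rewrite !exprD.
  have -> : 4 * s ^+ 2 * ((2^-1) ^+ 2 * (2^-1) ^+ m) = s ^+ 2 * (2^-1) ^+ m.
    by rewrite (expr2 2^-1); field.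
  by rewrite ler_wpM2l ?exprn_ge0 // lerXn2r ?nnegrE.
apply: le_trans (mb i j k) _; rewrite -!exprD.
rewrite [leRHS](_ : _ = A * (4 * s ^+ 2 * 2^-1 ^+ (i + j + k))).
  exact: ler_wpM2l.
by rewrite /half_pow !exprD; ring.
Qed.

End TripleSeries.

(** * Analytic functions of the state *)

Section AnalyticFunctions.
Variable R : realType.
Implicit Types (f : state R -> R) (q : state R) (D : set (state R)).

Lemma box_sum_term (T : nat -> nat -> nat -> R) i j k n : (forall i j k, 0 <= T i j k) ->
  (i < n)%N -> (j < n)%N -> (k < n)%N -> T i j k <= box_sum T n n n.
Proof.
move=> T0 li lj lk; rewrite /box_sum (bigD1 (Ordinal li)) //= (bigD1 (Ordinal lj)) //=.
rewrite (bigD1 (Ordinal lk)) //= -!addrA lerDl !addr_ge0 //.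
- by rewrite sumr_ge0.
- by rewrite sumr_ge0 // => a _; rewrite sumr_ge0.
- by rewrite sumr_ge0 // => a _; rewrite sumr_ge0 // => b _; rewrite sumr_ge0.
Qed.

(** The corner of the half-size cube is a point of absolute convergence, and the total sum of moduli
    there bounds each single term: these are the Cauchy estimates, with r = rho / 2. *)
Lemma analytic_series D f v S l : analytic_on D f -> D (v, S, l) ->
  exists (c : nat -> nat -> nat -> R) (r A : R), [/\ 0 < r, geometric_coeff c r A &
    forall x y z, `|x| <= r -> `|y| <= r -> `|z| <= r ->
      (fun n => box_sum (mono c x y z) n n n) @ \oo --> f (v + x, S + y, l + z)].
Proof.
move=> fD /fD[c [rho [rho0 H]]].
have r0 : 0 < rho / 2 by lra.
have E x y z : (v + x, S + y, l + z) - (v, S, l) = (x, y, z) :> state R.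
  rewrite (_ : _ - _ = (v + x - v, S + y - S, l + z - l)) //.
  by congr (_, _, _); ring.
exists c, (rho / 2).
have cv : cvgn (fun n => box_sum (fun i j k => `|mono c (rho / 2) (rho / 2) (rho / 2) i j k|) n n n).
  have [||| + _] := H (v + rho / 2, S + rho / 2, l + rho / 2);
    try by rewrite /vol_of /ent_of /lam_of /= addrC addKr gtr0_norm //; lra.
  by rewrite E.
exists (limn (fun n => box_sum (fun i j k => `|mono c (rho / 2) (rho / 2) (rho / 2) i j k|) n n n)).
split => //.
  move=> i j k; pose n := (maxn i (maxn j k)).+1.
  apply: le_trans (nondecreasing_cvgn_le _ cv n); last exact: box_sum_nondecreasing.
  apply: le_trans (box_sum_term (i := i) (j := j) (k := k) _ _ _ _) => //.
  - rewrite /mono !normrM !normrX (gtr0_norm r0) le_eqVlt; apply/orP; left; apply/eqP; ring.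
  - by rewrite ltnS leq_maxl.
  - by rewrite ltnS leq_max leq_maxl orbT.
  - by rewrite ltnS leq_max leq_maxr orbT.
move=> x y z xr yr zr.
have [||| _] := H (v + x, S + y, l + z);
  try by rewrite /vol_of /ent_of /lam_of /= addrC addKr; lra.
by rewrite E.
Qed.

Definition sdist q q' : R := `|vol_of q' - vol_of q| + `|ent_of q' - ent_of q| +
  `|lam_of q' - lam_of q|.

(** A quadratic remainder is asked for, beside a given linear part: partial derivatives, local
    Lipschitz bounds and the chain rule along a curve all follow from it. *)
Definition taylor1 f q (gv gS gl : R) := exists K r : R, [/\ 0 < r, 0 <= K &
  forall q', sdist q q' <= r -> `|f q' - f q - (gv * (vol_of q' - vol_of q) +
    gS * (ent_of q' - ent_of q) + gl * (lam_of q' - lam_of q))| <= K * sdist q q' ^+ 2].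

Lemma is_derive_quad (g : R -> R) (x l K r : R) : 0 < r -> 0 <= K ->
  (forall t, `|t - x| <= r -> `|g t - g x - l * (t - x)| <= K * (t - x) ^+ 2) ->
  is_derive x 1 g l.
Proof.
move=> r0 K0 H; apply/is_deriveP => e e0.
exists (Num.min r (e / (K + 1))); first by rewrite lt_min r0 divr_gt0 //; lra.
move=> t; rewrite lt_min => /andP[tr te]; apply: le_trans (H t (ltW tr)) _.
rewrite -(real_normK (num_real (t - x))) expr2 mulrA ler_wpM2r //.
move: te; rewrite ltr_pdivlMr; last by lra.
have := normr_ge0 (t - x); nra.
Qed.

Lemma taylor1_partials f q gv gS gl : taylor1 f q gv gS gl ->
  [/\ is_derive (vol_of q) 1 (fun t => f (t, ent_of q, lam_of q)) gv,
      is_derive (ent_of q) 1 (fun t => f (vol_of q, t, lam_of q)) gS &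
      is_derive (lam_of q) 1 (fun t => f (vol_of q, ent_of q, t)) gl].
Proof.
case: q => [[v S] l] [K [r [r0 K0 H]]]; rewrite /vol_of /ent_of /lam_of /=.
split; apply: (is_derive_quad r0 K0) => t tr.
- have := H (t, S, l); rewrite /sdist /vol_of /ent_of /lam_of /= !subrr !normr0 !addr0.
  by move=> /(_ tr); rewrite !mulr0 !addr0 real_normK ?num_real.
- have := H (v, t, l); rewrite /sdist /vol_of /ent_of /lam_of /= !subrr !normr0 !addr0 !add0r.
  by move=> /(_ tr); rewrite !mulr0 !addr0 !add0r real_normK ?num_real.
- have := H (v, S, t); rewrite /sdist /vol_of /ent_of /lam_of /= !subrr !normr0 !add0r.
  by move=> /(_ tr); rewrite !mulr0 !add0r real_normK ?num_real.
Qed.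

Lemma is_derive_derive1 (g : R -> R) (x l : R) : is_derive x 1 g l -> derive1 g x = l.
Proof. by move=> [_ <-]; rewrite derive1E. Qed.

(** The power series provides some linear part; restriction to the coordinate lines identifies it
    with the partial derivatives. *)
Lemma analytic_taylor D f q : analytic_on D f -> D q ->
  taylor1 f q (d_v f q) (d_S f q) (d_lam f q).
Proof.
case: q => [[v S] l] fD Dq.
have [c [r [A [r0 cA H]]]] := analytic_series fD Dq.
have A0 := geometric_coeff_ge0 r0 cA.
have f0 : f (v, S, l) = c 0%N 0%N 0%N.
  have H0 : (fun n => box_sum (mono c 0 0 0) n n n) @ \oo --> f (v, S, l).
    by have := H 0 0 0; rewrite !normr0 !addr0; apply; exact: ltW.
  have := triple_series_taylor r0 cA _ H0.
  rewrite !normr0 !addr0 expr0n !mulr0 !addr0 => /(_ (ltW (divr_gt0 r0 _))).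
  by rewrite ltr0n => /(_ isT); rewrite normr_le0 subr_eq0 => /eqP.
have T : taylor1 f (v, S, l) (c 1%N 0%N 0%N) (c 0%N 1%N 0%N) (c 0%N 0%N 1%N).
  exists (32 * A / r ^+ 2), (r / 2); split; [by lra| |].
    have r2 : 0 < r ^+ 2 by rewrite exprn_gt0.
    by rewrite divr_ge0 ?mulr_ge0 // ltW.
  move=> [[v' S'] l']; rewrite /sdist /vol_of /ent_of /lam_of /= => hs.
  have nv := normr_ge0 (v' - v); have nS := normr_ge0 (S' - S); have nl := normr_ge0 (l' - l).
  have Hc : (fun n => box_sum (mono c (v' - v) (S' - S) (l' - l)) n n n) @ \oo --> f (v', S', l').
    have := H (v' - v) (S' - S) (l' - l); rewrite ![_ + (_ - _)]addrC !subrK.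
    by apply; lra.
  have := triple_series_taylor r0 cA hs Hc; rewrite f0.
  rewrite [X in `|X| <= _ -> _](_ : _ = f (v', S', l') - c 0%N 0%N 0%N -
    (c 1%N 0%N 0%N * (v' - v) + c 0%N 1%N 0%N * (S' - S) + c 0%N 0%N 1%N * (l' - l))) //.
  by ring.
have [T1 T2 T3] := taylor1_partials T.
by rewrite /d_v /d_S /d_lam (is_derive_derive1 T1) (is_derive_derive1 T2) (is_derive_derive1 T3).
Qed.

(** Termwise differentiation. The radius r / 8 keeps both the point and the variable t of the
    difference quotient within r / 4 of the centre, where [triple_series_quad] applies. *)
Lemma analytic_on_d_v D f : analytic_on D f -> analytic_on D (d_v f).
Proof.
move=> fD [[v S] l] Dq.
have [c [r [A [r0 cA H]]]] := analytic_series fD Dq.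
have A0 := geometric_coeff_ge0 r0 cA.
have r80 : 0 < r / 8 by lra.
exists (diff_coeff c), (r / 8); split => //.
move=> [[v' S'] l']; rewrite /vol_of /ent_of /lam_of /= => xr yr zr.
have -> : (v', S', l') - (v, S, l) = (v' - v, S' - S, l' - l) :> state R by [].
set x := v' - v in xr *; set y := S' - S in yr *; set z := l' - l in zr *.
have cA' := geometric_coeff_diff r0 cA.
have r20 : 0 < r / 2 by lra.
have mb i j k : `|mono (diff_coeff c) x y z i j k| <= A * 2 / r * half_pow R i j k.
  by rewrite /half_pow; apply: (mono_bound i j k r20 cA') => //; lra.
have [cv1 cv2] := box_sum_cvg mb; split; first exact: cv1.
suff E : d_v f (v', S', l') = limn (fun n => box_sum (mono (diff_coeff c) x y z) n n n).
  by rewrite E; exact: cv2.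
apply: is_derive_derive1; rewrite /vol_of /ent_of /lam_of /=.
apply: (@is_derive_quad _ _ _ (16 * A / (r / 4) ^+ 2) _ r80).
  have r2 : 0 < (r / 4) ^+ 2 by rewrite exprn_gt0 //; lra.
  by rewrite divr_ge0 ?mulr_ge0 // ltW.
move=> t tr.
have Hx : (fun n => box_sum (mono c x y z) n n n) @ \oo --> f (v', S', l').
  have := H x y z; rewrite /x /y /z ![_ + (_ - _)]addrC !subrK -/x -/y -/z.
  by apply; lra.
have tv : `|t - v| <= r / 4.
  by rewrite -[t](subrK v') -addrA (le_trans (ler_normD _ _)) //; rewrite -/x; lra.
have Ht : (fun n => box_sum (mono c (t - v) y z) n n n) @ \oo --> f (t, S', l').
  have := H (t - v) y z; rewrite /y /z ![_ + (_ - _)]addrC !subrK -/y -/z.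
  by apply; lra.
have := triple_series_quad r0 cA _ tv _ _ Hx Ht cv2.
rewrite (_ : t - v - x = t - v'); last by rewrite /x; ring.
by rewrite (mulrC (t - v')); apply; lra.
Qed.

(** The exchanges of coordinates that reduce the other two partial derivatives to [d_v]. *)
Definition swap_vS q : state R := (ent_of q, vol_of q, lam_of q).
Definition swap_vl q : state R := (lam_of q, ent_of q, vol_of q).

Lemma box_sum_swap12 (T : nat -> nat -> nat -> R) n :
  box_sum T n n n = box_sum (fun i j k => T j i k) n n n.
Proof. by rewrite /box_sum exchange_big. Qed.

Lemma box_sum_swap13 (T : nat -> nat -> nat -> R) n :
  box_sum T n n n = box_sum (fun i j k => T k j i) n n n.
Proof.
rewrite box_sum_swap12 /box_sum; under eq_bigr do rewrite exchange_big.
by rewrite exchange_big.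
Qed.

Lemma eq_is_cvgn (u v : nat -> R) : u =1 v -> cvgn u -> cvgn v.
Proof. by move=> /funext ->. Qed.

Lemma analytic_on_swap_vS D f : analytic_on D f ->
  analytic_on (swap_vS @^-1` D) (f \o swap_vS).
Proof.
move=> fD [[v S] l] /= /fD[c [rho [rho0 H]]].
exists (fun i j k => c j i k), rho; split => // -[[v' S'] l'] /= h1 h2 h3.
have [H1 H2] := H (swap_vS (v', S', l')) h2 h1 h3.
have E (i j k : nat) : monomial3 (fun i j k => c j i k) ((v', S', l') - (v, S, l)) i j k =
    monomial3 c (swap_vS (v', S', l') - swap_vS (v, S, l)) j i k.
  by rewrite /monomial3 /=; ring.
split.
  refine (eq_is_cvgn _ H1) => N.
  rewrite [LHS](box_sum_swap12 (fun i j k => `|monomial3 _ _ i j k|)).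
  by do 3 (apply: eq_bigr => ? _); rewrite E.
refine (eq_cvgn _ H2) => N.
rewrite [LHS](box_sum_swap12 (fun i j k => monomial3 _ _ i j k)).
by do 3 (apply: eq_bigr => ? _); rewrite E.
Qed.

Lemma analytic_on_swap_vl D f : analytic_on D f ->
  analytic_on (swap_vl @^-1` D) (f \o swap_vl).
Proof.
move=> fD [[v S] l] /= /fD[c [rho [rho0 H]]].
exists (fun i j k => c k j i), rho; split => // -[[v' S'] l'] /= h1 h2 h3.
have [H1 H2] := H (swap_vl (v', S', l')) h3 h2 h1.
have E (i j k : nat) : monomial3 (fun i j k => c k j i) ((v', S', l') - (v, S, l)) i j k =
    monomial3 c (swap_vl (v', S', l') - swap_vl (v, S, l)) k j i.
  by rewrite /monomial3 /=; ring.
split.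
  refine (eq_is_cvgn _ H1) => N.
  rewrite [LHS](box_sum_swap13 (fun i j k => `|monomial3 _ _ i j k|)).
  by do 3 (apply: eq_bigr => ? _); rewrite E.
refine (eq_cvgn _ H2) => N.
rewrite [LHS](box_sum_swap13 (fun i j k => monomial3 _ _ i j k)).
by do 3 (apply: eq_bigr => ? _); rewrite E.
Qed.

Lemma analytic_on_d_S D f : analytic_on D f -> analytic_on D (d_S f).
Proof.
move=> /analytic_on_swap_vS/analytic_on_d_v/analytic_on_swap_vS H.
have E : d_S f = d_v (f \o swap_vS) \o swap_vS by apply/funext => -[[v S] l].
rewrite E; congr (analytic_on _ _): H.
by apply/seteqP; split=> -[[v S] l].
Qed.

Lemma analytic_on_d_lam D f : analytic_on D f -> analytic_on D (d_lam f).
Proof.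
move=> /analytic_on_swap_vl/analytic_on_d_v/analytic_on_swap_vl H.
have E : d_lam f = d_v (f \o swap_vl) \o swap_vl by apply/funext => -[[v S] l].
rewrite E; congr (analytic_on _ _): H.
by apply/seteqP; split=> -[[v S] l].
Qed.

Lemma taylor1_lipschitz f q gv gS gl : taylor1 f q gv gS gl ->
  exists K r : R, [/\ 0 < r, 0 <= K &
    forall q', sdist q q' <= r -> `|f q' - f q| <= K * sdist q q'].
Proof.
move=> [K [r [r0 K0 H]]].
exists (K * r + `|gv| + `|gS| + `|gl|), r; split => //.
  by rewrite !addr_ge0 // mulr_ge0 // ltW.
move=> q' qr; have Hq := H q' qr; set lin := gv * _ + _ + _ in Hq.
have : `|lin| <= (`|gv| + `|gS| + `|gl|) * sdist q q'.
  rewrite /lin; apply: le_trans (ler_normD _ _) _; rewrite normrM.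
  apply: le_trans (lerD (ler_normD _ _) (lexx _)) _; rewrite !normrM /sdist.
  have := normr_ge0 gv; have := normr_ge0 gS; have := normr_ge0 gl.
  have := normr_ge0 (vol_of q' - vol_of q); have := normr_ge0 (ent_of q' - ent_of q).
  have := normr_ge0 (lam_of q' - lam_of q); nra.
have : `|f q' - f q| <= K * sdist q q' ^+ 2 + `|lin|.
  by rewrite -[f q' - f q](subrK lin); apply: le_trans (ler_normD _ _) _; rewrite lerD2r.
have s0 : 0 <= sdist q q' by rewrite !addr_ge0.
have : K * sdist q q' ^+ 2 <= K * r * sdist q q'.
  by rewrite expr2 -mulrA ler_wpM2l // ler_wpM2r.
rewrite !mulrDl; lra.
Qed.

Lemma taylor1_chain f (q : R -> state R) (x gv gS gl lv lS ll : R) :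
  taylor1 f (q x) gv gS gl ->
  is_derive x 1 (fun y => vol_of (q y)) lv ->
  is_derive x 1 (fun y => ent_of (q y)) lS ->
  is_derive x 1 (fun y => lam_of (q y)) ll ->
  is_derive x 1 (fun y => f (q y)) (gv * lv + gS * lS + gl * ll).
Proof.
move=> [K [r [r0 K0 H]]] Hv HS Hl.
pose lin y := gv * (vol_of (q y) - vol_of (q x)) + gS * (ent_of (q y) - ent_of (q x))
  + gl * (lam_of (q y) - lam_of (q x)).
have Hlin : is_derive x 1 lin (gv * lv + gS * lS + gl * ll).
  have c (k : R) (g : R -> R) (l : R) : is_derive x 1 g l ->
      is_derive x 1 (fun y => k * (g y - g x)) (k * l).
    move=> Hg; apply: is_derive_eq_val (is_derive_fM (is_derive_cst k _ _)
      (is_derive_fB Hg (is_derive_cst (g x) _ _))) _.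
    by rewrite mul0r add0r subr0.
  exact: (is_derive_fD (is_derive_fD (c gv _ _ Hv) (c gS _ _ HS)) (c gl _ _ Hl)).
have lip (g : R -> R) (l : R) : is_derive x 1 g l ->
    exists2 d : R, 0 < d & forall y, `|y - x| < d -> `|g y - g x| <= (`|l| + 1) * `|y - x|.
  move=> /is_deriveP/(_ 1 ltr01)[d d0 Hd]; exists d => // y /Hd; rewrite mul1r => Hy.
  have := ler_normD (g y - g x - l * (y - x)) (l * (y - x)).
  by rewrite subrK normrM mulrDl mul1r; lra.
have [d1 d10 L1] := lip _ _ Hv; have [d2 d20 L2] := lip _ _ HS; have [d3 d30 L3] := lip _ _ Hl.
pose M := `|lv| + `|lS| + `|ll| + 3.
have M0 : 0 < M by rewrite /M; have := normr_ge0 lv; have := normr_ge0 lS; have := normr_ge0 ll; lra.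
apply/is_deriveP => e e0.
have [d4 d40 H4] := (is_deriveP _ _ _).1 Hlin (e / 2) (divr_gt0 e0 (ltr0Sn _ 1)).
(* For |y - x| < b the quadratic remainder K (M |y - x|)^2 is at most (e / 2) |y - x|. *)
pose b := e / (2 * (K + 1) * M ^+ 2).
have M20 : 0 < M ^+ 2 by rewrite exprn_gt0.
have KM0 : 0 < 2 * (K + 1) * M ^+ 2 by rewrite !mulr_gt0 //; lra.
have b0 : 0 < b by rewrite divr_gt0.
exists (Num.min (Num.min d1 (Num.min d2 d3)) (Num.min d4 (Num.min (r / M) b))).
  by rewrite !lt_min d10 d20 d30 d40 b0 divr_gt0.
move=> y; rewrite !lt_min => /andP[/andP[/L1{}L1 /andP[/L2{}L2 /L3{}L3]]
  /andP[/H4{}H4 /andP[yr yb]]].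
have sM : sdist (q x) (q y) <= M * `|y - x|.
  by move: L1 L2 L3; rewrite /sdist /M !mulrDl !mul1r; lra.
have s0 : 0 <= sdist (q x) (q y) by rewrite !addr_ge0.
have Hy : `|f (q y) - f (q x) - lin y| <= K * sdist (q x) (q y) ^+ 2.
  by apply: H; apply: le_trans sM _; rewrite mulrC -ler_pdivlMr // ltW.
have lx : lin x = 0 by rewrite /lin !subrr !mulr0 !addr0.
move: H4; rewrite lx subr0 => H4.
rewrite -[f (q y) - f (q x)](subrK (lin y)) -addrA.
apply: le_trans (ler_normD _ _) _.
have : K * sdist (q x) (q y) ^+ 2 <= e / 2 * `|y - x|.
  apply: (@le_trans _ _ (K * (M * `|y - x|) ^+ 2)).
    by rewrite ler_wpM2l // lerXn2r // nnegrE mulr_ge0 // ltW.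
  rewrite exprMn (expr2 `|y - x|) !mulrA ler_wpM2r //.
  move: yb; rewrite /b ltr_pdivlMr // => yb.
  have : 0 <= M ^+ 2 * `|y - x| by rewrite mulr_ge0 // ltW.
  nra.
lra.
Qed.

End AnalyticFunctions.

(** * Regularity classes on a half line *)

Section TameFamilies.
Variables (R : realType) (beta h0 a : R).
Hypotheses (beta_gt0 : 0 < beta) (a_ge0 : 0 <= a).
Implicit Types (f g : R -> R -> R[i]).

Definition bounded_fam f := exists2 C : R, 0 <= C &
  forall h x, 0 < h < h0 -> a <= x -> modc (f h x) <= C.

Definition decaying f := exists2 C : R, 0 <= C &
  forall h x, 0 < h < h0 -> a <= x -> modc (f h x) <= C * expR (- beta * x).

(* Continuity on [[a, +oo[], expressed through the constant extension to the left
   of [a]. *)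
Definition continuous_fam f := forall h, 0 < h < h0 ->
  forall x, continuousC (fun y => f h (Num.max a y)) x.

(* Families in (h, x) with [n] derivatives in [x > a], uniformly bounded in [h],
   all the derivatives of order at least 1 being [O(exp (- beta x))]. *)
Fixpoint tame n f : Prop := [/\ bounded_fam f, continuous_fam f &
  if n is n'.+1 then exists f' : R -> R -> R[i],
    [/\ forall h x, 0 < h < h0 -> a < x -> is_deriveC (f h) x (f' h x),
        decaying f' & tame n' f'] else True].

Lemma expR_decay_le1 x : a <= x -> expR (- beta * x) <= 1.
Proof.
move=> ax; rewrite -expR0 ler_expR mulNr oppr_le0 mulr_ge0 ?(ltW beta_gt0) //.
exact: le_trans ax.
Qed.

Lemma bounded_famD f g : bounded_fam f -> bounded_fam g ->
  bounded_fam (fun h x => f h x + g h x).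
Proof.
move=> [C C0 H] [K K0 G]; exists (C + K); first exact: addr_ge0.
by move=> h x hh ax; apply: le_trans (modcD _ _) _; apply: lerD; [exact: H|exact: G].
Qed.

Lemma bounded_famN f : bounded_fam f -> bounded_fam (fun h x => - f h x).
Proof. by move=> [C C0 H]; exists C => // h x hh ax; rewrite modcN H. Qed.

Lemma bounded_famM f g : bounded_fam f -> bounded_fam g ->
  bounded_fam (fun h x => f h x * g h x).
Proof.
move=> [C C0 H] [K K0 G]; exists (C * K); first exact: mulr_ge0.
by move=> h x hh ax; rewrite modcM; apply: ler_pM; rewrite ?modc_ge0 ?H ?G.
Qed.

Lemma decayingD f g : decaying f -> decaying g -> decaying (fun h x => f h x + g h x).
Proof.
move=> [C C0 H] [K K0 G]; exists (C + K); first exact: addr_ge0.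
by move=> h x hh ax; apply: le_trans (modcD _ _) _; rewrite mulrDl; apply: lerD; [exact: H|exact: G].
Qed.

Lemma decayingN f : decaying f -> decaying (fun h x => - f h x).
Proof. by move=> [C C0 H]; exists C => // h x hh ax; rewrite modcN H. Qed.

Lemma decayingMl f g : decaying f -> bounded_fam g -> decaying (fun h x => f h x * g h x).
Proof.
move=> [C C0 H] [K K0 G]; exists (C * K); first exact: mulr_ge0.
move=> h x hh ax; rewrite modcM mulrAC.
by apply: ler_pM; rewrite ?modc_ge0 ?H ?G.
Qed.

Lemma decayingMr f g : bounded_fam f -> decaying g -> decaying (fun h x => f h x * g h x).
Proof.
move=> bf dg; have [C C0 H] := decayingMl dg bf; exists C => // h x hh ax.
by rewrite mulrC H.
Qed.

Lemma decaying_ext f g : (forall h x, 0 < h < h0 -> a <= x -> f h x = g h x) ->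
  decaying f -> decaying g.
Proof. by move=> E [C C0 H]; exists C => // h x hh ax; rewrite -E // H. Qed.

Lemma decaying0 : decaying (fun _ _ => 0).
Proof. by exists 0 => // h x _ _; rewrite modc0 mul0r. Qed.

Lemma decaying_sum m (F : 'I_m -> R -> R -> R[i]) : (forall k, decaying (F k)) ->
  decaying (fun h x => \sum_k F k h x).
Proof.
move=> H; suff : forall s : seq 'I_m, decaying (fun h x => \sum_(k <- s) F k h x).
  by move=> /(_ (index_enum _)).
elim=> [|k s IH].
  by apply: decaying_ext decaying0 => h x _ _; rewrite big_nil.
by apply: decaying_ext (decayingD (H k) IH) => h x _ _; rewrite big_cons.
Qed.

Lemma max_near x : a < x -> \near x, Num.max a x = x.
Proof.
move=> ax; near=> y; apply/max_idPr; apply: ltW; near: y.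
exact: lt_nbhsr.
Unshelve. all: by end_near. Qed.

Lemma tame_bounded n f : tame n f -> bounded_fam f.
Proof. by case: n => [|n] []. Qed.

Lemma tame_continuous n f : tame n f -> continuous_fam f.
Proof. by case: n => [|n] []. Qed.

Lemma tame_ext n f g : (forall h x, 0 < h < h0 -> a <= x -> f h x = g h x) ->
  tame n f -> tame n g.
Proof.
move=> E; have EB : bounded_fam f -> bounded_fam g.
  by move=> [C C0 H]; exists C => // h x hh ax; rewrite -E // H.
have EC : continuous_fam f -> continuous_fam g.
  move=> cf h hh x; rewrite (_ : (fun y => _) = fun y => f h (Num.max a y)); first exact: cf.
  by apply/funext => y; rewrite E // le_max lexx.
case: n => [|n] [bf cf H]; split; rewrite ?EB ?EC //; [exact: EB|exact: EC|exact: EB|exact: EC|].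
have [f' [df decf tf]] := H; exists f'; split => // h x hh ax.
apply: is_deriveC_near (df h x hh ax); near=> y; apply: E => //; apply: ltW; near: y.
exact: lt_nbhsr.
Unshelve. all: by end_near. Qed.

Lemma tameS n f : tame n.+1 f -> tame n f.
Proof.
elim: n f => [|n IH] f [bf cf [f' [df decf tf]]]; first by [].
split => //; exists f'; split => //; exact: IH.
Qed.

Lemma continuous_famD f g : continuous_fam f -> continuous_fam g ->
  continuous_fam (fun h x => f h x + g h x).
Proof. by move=> cf cg h hh x; apply: continuousCD; [exact: cf|exact: cg]. Qed.

Lemma continuous_famM f g : continuous_fam f -> continuous_fam g ->
  continuous_fam (fun h x => f h x * g h x).
Proof. by move=> cf cg h hh x; apply: continuousCM; [exact: cf|exact: cg]. Qed.

Lemma tameD n f g : tame n f -> tame n g -> tame n (fun h x => f h x + g h x).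
Proof.
elim: n f g => [|n IH] f g [bf cf H] [bg cg G].
  by split => //; [exact: bounded_famD|exact: continuous_famD].
split; [exact: bounded_famD|exact: continuous_famD|].
have [f' [df decf tf]] := H; have [g' [dg decg tg]] := G.
exists (fun h x => f' h x + g' h x); split; [|exact: decayingD|exact: IH].
by move=> h x hh ax; apply: is_deriveCD; [exact: df|exact: dg].
Qed.

Lemma tameN n f : tame n f -> tame n (fun h x => - f h x).
Proof.
elim: n f => [|n IH] f [bf cf H].
  by split => //; [exact: bounded_famN|move=> h hh x; apply: continuousCN; exact: cf].
split; [exact: bounded_famN|move=> h hh x; apply: continuousCN; exact: cf|].
have [f' [df decf tf]] := H.
exists (fun h x => - f' h x); split; [|exact: decayingN|exact: IH].
by move=> h x hh ax; apply: is_deriveCN; exact: df.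
Qed.

Lemma tameM n f g : tame n f -> tame n g -> tame n (fun h x => f h x * g h x).
Proof.
elim: n f g => [|n IH] f g tf tg; have [bf cf H] := tf; have [bg cg G] := tg.
  by split => //; [exact: bounded_famM|exact: continuous_famM].
split; [exact: bounded_famM|exact: continuous_famM|].
have [f' [df decf tf']] := H; have [g' [dg decg tg']] := G.
exists (fun h x => f' h x * g h x + f h x * g' h x); split.
- by move=> h x hh ax; apply: is_deriveCM; [exact: df|exact: dg].
- by apply: decayingD; [exact: decayingMl|exact: decayingMr].
- by apply: tameD; apply: IH => //; exact: tameS.
Qed.

Lemma tame_cst n (c : R -> R[i]) (C : R) : (forall h, 0 < h < h0 -> modc (c h) <= C) ->
  tame n (fun h _ => c h).
Proof.
elim: n c C => [|n IH] c C H.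
  split => //; last by move=> h hh x; exact: continuousC_cst.
  exists `|C| => // h x hh _; exact: le_trans (H h hh) (ler_norm _).
have tc := IH c C H.
split; [exact: tame_bounded tc|exact: tame_continuous tc|].
exists (fun _ _ => 0); split; first by move=> h x hh ax; exact: is_deriveC_cst.
  exact: decaying0.
by apply: (IH (fun=> 0) 0) => h _; rewrite modc0.
Qed.

Lemma tame_sum n m (F : 'I_m -> R -> R -> R[i]) : (forall k, tame n (F k)) ->
  tame n (fun h x => \sum_k F k h x).
Proof.
move=> H; suff : forall s : seq 'I_m, tame n (fun h x => \sum_(k <- s) F k h x).
  by move=> /(_ (index_enum _)).
elim=> [|k s IH].
  apply: (@tame_ext _ (fun _ _ => 0)); first by move=> h x _ _; rewrite big_nil.
  by apply: (@tame_cst n (fun=> 0) 0) => h _; rewrite modc0.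
by apply: tame_ext (tameD (H k) IH) => h x _ _; rewrite big_cons.
Qed.

Definition away_from0 f := exists2 c : R, 0 < c &
  forall h x, 0 < h < h0 -> a <= x -> c <= modc (f h x).

Lemma away_neq0 f h x : away_from0 f -> 0 < h < h0 -> a <= x -> f h x != 0.
Proof. by move=> [c c0 H] hh ax; rewrite -modc_gt0; apply: lt_le_trans (H h x hh ax). Qed.

Lemma tameV n f : away_from0 f -> tame n f -> tame n (fun h x => (f h x)^-1).
Proof.
move=> af; have f0 := away_neq0 af; have [c c0 cH] := af.
have bV : bounded_fam (fun h x => (f h x)^-1).
  exists c^-1; first by rewrite invr_ge0 ltW.
  move=> h x hh ax; rewrite modcV lef_pV2 ?posrE ?cH //.
  by apply: lt_le_trans (cH h x hh ax).
elim: n f {c c0 cH} f0 bV {af} => [|n IH] f f0 bV tf; have [bf cf H] := tf.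
  split => // h hh x; apply: continuousCV; last exact: cf.
  by apply: f0 => //; rewrite le_max lexx.
split => //.
  move=> h hh x; apply: continuousCV; last exact: cf.
  by apply: f0 => //; rewrite le_max lexx.
have [f' [df decf tf']] := H.
have tV : tame n (fun h x => (f h x)^-1) by apply: IH => //; exact: tameS.
exists (fun h x => - (f' h x * (f h x)^-1 * (f h x)^-1)); split.
- by move=> h x hh ax; apply: is_deriveCV; [apply: f0 => //; exact: ltW|exact: df].
- by apply: decayingN; do 2 apply: decayingMl => //.
- by apply: tameN; do 2 apply: tameM => //.
Qed.

Lemma is_deriveC_caratheodory (f : R -> R[i]) x l : is_deriveC f x l <->
  exists g : R -> R[i], [/\ forall z, f z - f x = g z * (z - x)%:C, continuousC g x & g x = l].
Proof.
split=> [[]|[g [E [c1 c2] <-]]].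
  move=> /is_derive1_caratheodory[g1 [E1 c1 l1]] /is_derive1_caratheodory[g2 [E2 c2 l2]].
  exists (fun z => g1 z +i* g2 z); split => //.
  - move=> z; apply: complex_ext; rewrite ?ReCM ?ImCM ?ReCD ?ImCD ?ReCN ?ImCN /=.
      by rewrite mulr0 subr0 E1.
    by rewrite mulr0 add0r E2.
  - by apply: complex_ext.
split; apply/is_derive1_caratheodory.
- exists (fun z => complex.Re (g z)); split => // z.
  by rewrite -ReCN -ReCD E ReCM /= mulr0 subr0.
- exists (fun z => complex.Im (g z)); split => // z.
  by rewrite -ImCN -ImCD E ImCM /= mulr0 add0r.
Qed.

Lemma near_continuous_for (p q : R -> R) x : (\near x, p x = q x) ->
  {for x, continuous p} -> {for x, continuous q}.
Proof.
move=> N cp; have E := nbhs_singleton N; change (q @ x --> q x); rewrite -E.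
by apply: cvg_trans cp; apply: near_eq_cvg; apply: filterS N => y ->.
Qed.

Lemma continuous_near_neq0 (f : R -> R) x : {for x, continuous f} -> f x != 0 ->
  \near x, f x != 0.
Proof.
move=> cf f0; have e0 : 0 < `|f x| by rewrite normr_gt0.
have [d d0 H] := (continuous_forP f x).1 cf _ e0.
apply/nbhs_ballP; exists d => // y; rewrite /ball /= distrC => /H.
by apply: contraTneq => ->; rewrite sub0r normrN ltxx.
Qed.

Lemma continuousC_near_neq0 (f : R -> R[i]) x : continuousC f x -> f x != 0 ->
  \near x, f x != 0.
Proof.
move=> [c1 c2] f0.
have [r0|r0] := eqVneq (complex.Re (f x)) 0.
  have i0 : complex.Im (f x) != 0 by apply: contraNneq f0 => i0; apply/eqP/complex_ext.
  have := continuous_near_neq0 c2 i0.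
  by apply: filterS => y; apply: contraNneq => ->.
have := continuous_near_neq0 c1 r0.
by apply: filterS => y; apply: contraNneq => ->.
Qed.

(** From f(z) - f(x) = (g(z) - g(x)) / (f(z) + f(x)): continuity of f selects the branch and keeps
    f(z) + f(x) away from 0 near x. *)
Lemma is_deriveC_sqrt (f g : R -> R[i]) x l : (forall y, f y * f y = g y) ->
  continuousC f x -> f x != 0 -> is_deriveC g x l ->
  is_deriveC f x (l * (f x)^-1 * (2^-1)%:C).
Proof.
move=> fg cf f0 /is_deriveC_caratheodory[p [pE cp pl]].
have c2 : continuousC (fun z => f z + f x) x by apply: continuousCD => //; exact: continuousC_cst.
have n2 : f x + f x != 0.
  apply: contraNneq f0 => E; apply/eqP; apply: complex_ext.
    by move: (congr1 (@complex.Re R) E); rewrite ReCD /=; lra.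
  by move: (congr1 (@complex.Im R) E); rewrite ImCD /=; lra.
apply/is_deriveC_caratheodory.
(* Where f z + f x vanishes, the quotient is completed so that the identity holds for every z; this
   happens only away from x. *)
exists (fun z => if f z + f x == 0 then (f z - f x) / (z - x)%:C else p z / (f z + f x)); split.
- move=> z; case: eqP => [E|/eqP E].
    have [zx|zx] := eqVneq z x; first by rewrite zx !subrr mulr0.
    rewrite mulfVK //; apply: contraNneq zx => /(congr1 (@complex.Re R)) /= /eqP.
    by rewrite subr_eq0.
  rewrite mulrAC -pE -!fg; field; exact: E.
- have H := continuousCM cp (continuousCV n2 c2).
  have N := continuousC_near_neq0 c2 n2.
  have [H1 H2] := H.
  by split; [apply: near_continuous_for H1|apply: near_continuous_for H2];
    apply: filterS N => z Nz; rewrite (negbTE Nz).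
- rewrite (negbTE n2) pl (_ : f x + f x = f x * 2); last by ring.
  by rewrite invfM mulrA fmorphV rmorph_nat.
Qed.

(** The derivative g' / (2 f) involves f only through its inverse, so order n + 1 follows from order
    n of f. *)
Lemma tame_sqrt n f g : (forall h x, 0 < h < h0 -> a <= x -> f h x * f h x = g h x) ->
  continuous_fam f -> away_from0 f -> tame n g -> tame n f.
Proof.
move=> fg cf af tg; have f0 := away_neq0 af.
have bf : bounded_fam f.
  have [C C0 H] := tame_bounded tg; exists (C + 1); first lra.
  move=> h x hh ax; have := H h x hh ax; rewrite -fg // modcM.
  by have := modc_ge0 (f h x); nra.
elim: n g fg tg => [|n IH] g fg tg; first by [].
split => //; have [_ _ [g' [dg decg tg']]] := tg.
have tV : tame n (fun h x => (f h x)^-1) by apply: tameV => //; apply: IH (tameS tg).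
exists (fun h x => g' h x * (f h x)^-1 * (2^-1)%:C); split.
- move=> h x hh ax.
  have E : Num.max a x = x by apply/max_idPr; exact: ltW.
  apply: (@is_deriveC_near _ (fun y => f h (Num.max a y))).
    by have := max_near ax; apply: filterS => y ->.
  rewrite -[in f h x]E; apply: (is_deriveC_sqrt (g := fun y => g h (Num.max a y))).
  + by move=> y; rewrite fg // le_max lexx.
  + exact: cf.
  + by apply: f0 => //; rewrite le_max lexx.
  + apply: (@is_deriveC_near _ (g h)); last exact: dg.
    by have := max_near ax; apply: filterS => y ->.
- apply: decayingMl; last by exists `|2^-1| => // h x _ _; rewrite modcR.
  by apply: decayingMl => //; exact: tame_bounded tV.
- apply: tameM; first exact: tameM.
  by apply: (@tame_cst _ (fun=> (2^-1)%:C) `|2^-1|) => h _; rewrite modcR.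
Qed.

Definition rtame n (f : R -> R) := tame n (fun _ x => (f x)%:C).
Definition rdecaying (f : R -> R) := decaying (fun _ x => (f x)%:C).

Lemma rtame_ext n (f g : R -> R) : (forall x, a <= x -> f x = g x) -> rtame n f -> rtame n g.
Proof. by move=> E; apply: tame_ext => h x _ ax; rewrite E. Qed.

Lemma rtameD n (f g : R -> R) : rtame n f -> rtame n g -> rtame n (fun x => f x + g x).
Proof. by move=> tf tg; apply: tame_ext (tameD tf tg) => h x _ _; rewrite rmorphD. Qed.

Lemma rtameM n (f g : R -> R) : rtame n f -> rtame n g -> rtame n (fun x => f x * g x).
Proof. by move=> tf tg; apply: tame_ext (tameM tf tg) => h x _ _; rewrite rmorphM. Qed.

Lemma rtameN n (f : R -> R) : rtame n f -> rtame n (fun x => - f x).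
Proof. by move=> tf; apply: tame_ext (tameN tf) => h x _ _; rewrite rmorphN. Qed.

Lemma rtame_cst n (c : R) : rtame n (fun=> c).
Proof. by apply: (@tame_cst _ (fun=> c%:C) `|c|) => h _; rewrite modcR. Qed.

Lemma rtameV n (f : R -> R) (c : R) : 0 < c -> (forall x, a <= x -> c <= `|f x|) ->
  rtame n f -> rtame n (fun x => (f x)^-1).
Proof.
move=> c0 H tf; apply: (@tame_ext _ (fun _ x => ((f x)%:C)^-1)).
  by move=> h x _ _; rewrite fmorphV.
by apply: tameV => //; exists c => // h x _ ax; rewrite modcR H.
Qed.

Lemma rtame_intro n (f f' : R -> R) (C : R) : (forall x, a <= x -> `|f x| <= C) ->
  continuous (fun y => f (Num.max a y)) ->
  (forall x, a < x -> is_derive x 1 f (f' x)) -> rdecaying f' -> rtame n f' ->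
  rtame n.+1 f.
Proof.
move=> bf cf df decf tf; split.
- exists `|C| => // h x _ ax; rewrite modcR; exact: le_trans (bf x ax) (ler_norm _).
- by move=> h hh x; apply: continuousC_real; exact: cf.
- exists (fun _ x => (f' x)%:C); split => // h x _ ax.
  exact: is_deriveC_real (df x ax).
Qed.

Lemma rtame0_intro (f : R -> R) (C : R) : (forall x, a <= x -> `|f x| <= C) ->
  continuous (fun y => f (Num.max a y)) -> rtame 0 f.
Proof.
move=> bf cf; split => //.
- exists `|C| => // h x _ ax; rewrite modcR; exact: le_trans (bf x ax) (ler_norm _).
- by move=> h hh x; apply: continuousC_real; exact: cf.
Qed.

Lemma rdecayingD (f g : R -> R) : rdecaying f -> rdecaying g -> rdecaying (fun x => f x + g x).
Proof. by move=> tf tg; apply: decaying_ext (decayingD tf tg) => h x _ _; rewrite rmorphD. Qed.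

Lemma rdecayingN (f : R -> R) : rdecaying f -> rdecaying (fun x => - f x).
Proof. by move=> tf; apply: decaying_ext (decayingN tf) => h x _ _; rewrite rmorphN. Qed.

Lemma rdecayingMl n (f g : R -> R) : rdecaying f -> rtame n g -> rdecaying (fun x => f x * g x).
Proof.
move=> tf tg; apply: decaying_ext (decayingMl tf (tame_bounded tg)) => h x _ _.
by rewrite rmorphM.
Qed.

Lemma rdecayingMr n (f g : R -> R) : rtame n f -> rdecaying g -> rdecaying (fun x => f x * g x).
Proof.
move=> tf tg; apply: decaying_ext (decayingMr (tame_bounded tf) tg) => h x _ _.
by rewrite rmorphM.
Qed.

End TameFamilies.

(** Profile data are regular on [0, +oo[, whereas the spectral quantities are controlled on [a, +oo[
    and for small h; this brings the former to the common range. *)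
Lemma tame_restrict (R : realType) (beta h0 h1 a b : R) n f : h1 <= h0 -> a <= b ->
  tame beta h0 a n f -> tame beta h1 b n f.
Proof.
move=> h10 ab.
have lt h : 0 < h < h1 -> 0 < h < h0.
  by move=> /andP[-> /lt_le_trans]; exact.
have B g : bounded_fam h0 a g -> bounded_fam h1 b g.
  by move=> [C C0 H]; exists C => // h x hh bx; apply: H; [exact: lt|exact: le_trans bx].
have C g : continuous_fam h0 a g -> continuous_fam h1 b g.
  move=> cg h hh x; have [c1 c2] := cg h (lt _ hh) (Num.max b x).
  have E y : Num.max a (Num.max b y) = Num.max b y.
    by apply/max_idPr; rewrite le_max ab.
  have cm : {for x, continuous (fun y => Num.max b y)}.
    by apply: continuous_max; [exact: cst_continuous|exact: cvg_id].
  split.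
    apply: (eq_continuous_for (p := (fun y => complex.Re (g h (Num.max a y))) \o (fun y => Num.max b y))).
      by move=> y /=; rewrite E.
    exact: continuous_comp.
  apply: (eq_continuous_for (p := (fun y => complex.Im (g h (Num.max a y))) \o (fun y => Num.max b y))).
    by move=> y /=; rewrite E.
  exact: continuous_comp.
elim: n f => [|n IH] f [bf cf H]; first by split; [exact: B|exact: C|].
split; [exact: B|exact: C|].
have [f' [df [K K0 dec] tf]] := H; exists f'; split; [|exists K|exact: IH] => //.
  by move=> h x hh bx; apply: df; [exact: lt|exact: le_lt_trans bx].
by move=> h x hh bx; apply: dec; [exact: lt|exact: le_trans bx].
Qed.

(** * The reaction zone *)

Section HalfLine.
Variable R : realType.
Implicit Types (f g : R -> R).

Lemma continuous_max_intro f (a : R) : f x @[x --> a^'+] --> f a ->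
  (forall x, a < x -> {for x, continuous f}) -> continuous (fun y => f (Num.max a y)).
Proof.
move=> fa fc x; apply/continuous_forP => e e0.
have [xa|ax|xa] := ltgtP x a.
- exists (a - x); first lra.
  move=> y yx; have ya : y < a by have := ler_norm (y - x); lra.
  by rewrite !max_l ?ltW // subrr normr0.
- have [d d0 H] := (continuous_forP f x).1 (fc x ax) e e0.
  exists (Num.min d (x - a)); first by rewrite lt_min d0 subr_gt0.
  move=> y; rewrite lt_min => /andP[yd yx].
  have ya : a < y by have := ler_norm (- (y - x)); rewrite normrN; lra.
  by rewrite !max_r ?ltW // H.
- move/cvgrPdist_lt : fa => /(_ e e0) /=.
  rewrite near_withinE => /nbhs_ballP[d /= d0 H]; exists d => // y.
  rewrite xa; have [ya|ay|->] := ltgtP y a => yx.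
  + by rewrite subrr normr0.
  + by rewrite distrC; apply: H => //; rewrite /ball /= distrC.
  + by rewrite subrr normr0.
Qed.

Lemma continuous_max_right f (a : R) : continuous (fun y => f (Num.max a y)) ->
  forall e : R, 0 < e -> exists2 d : R, 0 < d &
     forall y, a <= y -> y < a + d -> `|f y - f a| < e.
Proof.
move=> fc e e0; have [d d0 H] := (continuous_forP _ a).1 (fc a) e e0.
exists d => // y ay yd; have := H y; rewrite maxxx (max_r ay); apply.
by rewrite ger0_norm; lra.
Qed.

(** At x = 0 [ddx] is a one-sided derivative, and its value comes from the continuity of f and g up
    to 0. *)
Lemma ddx_eq f g : continuous (fun y : R => f (Num.max 0 y)) ->
  continuous (fun y : R => g (Num.max 0 y)) ->
  (forall x : R, 0 < x -> is_derive x 1 f (g x)) -> forall x, 0 <= x -> ddx f x = g x.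
Proof.
move=> fc gc fg x; rewrite le_eqVlt => /orP[/eqP <-|x0].
  apply: (has_derivative_within_half_lineP (a := 0)) => //.
  apply: has_derivative_within_endpoint => //; exact: continuous_max_right.
apply: (has_derivative_within_half_lineP (a := 0)); last exact: ltW.
by apply: has_derivative_within_interior => //; exact: fg.
Qed.

Lemma bounded_on_segment f (b : R) : continuous (fun y : R => f (Num.max 0 y)) ->
  exists2 M : R, 0 <= M & forall x, 0 <= x <= b -> `|f x| <= M.
Proof.
move=> fc; have [M H] := continuousC_bounded (fun x => continuousC_real (fc x)).
have [M0 MB] := H `|b|; exists (M `|b|) => // x /andP[x0 xb].
rewrite -modcR -[x in f x](max_r x0); apply: MB.
by rewrite ger0_norm // (le_trans xb) // ler_norm.
Qed.

(** The limit l controls f from X on, with X made explicit by 1 + t <= exp t; on [0, X] a continuous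
    positive function has a positive minimum. *)
Lemma exp_limit_positive f (l C beta : R) : 0 < beta -> 0 < l ->
  continuous (fun y : R => f (Num.max 0 y)) ->
  (forall x, 0 <= x -> `|f x - l| <= C * expR (- beta * x)) ->
  (forall x, 0 <= x -> 0 < f x) ->
  exists2 c : R, 0 < c & forall x, 0 <= x -> c <= f x.
Proof.
move=> b0 l0 fc fl fp.
pose X := `|C| * (2 / l) / beta.
have X0 : 0 <= X by rewrite !mulr_ge0 ?invr_ge0 // ltW.
have tail x : X <= x -> l / 2 <= f x.
  move=> Xx; have x0 : 0 <= x := le_trans X0 Xx.
  have := fl x x0; rewrite ler_norml => /andP[+ _].
  have : C * expR (- beta * x) <= l / 2; last lra.
  apply: (@le_trans _ _ (`|C| * expR (- beta * x))); first by rewrite ler_wpM2r ?expR_ge0 ?ler_norm.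
  have bx : `|C| * (2 / l) <= beta * x by rewrite (mulrC beta) -ler_pdivrMr.
  have e1 : 1 + beta * x <= expR (beta * x) by apply: expR_ge1Dx.
  rewrite mulNr expRN ler_pdivrMr ?expR_gt0 //.
  apply: (@le_trans _ _ (l / 2 * (beta * x))); last by rewrite ler_wpM2l //; lra.
  have l2 : 0 <= l / 2 by lra.
  have := ler_wpM2l l2 bx; rewrite mulrCA (_ : l / 2 * (2 / l) = 1) ?mulr1 //.
  by field; rewrite gt_eqF.
have [|c cX Hc] := @EVT_min R (fun y : R => f (Num.max 0 y)) 0 X X0.
  exact: continuous_subspaceT.
exists (Num.min (f (Num.max 0 c)) (l / 2)).
  by rewrite lt_min fp ?le_max ?lexx //=; lra.
move=> x x0; rewrite ge_min; have [Xx|xX] := leP X x; first by rewrite tail // orbT.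
have := Hc x; rewrite in_itv /= x0 (ltW xX) => /(_ isT).
by rewrite (max_r x0) => ->.
Qed.

End HalfLine.

Section Profile.
Variables (R : realType) (th : thermo R) (w : profile R) (beta h0 : R).
Hypotheses (Hth : thermodynamics th) (Hw : strong_detonation th w)
  (Hst : standing_assumptions th w beta).

Local Notation v := (vol w).
Local Notation S := (ent w).
Local Notation l := (lam w).
Local Notation u := (vel w).
Local Notation q := (st w).
Local Notation p := (pressure th).
Local Notation m0 := (u 0 / v 0).
Local Notation analytic := (analytic_on (dom th)).
Local Notation rt := (rtame beta h0 0).
Local Notation rdec := (rdecaying beta h0 0).

Let beta_gt0 : 0 < beta. Proof. by have [_ _ [b0 _] _] := Hst. Qed.

Lemma dom_profile x : 0 <= x -> dom th (q x).
Proof. by have [_ _ _ [H _] _] := Hw; exact: H. Qed.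

Lemma vol_gt0 x : 0 <= x -> 0 < v x.
Proof. by move=> /dom_profile; have [[_ H] _ _ _ _] := Hth; exact: H. Qed.

Lemma kappa_vel_bounds : exists C1 C2 : R, [/\ 0 < C1, C2 < 1 &
  forall x, 0 <= x -> C1 <= kappa th w x <= C2 /\ C1 <= u x <= C2].
Proof. by have [_ H _ _] := Hst. Qed.

Lemma vel_gt0 x : 0 <= x -> 0 < u x.
Proof.
have [C1 [C2 [C10 _ H]]] := kappa_vel_bounds => /H[_ /andP[+ _]].
exact: lt_le_trans.
Qed.

Lemma c0_gt0 x : 0 <= x -> 0 < c0 th (q x).
Proof.
have [C1 [C2 [C10 _ H]]] := kappa_vel_bounds => /H[/andP[k _] _].
rewrite lt0r sqrtr_ge0 andbT; apply/eqP => c00.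
by move: k; rewrite /kappa c00 invr0 mulr0; lra.
Qed.

Lemma c0_sqr x : 0 <= x -> c0 th (q x) ^+ 2 = - (v x ^+ 2 * d_v p (q x)).
Proof.
move=> x0; rewrite /c0 sqr_sqrtr //; rewrite leNgt; apply/negP => n.
by have := c0_gt0 x0; rewrite /c0 ler0_sqrtr ?ltxx // ltW.
Qed.

(** Equal to c0^2 eta; it is the factor of v' when the steady equations are solved for the
    derivatives. *)
Definition sound_gap x := c0 th (q x) ^+ 2 - u x ^+ 2.

Lemma sound_gap_bound : exists2 c : R, 0 < c & forall x, 0 <= x -> c <= sound_gap x.
Proof.
have [C1 [C2 [C10 C21 H]]] := kappa_vel_bounds.
have C20 : 0 < C2 by have [/andP[k1 k2] _] := H 0 (lexx _); lra.
exists (C1 ^+ 2 * (1 - C2 ^+ 2)); first by rewrite mulr_gt0 ?exprn_gt0 // subr_gt0 expr_lt1 // ltW.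
move=> x x0; have [/andP[k1 k2] /andP[u1 u2]] := H x x0.
have c00 := c0_gt0 x0; have ux : u x = kappa th w x * c0 th (q x) by rewrite /kappa mulfVK // gt_eqF.
rewrite /sound_gap ux; set k := kappa th w x in k1 k2 ux *; set c := c0 th (q x) in c00 ux *.
(* Since kappa < 1, c0 >= u >= C1. *)
have kc : C1 <= c.
  apply: le_trans u1 _; rewrite ux ler_piMl //; first exact: ltW.
  by lra.
rewrite exprMn [leRHS](_ : _ = c ^+ 2 * (1 - k ^+ 2)); last by ring.
apply: ler_pM; rewrite ?exprn_ge0 ?(ltW C10) //.
- by rewrite subr_ge0 expr_le1 // ltW.
- by rewrite lerXn2r ?nnegrE ?(ltW C10) ?(ltW c00).
- by rewrite lerD2l lerN2 lerXn2r ?nnegrE ?(ltW C20) //; lra.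
Qed.

Lemma profile_continuous :
  [/\ continuous (fun y : R => v (Num.max 0 y)), continuous (fun y : R => S (Num.max 0 y)),
      continuous (fun y : R => l (Num.max 0 y)) & continuous (fun y : R => u (Num.max 0 y))].
Proof.
have [_ _ [q0 u0] [_ H] _] := Hw.
have dc f x : smooth_at f x -> {for x, continuous f}.
  by move=> /(_ 0%N)/derivable1_diffP/differentiable_continuous.
have q1 : (q x).1 @[x --> 0^'+] --> (q 0).1 by apply: (cvg_comp _ _ q0); exact: cvg_fst.
split; apply: continuous_max_intro.
- by apply: (cvg_comp _ _ q1); exact: cvg_fst.
- by move=> x /H[_ [/dc]].
- by apply: (cvg_comp _ _ q1); exact: cvg_snd.
- by move=> x /H[_ [_ _ /dc]].
- by apply: (cvg_comp _ _ q0); exact: cvg_snd.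
- by move=> x /H[_ [_ _ _ /dc]].
- exact: u0.
- by move=> x /H[_ [_ /dc]].
Qed.

Lemma profile_derivable (x : R) : 0 < x ->
  [/\ is_derive x 1 v (derive1 v x), is_derive x 1 u (derive1 u x),
      is_derive x 1 S (derive1 S x) & is_derive x 1 l (derive1 l x)].
Proof.
have [_ _ _ [_ H] _] := Hw => /H[_ [sv su sS sl] _].
have D f : smooth_at f x -> is_derive x 1 f (derive1 f x).
  by move=> /(_ 0%N) df; split => //; rewrite derive1E.
by split; exact: D.
Qed.

(** Conservation of mass: (u / v)' = 0 for x > 0, and continuity extends the constancy to 0. Hence u
    is a multiple of v, and the profile is governed by its state alone. *)
Lemma vel_eq x : 0 <= x -> u x = m0 * v x.
Proof.
move=> x0; suff : u x / v x = m0 by move=> <-; rewrite mulfVK // gt_eqF // vol_gt0.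
have [cv _ _ cu] := profile_continuous.
have D (y : R) : 0 < y -> is_derive y 1 (fun z => u z / v z) 0.
  move=> y0; have [dv du _ _] := profile_derivable y0.
  have v0 : v y != 0 by rewrite gt_eqF // vol_gt0 // ltW.
  apply: is_derive_eq_val (is_derive_fM du (is_derive_fV v0 dv)) _.
  have [_ _ _ [_ /(_ y y0)[_ _ [E _ _ _]]] _] := Hw.
  apply: (@mulfI _ (v y ^+ 2)); first by rewrite expf_neq0.
  rewrite mulr0; transitivity (- (u y * derive1 v y - v y * derive1 u y)); last by rewrite E oppr0.
  by field.
have c : continuous (fun y : R => u (Num.max 0 y) / v (Num.max 0 y)).
  move=> y; apply: cvgM; first exact: cu.
  by apply: cvgV; [rewrite gt_eqF // vol_gt0 // le_max lexx|exact: cv].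
move: x0; rewrite le_eqVlt => /orP[/eqP <- //|x0].
have [||t _] := @MVT R (fun y : R => u (Num.max 0 y) / v (Num.max 0 y)) (fun=> 0) 0 x x0.
- move=> y; rewrite in_itv /= => /andP[y0 _].
  apply: is_derive_near (D y y0).
  by have := max_near y0; apply: filterS => z ->.
- exact: continuous_subspaceT.
by rewrite mul0r maxxx (max_r (ltW x0)) => /eqP; rewrite subr_eq0 => /eqP.
Qed.

Lemma m0_gt0 : 0 < m0.
Proof. by rewrite divr_gt0 ?vel_gt0 ?vol_gt0. Qed.

Lemma analytic_along_continuous f : analytic f ->
  continuous (fun y : R => f (q (Num.max 0 y))).
Proof.
move=> af; have [cv cS cl _] := profile_continuous => x; apply/continuous_forP => e e0.
have x0 : 0 <= Num.max 0 x by rewrite le_max lexx.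
have [K [r [r0 K0 H]]] := taylor1_lipschitz (analytic_taylor af (dom_profile x0)).
pose t := Num.min (r / 3) (e / (3 * (K + 1))).
have t0 : 0 < t by rewrite lt_min !divr_gt0 // mulr_gt0 //; lra.
have [d1 d10 H1] := (continuous_forP _ x).1 (cv x) t t0.
have [d2 d20 H2] := (continuous_forP _ x).1 (cS x) t t0.
have [d3 d30 H3] := (continuous_forP _ x).1 (cl x) t t0.
exists (Num.min d1 (Num.min d2 d3)); first by rewrite !lt_min d10 d20 d30.
move=> y; rewrite !lt_min => /andP[/H1{}H1 /andP[/H2{}H2 /H3{}H3]].
have st : sdist (q (Num.max 0 x)) (q (Num.max 0 y)) < 3 * t.
  by move: H1 H2 H3; rewrite /sdist /vol /ent /lam; lra.
have tr : 3 * t <= r by have : t <= r / 3 by [rewrite ge_min lexx]; lra.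
have te : 3 * t * (K + 1) <= e.
  have : t <= e / (3 * (K + 1)) by rewrite ge_min lexx orbT.
  by rewrite ler_pdivlMr; nra.
apply: le_lt_trans (H _ (le_trans (ltW st) tr)) _; nra.
Qed.

(** Beyond X the state is within the Lipschitz radius r of the end state; before X the function is
    merely bounded, and the factor exp (beta X) turns this bound into one of the required form. *)
Lemma analytic_along_exp f : analytic f -> exists2 C : R, 0 <= C &
  forall x, 0 <= x -> `|f (q x) - f (st_oo w)| <= C * expR (- beta * x).
Proof.
move=> af; have [_ _ _ _ [_ _ doo _]] := Hw.
have [_ _ [_ [C HC]] _] := Hst.
have [K [r [r0 K0 H]]] := taylor1_lipschitz (analytic_taylor af doo).
have C0 : 0 <= C.
  have [+ _ _ _] := HC 0 (lexx _); rewrite mulr0 expR0 mulr1; exact: le_trans.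
have sd x : 0 <= x -> sdist (st_oo w) (q x) <= 3 * C * expR (- beta * x).
  by move=> /HC[]; rewrite /sdist /vol /ent /lam; lra.
pose X := 3 * C / r / beta.
have X0 : 0 <= X by rewrite !divr_ge0 ?mulr_ge0 // ltW.
have [M M0 HM] := @bounded_on_segment R (fun x => f (q x)) X (analytic_along_continuous af).
exists (K * (3 * C) + (M + `|f (st_oo w)|) * expR (beta * X)).
  by rewrite addr_ge0 ?mulr_ge0 ?expR_ge0 ?addr_ge0.
move=> x x0; have [Xx|xX] := leP X x.
  have sr : sdist (st_oo w) (q x) <= r.
    apply: le_trans (sd x x0) _; rewrite mulNr expRN ler_pdivrMr ?expR_gt0 //.
    have bx : 3 * C / r <= beta * x by rewrite (mulrC beta) -ler_pdivrMr.
    have := expR_ge1Dx (beta * x) => e1.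
    by move: bx; rewrite ler_pdivrMr //; nra.
  apply: le_trans (H _ sr) _.
  rewrite mulrDl -mulrA; apply: (@le_trans _ _ (K * (3 * C * expR (- beta * x)))).
    by rewrite ler_wpM2l ?sd.
  rewrite lerDl !mulr_ge0 ?expR_ge0 ?addr_ge0 //.
have b1 : `|f (q x) - f (st_oo w)| <= M + `|f (st_oo w)|.
  by apply: le_trans (ler_normB _ _) _; rewrite lerD2r HM // x0 ltW.
apply: le_trans b1 _; rewrite mulrDl -[leLHS]add0r lerD //.
  by rewrite !mulr_ge0 ?expR_ge0.
rewrite -mulrA -expRD ler_peMr ?addr_ge0 // -expR0 ler_expR.
by rewrite mulNr subr_ge0 ler_pM2l // ltW.
Qed.

Definition dS_profile x := omega th (q x) / u x.
Definition dlam_profile x := rate th (q x) / u x.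
(** From u u' + v p' = 0 with u' = m v' and c0^2 = - v^2 p_v: (c0^2 - u^2) v' = v^2 (p_S S' +
    p_lambda lambda'). The explicit formulas are continuous up to x = 0, where only one-sided
    derivatives make sense. *)
Definition dvol_profile x := v x ^+ 2 *
  (d_S p (q x) * dS_profile x + d_lam p (q x) * dlam_profile x) / sound_gap x.
Definition along_deriv (f : state R -> R) x := d_v f (q x) * dvol_profile x +
  d_S f (q x) * dS_profile x + d_lam f (q x) * dlam_profile x.

Let analytic_thermo : [/\ analytic p, analytic (temperature th),
  analytic (free_energy th) & analytic (rate th)].
Proof. by have [_ _ [? ? ? _ ?] _ _] := Hth. Qed.

Lemma profile_is_derive (x : R) : 0 < x ->
  [/\ is_derive x 1 v (dvol_profile x), is_derive x 1 u (m0 * dvol_profile x),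
      is_derive x 1 S (dS_profile x) & is_derive x 1 l (dlam_profile x)].
Proof.
move=> x0; have xge := ltW x0; have [dv du dS dl] := profile_derivable x0.
have [_ _ _ [_ /(_ x x0)[_ _ [_ E2 E3 E4]]] _] := Hw.
have u0 : u x != 0 by rewrite gt_eqF // vel_gt0.
have v0 := vol_gt0 xge.
have eS : derive1 S x = dS_profile x by rewrite /dS_profile -E3 mulrC mulKf.
have el : derive1 l x = dlam_profile x by rewrite /dlam_profile -E4 mulrC mulKf.
have du' : is_derive x 1 u (m0 * derive1 v x).
  have H : is_derive x 1 (fun y => m0 * v y) (m0 * derive1 v x).
    apply: is_derive_eq_val (is_derive_fM (is_derive_cst m0 _ _) dv) _.
    by rewrite mul0r add0r.
  apply: (is_derive_near _ H).
  by have := max_near x0; apply: filterS => y <-; rewrite -vel_eq // le_max lexx.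
have eu : derive1 u x = m0 * derive1 v x by exact: is_derive_derive1 du'.
have [ap _ _ _] := analytic_thermo.
have dp := taylor1_chain (analytic_taylor ap (dom_profile xge)) dv dS dl.
move: E2; rewrite (is_derive_derive1 dp) eu eS el => E2.
have ux := vel_eq xge.
have [c cp Hc] := sound_gap_bound; have gp : 0 < sound_gap x := lt_le_trans cp (Hc x xge).
have ev : derive1 v x = dvol_profile x.
  apply: (@mulIf _ (sound_gap x)); first by rewrite gt_eqF.
  rewrite /dvol_profile mulfVK ?gt_eqF // /sound_gap c0_sqr //.
  have -> : u x ^+ 2 = u x * m0 * v x by rewrite expr2 {2}ux mulrA.
  apply/subr0_eq; rewrite [LHS](_ : _ = - v x * (u x * (m0 * derive1 v x) +
    v x * (d_v p (q x) * derive1 v x + d_S p (q x) * dS_profile x + d_lam p (q x) * dlam_profile x))).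
    by rewrite E2 mulr0.
  by ring.
by rewrite -ev -eS -el -eu.
Qed.

Lemma analytic_along_decay f : analytic f -> f (st_oo w) = 0 -> rdec (fun x => f (q x)).
Proof.
move=> af f0; have [C C0 H] := analytic_along_exp af; exists C => // h x _ x0.
by rewrite modcR -[f (q x)]subr0 -f0 H.
Qed.

Lemma analytic_along_bounded f : analytic f -> exists C : R, forall x, 0 <= x -> `|f (q x)| <= C.
Proof.
move=> af; have [C C0 H] := analytic_along_exp af.
exists (C + `|f (st_oo w)|) => x x0; rewrite -[f (q x)](subrK (f (st_oo w))).
apply: le_trans (ler_normD _ _) _; rewrite lerD2r; apply: le_trans (H x x0) _.
by rewrite ler_piMr // (@expR_decay_le1 _ _ 0).
Qed.

Lemma temperature_bound : exists2 c : R, 0 < c & forall x, 0 <= x -> c <= temperature th (q x).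
Proof.
have [_ aT _ _] := analytic_thermo; have [C C0 H] := analytic_along_exp aT.
have [_ _ _ Tp _] := Hth; have [_ _ _ _ [_ _ doo _]] := Hw.
apply: (exp_limit_positive (f := fun x => temperature th (q x)) (l := temperature th (st_oo w))
  (C := C) beta_gt0) => //.
- exact: Tp.
- exact: analytic_along_continuous.
- by move=> x x0; apply: Tp; exact: dom_profile.
Qed.

Lemma rate_decay : rdec (fun x => rate th (q x)).
Proof.
have [_ _ _ ar] := analytic_thermo; apply: analytic_along_decay => //.
by have [_ _ _ _ []] := Hw.
Qed.

Section Induction.
Variable n : nat.
Hypotheses (tv : rt n v) (tf : forall f, analytic f -> rt n (fun x => f (q x))).

Let tu : rt n u.
Proof.
apply: (@rtame_ext _ _ _ _ _ (fun x => m0 * v x)); first by move=> x x0; rewrite (vel_eq x0).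
by apply: rtameM => //; exact: rtame_cst.
Qed.

Let tuV : rt n (fun x => (u x)^-1).
Proof.
have [C1 [C2 [C10 _ H]]] := kappa_vel_bounds.
apply: (rtameV C10); last exact: tu.
move=> x x0; have [_ /andP[u1 _]] := H x x0.
by rewrite gtr0_norm // vel_gt0.
Qed.

Lemma temperatureV_tame : rt n (fun x => (temperature th (q x))^-1).
Proof.
have [c c0 H] := temperature_bound; have [_ aT _ _] := analytic_thermo.
apply: (rtameV c0); last exact: tf.
by move=> x x0; rewrite ger0_norm ?H // (le_trans (ltW c0)) ?H.
Qed.

Lemma omega_tame : rt n (fun x => omega th (q x)).
Proof.
have [_ _ aF ar] := analytic_thermo; apply: rtameN; apply: rtameM; last exact: temperatureV_tame.
by apply: rtameM; exact: tf.
Qed.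

Lemma omega_decay : rdec (fun x => omega th (q x)).
Proof.
have [_ _ aF ar] := analytic_thermo; apply: rdecayingN.
apply: (rdecayingMl (n := n)); last exact: temperatureV_tame.
by apply: (rdecayingMl rate_decay); exact: tf.
Qed.

Lemma dS_profile_tame : rt n dS_profile /\ rdec dS_profile.
Proof.
split; first by apply: rtameM; [exact: omega_tame|exact: tuV].
exact: (rdecayingMl omega_decay tuV).
Qed.

Lemma dlam_profile_tame : rt n dlam_profile /\ rdec dlam_profile.
Proof.
have [_ _ _ ar] := analytic_thermo.
split; first by apply: rtameM; [exact: tf|exact: tuV].
exact: (rdecayingMl rate_decay tuV).
Qed.

Lemma dvol_profile_tame : rt n dvol_profile /\ rdec dvol_profile.
Proof.
have [ap _ _ _] := analytic_thermo.
have [tS dS] := dS_profile_tame; have [tl dl] := dlam_profile_tame.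
have tpv := tf (analytic_on_d_v ap); have tpS := tf (analytic_on_d_S ap).
have tpl := tf (analytic_on_d_lam ap).
have tg : rt n (fun x => (sound_gap x)^-1).
  have [c c0 H] := sound_gap_bound.
  apply: (rtameV c0); first by move=> x x0; rewrite ger0_norm ?H // (le_trans (ltW c0)) ?H.
  apply: (@rtame_ext _ _ _ _ _ (fun x => - (v x * v x * d_v p (q x)) + - (u x * u x))).
    by move=> x x0; rewrite /sound_gap c0_sqr // !expr2.
  by apply: rtameD; apply: rtameN; [exact: rtameM (rtameM tv tv) tpv|exact: rtameM tu tu].
have tv2 : rt n (fun x => v x ^+ 2) by apply: rtameM.
split.
  by apply: rtameM => //; apply: rtameM => //; apply: rtameD; exact: rtameM.
apply: rdecayingMl tg; apply: (rdecayingMr tv2).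
by apply: rdecayingD; [exact: rdecayingMr tpS dS|exact: rdecayingMr tpl dl].
Qed.

Lemma along_deriv_tame f : analytic f -> rt n (along_deriv f) /\ rdec (along_deriv f).
Proof.
move=> af; have [tS dS] := dS_profile_tame; have [tl dl] := dlam_profile_tame.
have [tvp dvp] := dvol_profile_tame.
have tpv := tf (analytic_on_d_v af); have tpS := tf (analytic_on_d_S af).
have tpl := tf (analytic_on_d_lam af).
split.
  by apply: rtameD; [apply: rtameD|]; exact: rtameM.
apply: rdecayingD; first apply: rdecayingD.
- exact: rdecayingMr tpv dvp.
- exact: rdecayingMr tpS dS.
- exact: rdecayingMr tpl dl.
Qed.

End Induction.

Lemma vol_bounded : exists C : R, forall x, 0 <= x -> `|v x| <= C.
Proof.
have [_ _ [_ [C HC]] _] := Hst.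
exists (`|C| + `|vol_of (st_oo w)|) => x x0; rewrite -[v x](subrK (vol_of (st_oo w))).
apply: le_trans (ler_normD _ _) _; rewrite lerD2r; have [H _ _ _] := HC x x0.
apply: le_trans H _; apply: (@le_trans _ _ (`|C| * expR (- beta * x))).
  by rewrite ler_wpM2r ?expR_ge0 ?ler_norm.
by rewrite ler_piMr // (@expR_decay_le1 _ _ 0).
Qed.

(** A bootstrap: the derivatives of v and of f along the profile are built from v, u and analytic
    functions of the state, so regularity of order n passes to them, and they decay because each
    carries a factor [rate]. All analytic f are treated together, since f' involves the partial
    derivatives of f and of the pressure. *)
Lemma profile_tame n : rt n v /\ forall f, analytic f -> rt n (fun x => f (q x)).
Proof.
have [C vC] := vol_bounded; have [cv _ _ _] := profile_continuous.
elim: n => [|n [tv tf]].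
  split; first exact: rtame0_intro vC cv.
  move=> f af; have [M fM] := analytic_along_bounded af.
  exact: rtame0_intro fM (analytic_along_continuous af).
have [tvp dvp] := dvol_profile_tame tv tf.
split.
  apply: rtame_intro vC cv _ dvp tvp => x x0.
  by have [] := profile_is_derive x0.
move=> f af; have [M fM] := analytic_along_bounded af.
have [td dd] := along_deriv_tame tv tf af.
apply: rtame_intro fM (analytic_along_continuous af) _ dd td => x x0.
have [dv _ dS dl] := profile_is_derive x0.
exact: (taylor1_chain (analytic_taylor af (dom_profile (ltW x0))) dv dS dl).
Qed.

End Profile.

(** * The coefficient matrix B *)

Section Linearization.
Variables (R : realType) (th : thermo R) (w : profile R) (beta : R).
Hypotheses (Hth : thermodynamics th) (Hw : strong_detonation th w)
  (Hst : standing_assumptions th w beta).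

Local Notation v := (vol w).
Local Notation S := (ent w).
Local Notation l := (lam w).
Local Notation u := (vel w).
Local Notation q := (st w).
Local Notation p := (pressure th).
Local Notation m0 := (u 0 / v 0).
Local Notation analytic := (analytic_on (dom th)).
Local Notation rt := (rtame beta 1 0).
Local Notation rdec := (rdecaying beta 1 0).

Let beta_gt0 : 0 < beta. Proof. by have [_ _ [b0 _] _] := Hst. Qed.

Let analytic_thermo : [/\ analytic p, analytic (temperature th),
  analytic (free_energy th) & analytic (rate th)].
Proof. by have [_ _ [? ? ? _ ?] _ _] := Hth. Qed.

Let tv n : rt n v := (profile_tame 1 Hth Hw Hst n).1.
Let tf n f (af : analytic f) : rt n (fun x => f (q x)) := (profile_tame 1 Hth Hw Hst n).2 f af.

Lemma vel_tame n : rt n u.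
Proof.
apply: (@rtame_ext _ _ _ _ _ (fun x => m0 * v x)).
  by move=> x x0; rewrite -(vel_eq Hth Hw x0).
by apply: rtameM; [exact: rtame_cst|exact: tv].
Qed.

Lemma c0_tame n : rt n (fun x => c0 th (q x)).
Proof.
have [ap _ _ _] := analytic_thermo; have pos := c0_gt0 Hst.
have [C1 [C2 [C10 C21 H]]] := kappa_vel_bounds Hst.
apply: (@tame_sqrt _ _ _ _ _ _ (fun _ x => (- (v x * v x * d_v p (q x)))%:C)).
- move=> h x _ x0; rewrite -rmorphM -expr2 (c0_sqr Hst x0) expr2.
  by [].
- move=> h hh x; apply: continuousC_real.
  have -> : (fun y => c0 th (q (Num.max 0 y))) =
      (fun y => Num.sqrt (- (v (Num.max 0 y) ^+ 2 * d_v p (q (Num.max 0 y))))) by [].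
  have [cv _ _ _] := profile_continuous Hw.
  apply: continuous_comp; last exact: sqrt_continuous.
  apply: cvgN; apply: cvgM; last exact: (analytic_along_continuous Hw (analytic_on_d_v ap)).
  by apply: cvgM; exact: cv.
- exists C1 => // h x _ x0; rewrite modcR (gtr0_norm (pos x x0)).
  have [/andP[k1 k2] /andP[u1 u2]] := H x x0.
  apply: le_trans u1 _; have E : u x = kappa th w x * c0 th (q x).
    by rewrite /kappa mulfVK // gt_eqF // pos.
  rewrite E ler_piMl //; first exact: ltW (pos x x0).
  lra.
- apply: rtameN; apply: rtameM; last exact: tf (analytic_on_d_v ap).
  by apply: rtameM; exact: tv.
Qed.

(** The quotient rule for omega, with analyticity used separately for the rate, the free energy and
    the temperature. Every term has as factor the rate or a partial derivative of it. *)
Definition omega_deriv (x rx Fx Tx : R) := - ((rx * free_energy th (q x) + rate th (q x) * Fx) *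
   (temperature th (q x))^-1 +
   rate th (q x) * free_energy th (q x) * (- (Tx * (temperature th (q x))^-1 * (temperature th (q x))^-1))).

Let omega_deriv_val (r F T : R -> R) (t rx Fx Tx : R) : T t != 0 ->
  is_derive t 1 r rx -> is_derive t 1 F Fx -> is_derive t 1 T Tx ->
  is_derive t 1 (fun y => - (r y * F y / T y))
    (- ((rx * F t + r t * Fx) * (T t)^-1 + r t * F t * (- (Tx * (T t)^-1 * (T t)^-1)))).
Proof.
move=> T0 Hr HF HT.
apply: is_derive_eq_val (is_derive_fN (is_derive_fM (is_derive_fM Hr HF) (is_derive_fV T0 HT))) _.
by field.
Qed.

Lemma omega_partials x : 0 <= x ->
  [/\ d_v (omega th) (q x) = omega_deriv x (d_v (rate th) (q x))
        (d_v (free_energy th) (q x)) (d_v (temperature th) (q x)),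
      d_S (omega th) (q x) = omega_deriv x (d_S (rate th) (q x))
        (d_S (free_energy th) (q x)) (d_S (temperature th) (q x)) &
      d_lam (omega th) (q x) = omega_deriv x (d_lam (rate th) (q x))
        (d_lam (free_energy th) (q x)) (d_lam (temperature th) (q x))].
Proof.
move=> x0; have dq := dom_profile Hw x0; have [_ aT aF ar] := analytic_thermo.
have [_ _ _ Tp _] := Hth; have T0 : temperature th (q x) != 0 by rewrite gt_eqF // Tp.
have [r1 r2 r3] := taylor1_partials (analytic_taylor ar dq).
have [F1 F2 F3] := taylor1_partials (analytic_taylor aF dq).
have [T1 T2 T3] := taylor1_partials (analytic_taylor aT dq).
rewrite /omega_deriv; move: T0 r1 r2 r3 F1 F2 F3 T1 T2 T3.
case: (q x) => [[a b] c]; rewrite /vol_of /ent_of /lam_of /= => T0 r1 r2 r3 F1 F2 F3 T1 T2 T3.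
split; apply: is_derive_derive1.
- exact: (omega_deriv_val _ r1 F1 T1).
- exact: (omega_deriv_val _ r2 F2 T2).
- exact: (omega_deriv_val _ r3 F3 T3).
Qed.

Lemma omega_deriv_tame n (rx Fx Tx : R -> R) : rt n rx -> rt n Fx -> rt n Tx ->
  rt n (fun x => omega_deriv x (rx x) (Fx x) (Tx x)).
Proof.
move=> t1 t2 t3; have [_ _ aF ar] := analytic_thermo.
have tF := tf n aF; have tr := tf n ar.
have tT := temperatureV_tame Hth Hw Hst (fun f af => tf n af).
apply: rtameN; apply: rtameD.
  by apply: rtameM => //; apply: rtameD; exact: rtameM.
apply: rtameM; first exact: rtameM.
apply: rtameN; apply: rtameM => //; exact: rtameM.
Qed.

Lemma omega_deriv_decay (rx Fx Tx : R -> R) : rdec rx -> rt 0 Fx -> rt 0 Tx ->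
  rdec (fun x => omega_deriv x (rx x) (Fx x) (Tx x)).
Proof.
move=> t1 t2 t3; have [_ _ aF ar] := analytic_thermo.
have tF := tf 0 aF; have dr := rate_decay 1 Hth Hw Hst.
have tT := temperatureV_tame Hth Hw Hst (fun f af => tf 0 af).
apply: rdecayingN; apply: rdecayingD.
  apply: rdecayingMl tT; apply: rdecayingD; [exact: rdecayingMl t1 tF|exact: rdecayingMl dr t2].
apply: (rdecayingMl (n := 0)); first exact: rdecayingMl dr tF.
apply: rtameN; apply: rtameM => //; exact: rtameM.
Qed.

(** Along t |-> (v, S, t lambda), t from 0 to 1, the rate vanishes at both ends, so r_lambda lambda
    = 0 at some point by the mean value theorem, while r_lambda < 0. The closure of [dom] under
    scaling of lambda keeps the segment in the domain. *)
Lemma lam_oo : lam_of (st_oo w) = 0.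
Proof.
have [_ _ _ _ [_ _ doo roo]] := Hw; have [_ _ _ [r0 rl _ _]] := Hst.
have [_ hom _ _ _] := Hth; have [_ _ _ ar] := analytic_thermo.
move: doo roo; case: (st_oo w) => [[a b] c] doo roo; rewrite /lam_of /=.
have dt t : 0 <= t <= 1 -> dom th (a, b, t * c) by move=> /hom; exact.
have D (t : R) : 0 <= t <= 1 -> is_derive t 1 (fun s => rate th (a, b, s * c)) (d_lam (rate th) (a, b, t * c) * c).
  move=> t01; have [_ _ H] := taylor1_partials (analytic_taylor ar (dt t t01)).
  apply: (is_derive1_comp (f := fun s => rate th (a, b, s)) (g := fun s => s * c) H).
  apply: is_derive_eq_val (is_derive_fM (is_derive_id _ _) (is_derive_cst c _ _)) _.
  by rewrite mul1r mulr0 addr0.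
have [t t01 E] := mean_value (df := fun t => d_lam (rate th) (a, b, t * c) * c) ler01 D.
have d0 : dom th (a, b, 0) by rewrite -(mul0r c); apply: dt; rewrite lexx ler01.
move: E; rewrite mul1r mul0r roo (r0 _ d0) // subr0 subr0 mulr1.
move/esym/eqP; rewrite mulf_eq0 => /orP[/eqP H|/eqP //].
by have := rl _ (dt t t01); rewrite H ltxx.
Qed.

Lemma rate_partials_decay : rdec (fun x => d_v (rate th) (q x)) /\
  rdec (fun x => d_S (rate th) (q x)).
Proof.
have [_ _ _ _ [_ _ doo roo]] := Hw; have [_ _ _ [_ _ rv rS]] := Hst.
have [_ _ _ ar] := analytic_thermo; have l0 := lam_oo.
split; apply: (analytic_along_decay 1 Hw Hst).
- exact: analytic_on_d_v.
- exact: rv.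
- exact: analytic_on_d_S.
- exact: rS.
Qed.

Lemma rtame_continuous n (g : R -> R) : rt n g -> continuous (fun y : R => g (Num.max 0 y)).
Proof.
move=> /tame_continuous cg y; have h1 : 0 < (2^-1 : R) < 1 by lra.
by have [] := cg _ h1 y.
Qed.

Let deriv_tame n : [/\ rt n (dvol_profile th w), rt n (dS_profile th w) &
  rt n (dlam_profile th w)].
Proof.
have [H1 _] := dvol_profile_tame Hth Hw Hst (tv n) (fun f => @tf n f).
have [H2 _] := dS_profile_tame Hth Hw Hst (tv n) (fun f => @tf n f).
by have [H3 _] := dlam_profile_tame Hth Hw Hst (tv n) (fun f => @tf n f).
Qed.

Let deriv_decay : [/\ rdec (dvol_profile th w), rdec (dS_profile th w) &
  rdec (dlam_profile th w)].
Proof.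
have [_ H1] := dvol_profile_tame Hth Hw Hst (tv 0) (fun f => @tf 0 f).
have [_ H2] := dS_profile_tame Hth Hw Hst (tv 0) (fun f => @tf 0 f).
by have [_ H3] := dlam_profile_tame Hth Hw Hst (tv 0) (fun f => @tf 0 f).
Qed.

Lemma ddx_profile x : 0 <= x ->
  [/\ ddx v x = dvol_profile th w x, ddx u x = m0 * dvol_profile th w x,
      ddx S x = dS_profile th w x & ddx l x = dlam_profile th w x].
Proof.
move=> x0; have [t1 t2 t3] := deriv_tame 0.
have [cv cS cl cu] := profile_continuous Hw.
have D y : 0 < y -> _ := @profile_is_derive _ _ _ _ Hth Hw Hst y.
have cm : continuous (fun y : R => m0 * dvol_profile th w (Num.max 0 y)).
  by apply: (@rtame_continuous 0 (fun x => m0 * dvol_profile th w x)); apply: rtameM => //; exact: rtame_cst.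
split.
- apply: (@ddx_eq _ v (dvol_profile th w) cv (rtame_continuous t1) _ x x0).
  by move=> y /D[].
- apply: (@ddx_eq _ u (fun x => m0 * dvol_profile th w x) cu cm _ x x0).
  by move=> y /D[].
- apply: (@ddx_eq _ S (dS_profile th w) cS (rtame_continuous t2) _ x x0).
  by move=> y /D[].
- apply: (@ddx_eq _ l (dlam_profile th w) cl (rtame_continuous t3) _ x x0).
  by move=> y /D[].
Qed.

Lemma ddx_along f x : analytic f -> 0 <= x -> ddx (fun y => f (q y)) x = along_deriv th w f x.
Proof.
move=> af x0; have [td _] := along_deriv_tame Hth Hw Hst (tv 0) (fun f => @tf 0 f) af.
apply: (@ddx_eq _ (fun y => f (q y)) (along_deriv th w f)
  (analytic_along_continuous Hw af) (rtame_continuous td) _ x x0).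
- move=> y y0; have [dv _ dS dl] := profile_is_derive Hth Hw Hst y0.
  exact: (taylor1_chain (analytic_taylor af (dom_profile Hw (ltW y0))) dv dS dl).
Qed.

Let along_tame n f : analytic f -> rt n (along_deriv th w f).
Proof. by move=> af; have [] := along_deriv_tame Hth Hw Hst (tv n) (fun f => @tf n f) af. Qed.

Let along_decay f : analytic f -> rdec (along_deriv th w f).
Proof. by move=> af; have [] := along_deriv_tame Hth Hw Hst (tv 0) (fun f => @tf 0 f) af. Qed.

(** The quotient is - p_v, so no root has to be differentiated. *)
Lemma ddx_sound x : 0 <= x ->
  ddx (fun y => c0 th (q y) ^+ 2 / vol_of (q y) ^+ 2) x = - along_deriv th w (d_v p) x.
Proof.
move=> x0; have [ap _ _ _] := analytic_thermo; have apv := analytic_on_d_v ap.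
have E y : 0 <= y -> c0 th (q y) ^+ 2 / vol_of (q y) ^+ 2 = - d_v p (q y).
  move=> y0; rewrite (c0_sqr Hst y0) -/(v y).
  by have := vol_gt0 Hth Hw y0 => vy; field; rewrite gt_eqF.
have cp : continuous (fun y : R => - d_v p (q (Num.max 0 y))).
  by have H := analytic_along_continuous Hw apv; move=> y; apply: cvgN; exact: H.
have cd : continuous (fun y : R => - along_deriv th w (d_v p) (Num.max 0 y)).
  apply: (@rtame_continuous 0 (fun x => - along_deriv th w (d_v p) x)).
  by apply: rtameN; exact: along_tame.
have cs : continuous (fun y : R => c0 th (q (Num.max 0 y)) ^+ 2 / vol_of (q (Num.max 0 y)) ^+ 2).
  rewrite (_ : (fun y => _) = (fun y : R => - d_v p (q (Num.max 0 y)))) //.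
  by apply/funext => y; rewrite E // le_max lexx.
have H (y : R) : 0 < y -> is_derive y 1 (fun y : R => c0 th (q y) ^+ 2 / vol_of (q y) ^+ 2)
    (- along_deriv th w (d_v p) y); last exact: (@ddx_eq _ _ (fun x => - _) cs cd H).
move=> y0; have [dv _ dS dl] := profile_is_derive Hth Hw Hst y0.
apply: (is_derive_near _ (is_derive_fN (taylor1_chain (analytic_taylor apv (dom_profile Hw (ltW y0))) dv dS dl))).
by have := max_near y0; apply: filterS => z <-; rewrite E // le_max lexx.
Qed.

(** B with explicit formulas in place of its derivatives, so that regularity and decay can be read
    off entry by entry. *)
Definition Brows x : seq (seq R) :=
  let vp := dvol_profile th w x in
  [:: [:: - (m0 * vp); vp; 0; 0; 0];
      [:: along_deriv th w p x - v x * - along_deriv th w (d_v p) x; m0 * vp; 0;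
          v x * along_deriv th w (d_S p) x; v x * along_deriv th w (d_lam p) x];
      [:: 0; 0; 0; 0; 0];
      [:: - omega_deriv x (d_v (rate th) (q x)) (d_v (free_energy th) (q x)) (d_v (temperature th) (q x));
          dS_profile th w x; 0;
          - omega_deriv x (d_S (rate th) (q x)) (d_S (free_energy th) (q x)) (d_S (temperature th) (q x));
          - omega_deriv x (d_lam (rate th) (q x)) (d_lam (free_energy th) (q x)) (d_lam (temperature th) (q x))];
      [:: - d_v (rate th) (q x); dlam_profile th w x; 0;
          - d_S (rate th) (q x); - d_lam (rate th) (q x)]].

Lemma BmxE x : 0 <= x -> Bmx th w x = mx_of_rows 5 (Brows x).
Proof.
move=> x0; have [ap _ _ _] := analytic_thermo.
have [e1 e2 e3 e4] := ddx_profile x0; have [w1 w2 w3] := omega_partials x0.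
rewrite /Bmx /Brows e1 e2 e3 e4 w1 w2 w3 (ddx_along ap x0) (ddx_along (analytic_on_d_S ap) x0).
by rewrite (ddx_along (analytic_on_d_lam ap) x0) (ddx_sound x0).
Qed.

Let rt0 n : rt n (fun=> 0). Proof. exact: rtame_cst. Qed.

Lemma Bmx_tame n (i j : 'I_5) : rt n (fun x => Bmx th w x i j).
Proof.
apply: (@rtame_ext _ _ _ _ _ (fun x => mx_of_rows 5 (Brows x) i j)).
  by move=> x x0; rewrite BmxE.
have [ap aT aF ar] := analytic_thermo; have [t1 t2 t3] := deriv_tame n.
have tm : rt n (fun x => m0 * dvol_profile th w x) by apply: rtameM => //; exact: rtame_cst.
have tp := along_tame n ap; have tpv := along_tame n (analytic_on_d_v ap).
have tpS := along_tame n (analytic_on_d_S ap); have tpl := along_tame n (analytic_on_d_lam ap).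
have o1 := omega_deriv_tame (tf n (analytic_on_d_v ar)) (tf n (analytic_on_d_v aF)) (tf n (analytic_on_d_v aT)).
have o2 := omega_deriv_tame (tf n (analytic_on_d_S ar)) (tf n (analytic_on_d_S aF)) (tf n (analytic_on_d_S aT)).
have o3 := omega_deriv_tame (tf n (analytic_on_d_lam ar)) (tf n (analytic_on_d_lam aF)) (tf n (analytic_on_d_lam aT)).
have r1 := tf n (analytic_on_d_v ar); have r2 := tf n (analytic_on_d_S ar); have r3 := tf n (analytic_on_d_lam ar).
have tvn := tv n.
apply: (@rtame_ext _ _ _ _ _ (fun x => nth 0 (nth [::] (Brows x) i) j)).
  by move=> x _; rewrite /mx_of_rows mxE.
case: i => -[|[|[|[|[|i]]]]] //= _; case: j => -[|[|[|[|[|j]]]]] //= _; try exact: rt0.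
- exact: rtameN.
- by apply: rtameD => //; apply: rtameN; apply: rtameM => //; exact: rtameN.
- exact: rtameM.
- exact: rtameM.
- exact: rtameN.
- exact: rtameN.
- exact: rtameN.
- exact: rtameN.
- exact: rtameN.
- exact: rtameN.
Qed.

(** The partial derivatives of omega and r in v and S decay because r, r_v and r_S vanish at the end
    state; those in lambda, in the last column, tend to limits that need not vanish. Transposition
    makes this column the last row of M. *)
Lemma Bmx_decay (i j : 'I_5) : j != 4%N :> nat -> rdec (fun x => Bmx th w x i j).
Proof.
move=> j4; apply: (@decaying_ext _ _ _ _ (fun _ x => (mx_of_rows 5 (Brows x) i j)%:C)).
  by move=> h x _ x0; rewrite BmxE.
have [ap aT aF ar] := analytic_thermo; have [d1 d2 d3] := deriv_decay.
have dm : rdec (fun x => m0 * dvol_profile th w x).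
  by apply: (rdecayingMr (n := 0)) => //; exact: rtame_cst.
have dp := along_decay ap; have dpv := along_decay (analytic_on_d_v ap).
have dpS := along_decay (analytic_on_d_S ap).
have [r1 r2] := rate_partials_decay.
have o1 := omega_deriv_decay r1 (tf 0 (analytic_on_d_v aF)) (tf 0 (analytic_on_d_v aT)).
have o2 := omega_deriv_decay r2 (tf 0 (analytic_on_d_S aF)) (tf 0 (analytic_on_d_S aT)).
have tv0 := tv 0.
have d0 : rdec (fun=> 0) by exact: decaying0.
apply: (@decaying_ext _ _ _ _ (fun _ x => (nth 0 (nth [::] (Brows x) i) j)%:C)).
  by move=> h x _ _; rewrite /mx_of_rows mxE.
case: i => -[|[|[|[|[|i]]]]] //= _; case: j j4 => -[|[|[|[|[|j]]]]] //= _ _; try exact: d0.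
- exact: rdecayingN dm.
- apply: rdecayingD => //; apply: rdecayingN; apply: (rdecayingMr tv0); exact: rdecayingN.
- exact: rdecayingMr tv0 dpS.
- exact: rdecayingN o1.
- exact: rdecayingN o2.
- exact: rdecayingN r1.
- exact: rdecayingN r2.
Qed.

End Linearization.

(** * Diagonalization of the principal symbol *)

Section Symbol.
Variable K : numFieldType.
Variables (u v c pS pl z s g I : K).
Hypotheses (u0 : u != 0) (v0 : v != 0) (c0n : c != 0) (s0 : s != 0)
  (D0 : c * z + u * s != 0) (dl0 : u ^+ 2 - c ^+ 2 != 0)
  (sE : s ^+ 2 = z ^+ 2 + c ^+ 2 - u ^+ 2) (IE : I ^+ 2 = -1).

Local Notation dl := (u ^+ 2 - c ^+ 2).
Local Notation D := (c * z + u * s).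

(* [p_v] is eliminated through [c ^+ 2 = - v ^+ 2 * p_v]. *)
Definition Ax_symbol : 'M[K]_5 := let pv := - (c ^+ 2 / v ^+ 2) in mx_of_rows 5
  [:: [:: u; - v; 0; 0; 0]; [:: v * pv; u; 0; v * pS; v * pl];
      [:: 0; 0; u; 0; 0]; [:: 0; 0; 0; u; 0]; [:: 0; 0; 0; 0; u]].

Definition Ax_inv : 'M[K]_5 := mx_of_rows 5
  [:: [:: u / dl; v / dl; 0; - (v ^+ 2 * pS / (dl * u)); - (v ^+ 2 * pl / (dl * u))];
      [:: c ^+ 2 / (v * dl); u / dl; 0; - (v * pS / dl); - (v * pl / dl)];
      [:: 0; 0; u^-1; 0; 0]; [:: 0; 0; 0; u^-1; 0]; [:: 0; 0; 0; 0; u^-1]].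

Definition Ay_symbol : 'M[K]_5 := let pv := - (c ^+ 2 / v ^+ 2) in mx_of_rows 5
  [:: [:: 0; 0; - v; 0; 0]; [:: 0; 0; 0; 0; 0];
      [:: v * pv; 0; 0; v * pS; v * pl]; [:: 0; 0; 0; 0; 0]; [:: 0; 0; 0; 0; 0]].

Definition Phi_symbol : 'M[K]_5 := mx_of_rows 5
  [:: [:: z * u / dl; z * c ^+ 2 / (v * dl); - (I * c ^+ 2 / (u * v)); 0; 0];
      [:: z * v / dl; z * u / dl; 0; 0; 0];
      [:: - (I * u * v / dl); - (I * c ^+ 2 / dl); z / u; 0; 0];
      [:: - (z * v ^+ 2 * pS / (dl * u)); - (z * v * pS / dl); I * v * pS / u; z / u; 0];
      [:: - (z * v ^+ 2 * pl / (dl * u)); - (z * v * pl / dl); I * v * pl / u; 0; z / u]].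

(* The third column is an eigenvector for [z / u] modulo the second one, of which
   any multiple [g] may be added. *)
Definition R_symbol : 'M[K]_5 :=
  let a := c * s / (u * v) in let b := - ((c * s + u * z) / v) - g * a in
  let fS := - (pS * v ^+ 2 / c ^+ 2) in let fl := - (pl * v ^+ 2 / c ^+ 2) in
  mx_of_rows 5
  [:: [:: a; - a; b; 0; 0];
      [:: z / u; z / u; z + u * s / c + g * z / u; 0; 0];
      [:: - I; - I; - (I * g); 0; 0];
      [:: fS * a; - (fS * a); fS * b; 1; 0];
      [:: fl * a; - (fl * a); fl * b; 0; 1]].

Definition Q_symbol : 'M[K]_5 :=
  let y1 := u * (c * s + u * z) / (2 * s * D) in
  let y2 := I * z * (c * s + u * z) / (2 * s * D) in
  mx_of_rows 5
  [:: [:: u * v / (2 * c * s); y1; I / 2 - y2; 0; 0];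
      [:: - (u * v / (2 * c * s)); - y1 - g * c / D; I / 2 + y2 + g * (I * c * z / (u * D)); 0; 0];
      [:: 0; c / D; - (I * c * z / (u * D)); 0; 0];
      [:: pS * v ^+ 2 / c ^+ 2; 0; 0; 1; 0];
      [:: pl * v ^+ 2 / c ^+ 2; 0; 0; 0; 1]].

Definition eig_symbol (j : nat) : K :=
  nth 0 [:: (u * z + c * s) / dl; (u * z - c * s) / dl; z / u; z / u; z / u] j.

(** The second eigenvector occurs with coefficient - z in the image of the third column; adding g
    times it to that column contributes g (mu_2 - z / u). *)
Definition off_symbol : K := - z + g * (eig_symbol 1 - z / u).

Definition Lam_symbol : 'M[K]_5 := \matrix_(i, j)
  ((i == j)%:R * eig_symbol j + ((i == 1%N :> nat) && (j == 2%N :> nat))%:R * off_symbol).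

Ltac entries := let i := fresh "i" in let j := fresh "j" in apply/matrixP => i j;
  rewrite !mxE ?big_ord_recl ?big_ord0;
  case: i => -[|[|[|[|[|?]]]]] //= ?; case: j => -[|[|[|[|[|?]]]]] //= ?; rewrite ?mxE /=.

Lemma Ax_invE : Ax_symbol *m Ax_inv = 1%:M.
Proof. by entries; field; rewrite ?u0 ?v0 ?dl0. Qed.

Lemma Phi_symbolE : (Ax_inv *m (z%:M + I *: Ay_symbol))^T = Phi_symbol.
Proof. by entries; field; rewrite ?u0 ?v0 ?dl0. Qed.

Lemma R_symbol_inv : R_symbol *m Q_symbol = 1%:M.
Proof. entries; field: IE sE; by rewrite ?u0 ?v0 ?c0n ?s0 ?D0. Qed.

Lemma Phi_R_symbol : Phi_symbol *m R_symbol = R_symbol *m Lam_symbol.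
Proof.
by entries; rewrite /off_symbol /eig_symbol /=; field: IE sE; rewrite ?u0 ?v0 ?c0n ?s0 ?dl0.
Qed.

End Symbol.

(** * The branch of the square root *)

Section SquareRootBranch.
Variables (R : realType) (th : thermo R) (w : profile R).

Local Notation gap x := (c0 th (st w x) ^+ 2 * eta th w x).

Lemma sqrtc_spec (z : R[i]) : [/\ sqrtc z ^+ 2 = z, 0 <= complex.Re (sqrtc z),
  0 <= complex.Im (sqrtc z) * complex.Im z &
  complex.Im z = 0 -> 0 <= complex.Im (sqrtc z)].
Proof.
split; first exact: sqr_sqrtc.
- by case: z => a b /=; exact: sqrtr_ge0.
- case: z => a b /=; case: eqP => [->|_]; first by rewrite mulr0.
  by rewrite mulrAC mulr_ge0 ?sqrtr_ge0 // -normrEsg.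
- by case: z => a b /= ->; rewrite eqxx mul1r sqrtr_ge0.
Qed.

(** These properties stand for the branch from here on. Re z <= Re s is what puts Re mu_1 below the
    other real parts, and the sign of Im s, copied from Im z, prevents cancellation in sums of
    values of s. *)
Lemma sfun_spec (x : R) (z : R[i]) : 0 <= complex.Re z -> 0 < gap x ->
  let s := Defs.sfun th w x z in
  [/\ s ^+ 2 = z ^+ 2 + (gap x)%:C, complex.Re z <= complex.Re s,
      0 <= complex.Im s * complex.Im z & complex.Im z = 0 -> complex.Im s = 0].
Proof.
move=> zre g0 s; set d := gap x in g0 *.
have [E r0 rI rI0] := sqrtc_spec (z ^+ 2 + d%:C); set r := sqrtc _ in E r0 rI rI0.
have sr : s = r \/ s = - r by rewrite /s /Defs.sfun -/d -/r; do !case: ifP => _; auto.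
have sE : s ^+ 2 = z ^+ 2 + d%:C by case: sr => ->; rewrite ?sqrrN E.
have s0I : 0 <= complex.Re s /\ 0 <= complex.Im s * complex.Im z.
  have E1 := congr1 (@complex.Re R) E; have E2 := congr1 (@complex.Im R) E.
  rewrite /s /Defs.sfun -/d -/r.
  move: E1 E2 rI rI0; rewrite !expr2 !ReCD !ImCD !ReCM !ImCM /=.
  move: zre r0; set a := complex.Re z; set b := complex.Im z.
  set p := complex.Re r; set t := complex.Im r => a0 p0 E1 E2 rI rI0.
  have [az|az|az] := ltgtP 0 a; [| lra |].
    split => //; move: rI; rewrite addr0 => rI; nra.
  have {}rI0 : 0 <= t by apply: rI0; rewrite -az; ring.
  case: ifP => [pos|/negbT neg].
    rewrite -/t -/p; rewrite -az in E1 E2 pos; split => //.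
    have /eqP : p * t = 0 by lra.
    rewrite mulf_eq0 => /orP[/eqP pz|/eqP ->]; last by rewrite mul0r.
    by have -> : t = 0 by [apply/eqP; rewrite -sqrf_eq0 expr2; apply/eqP; nra]; rewrite mul0r.
  rewrite -ltNge in neg; rewrite -az in E1 E2 neg.
  have p00 : p = 0 by nra.
  case: ifP => [b0|/negbT b0]; first by split => //; nra.
  rewrite -leNgt in b0; rewrite ReCN ImCN -/p -/t p00 oppr0; split => //; nra.
have [s0 sI] := s0I.
have F1 := congr1 (@complex.Re R) sE; have F2 := congr1 (@complex.Im R) sE.
move: F1 F2 s0 sI; rewrite !expr2 !ReCD !ImCD !ReCM !ImCM /=.
move: zre; set a := complex.Re z; set b := complex.Im z.
set p := complex.Re s; set t := complex.Im s => a0 F1 F2 p0 tb.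
split => //; last first.
  by move=> b0; rewrite b0 in F1 F2; apply/eqP; rewrite -sqrf_eq0 expr2; apply/eqP; nra.
rewrite leNgt; apply/negP => pa.
(* The parts of s^2 = z^2 + d read p^2 - t^2 = a^2 - b^2 + d and p t = a b; eliminating t gives (p^2
   - a^2) (p^2 + b^2) = p^2 d, which rules out p < a unless p = 0. *)
have id : (p * p - a * a) * (p * p + b * b) = p * p * d.
  have F3 : p * t = a * b by lra.
  have -> : (p * p - a * a) * (p * p + b * b) = p * p * (p * p - t * t) +
     ((p * t) ^+ 2 - (a * b) ^+ 2) - p * p * (a * a - b * b) by ring.
  by rewrite F1 F3; ring.
have [pz|pz] := eqVneq p 0.
  have b0 : b = 0 by have : a * b = 0 by [rewrite pz in F2; lra]; move=> /eqP; rewrite mulf_eq0 => /orP[/eqP|/eqP] //; lra.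
  by rewrite pz b0 in F1; nra.
have pp : 0 < p * p by rewrite -expr2 exprn_even_gt0.
have : 0 < p * p * d by rewrite mulr_gt0.
rewrite -id; have : 0 <= p * p + b * b by nra.
have : p * p - a * a < 0 by nra.
nra.
Qed.

(** At an angle of at most a right angle there is no cancellation in s + t, which makes it a safe
    divisor in s - t = (s^2 - t^2) / (s + t). *)
Lemma same_side_modc (s t : R[i]) :
  0 <= complex.Re s * complex.Re t + complex.Im s * complex.Im t ->
  modc s <= modc (s + t) /\ modc (s - t) <= modc (s + t).
Proof.
move=> H; have le2 (x y : R) : 0 <= y -> x ^+ 2 <= y ^+ 2 -> x <= y.
  move=> y0; have [x0|x0] := leP 0 x; last by move=> _; lra.
  by rewrite ler_pXn2r // nnegrE.
by split; apply: le2; rewrite ?modc_ge0 // !modc_sqr !ReCD !ImCD ?ReCN ?ImCN; nra.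
Qed.

Lemma same_sideP (z s t : R[i]) : 0 <= complex.Re z -> complex.Re z <= complex.Re s ->
  complex.Re z <= complex.Re t -> 0 <= complex.Im s * complex.Im z ->
  0 <= complex.Im t * complex.Im z -> (complex.Im z = 0 -> complex.Im s = 0) ->
  0 <= complex.Re s * complex.Re t + complex.Im s * complex.Im t.
Proof.
move=> z0 s1 t1 s2 t2 s3.
apply: addr_ge0; first by apply: mulr_ge0; exact: le_trans z0 _.
have [b0|b0] := eqVneq (complex.Im z) 0; first by rewrite s3 // mul0r.
have b2 : 0 < complex.Im z ^+ 2 by rewrite exprn_even_gt0.
have := mulr_ge0 s2 t2.
rewrite [X in 0 <= X -> _](_ : _ = complex.Im s * complex.Im t * complex.Im z ^+ 2); last by ring.
by rewrite pmulr_lge0.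
Qed.

Lemma sfun_same_side (x y : R) (z : R[i]) : 0 <= complex.Re z -> 0 < gap x -> 0 < gap y ->
  0 <= complex.Re (Defs.sfun th w x z) * complex.Re (Defs.sfun th w y z) +
       complex.Im (Defs.sfun th w x z) * complex.Im (Defs.sfun th w y z).
Proof.
move=> z0 gx gy; have [_ s1 s2 s3] := sfun_spec z0 gx; have [_ t1 t2 _] := sfun_spec z0 gy.
exact: same_sideP z0 s1 t1 s2 t2 s3.
Qed.

(** From |s - t| <= |s + t| follows |s - t|^2 <= |s^2 - t^2|. This gives continuity in x without a
    lower bound for s, hence also to the left of a, where s may vanish. *)
Lemma sfun_dist_sqr (x y : R) (z : R[i]) : 0 <= complex.Re z -> 0 < gap x -> 0 < gap y ->
  modc (Defs.sfun th w x z - Defs.sfun th w y z) ^+ 2 <= `|gap x - gap y|.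
Proof.
move=> z0 gx gy; have [_ H] := same_side_modc (sfun_same_side z0 gx gy).
have [E1 _ _ _] := sfun_spec z0 gx; have [E2 _ _ _] := sfun_spec z0 gy.
move: E1 E2 H; move: (Defs.sfun th w x z) (Defs.sfun th w y z) (gap x) (gap y) => s t a b E1 E2 H.
rewrite -modcR expr2; apply: le_trans (ler_wpM2l (modc_ge0 _) H) _.
rewrite -modcM (_ : _ * _ = s ^+ 2 - t ^+ 2); last by ring.
by rewrite E1 E2 [X in modc X <= _](_ : _ = (a - b)%:C) // rmorphB /=; ring.
Qed.

(* Since [Im s * Im z >= 0], the values at two nearby points of the closed right
   half plane lie on the same side unless [Im z] changes sign, and then
   [Re s] is bounded below. *)
Lemma sfun_lipschitz_param (c : R) (zeta z : R[i]) (x : R) : 0 < c ->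
  0 <= complex.Re zeta -> 0 <= complex.Re z -> 0 < gap x -> c ^+ 2 <= gap x ->
  c <= modc (Defs.sfun th w x zeta) ->
  (complex.Im zeta != 0 -> 0 <= complex.Im zeta * complex.Im z) ->
  c * modc (Defs.sfun th w x z - Defs.sfun th w x zeta) <= modc (z - zeta) * (modc z + modc zeta).
Proof.
move=> cp r1 r2 g0 gc sc side.
have [E1 a1 b1 d1] := sfun_spec r1 g0; have [E2 a2 b2 d2] := sfun_spec r2 g0.
move: (Defs.sfun th w x zeta) (Defs.sfun th w x z) sc E1 a1 b1 d1 E2 a2 b2 d2.
move: (gap x) gc {g0} => d gc s t sc E1 a1 b1 d1 E2 a2 b2 d2.
have ct : c <= modc (s + t).
  (* For Im zeta = 0 the value s is real with s^2 = zeta^2 + d >= c^2, so Re (s + t) >= c on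
     whichever side t lies. Otherwise s and t lie on the same side. *)
  have [i0|i0] := eqVneq (complex.Im zeta) 0.
    apply: le_trans (le_trans (ler_norm _) (Re_le_modc (s + t))).
    rewrite ReCD; suff : c <= complex.Re s by lra.
    have s0 := d1 i0; have := congr1 (@complex.Re R) E1.
    by rewrite !expr2 ReCD !ReCM s0 i0 /=; nra.
  apply: le_trans sc _; apply: (same_side_modc _).1.
  have {}side := side i0; apply: addr_ge0; first by apply: mulr_ge0; lra.
  have z2 : 0 < complex.Im zeta ^+ 2 by rewrite exprn_even_gt0.
  have [iz|iz] := eqVneq (complex.Im z) 0; first by rewrite (d2 iz) mulr0.
  have P : 0 < complex.Im zeta * complex.Im z.
    by rewrite lt0r side mulf_neq0.
  have := mulr_ge0 b1 b2.
  rewrite [X in 0 <= X -> _](_ : _ = complex.Im s * complex.Im t * (complex.Im zeta * complex.Im z)); last by ring.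
  by rewrite pmulr_lge0.
apply: le_trans (ler_wpM2r (modc_ge0 _) ct) _.
rewrite -modcM (_ : (s + t) * (t - s) = (z - zeta) * (z + zeta)); last first.
  have -> : (s + t) * (t - s) = t ^+ 2 - s ^+ 2 by ring.
  by rewrite E1 E2; ring.
by rewrite modcM ler_wpM2l ?modc_ge0 // modcD.
Qed.

End SquareRootBranch.

(** * Removal of the first-order coupling *)

Notation i0 := (@Ordinal 5 0 isT).
Notation i1 := (@Ordinal 5 1 isT).
Notation i2 := (@Ordinal 5 2 isT).
Notation i3 := (@Ordinal 5 3 isT).
Notation i4 := (@Ordinal 5 4 isT).

Lemma ord5_ind (P : 'I_5 -> Prop) : P i0 -> P i1 -> P i2 -> P i3 -> P i4 -> forall j, P j.
Proof.
move=> P0 P1 P2 P3 P4 [[|[|[|[|[|j]]]]] Hj] //.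
- by rewrite (_ : Ordinal Hj = i0) //; apply: val_inj.
- by rewrite (_ : Ordinal Hj = i1) //; apply: val_inj.
- by rewrite (_ : Ordinal Hj = i2) //; apply: val_inj.
- by rewrite (_ : Ordinal Hj = i3) //; apply: val_inj.
- by rewrite (_ : Ordinal Hj = i4) //; apply: val_inj.
Qed.

Lemma sum_ord5 (V : nmodType) (F : 'I_5 -> V) :
  \sum_k F k = F i0 + (F i1 + (F i2 + (F i3 + F i4))).
Proof.
rewrite !big_ord_recl big_ord0 addr0.
by do 4 (congr (_ + _); first by congr F; apply: val_inj); congr F; apply: val_inj.
Qed.

Section Reduction.
Variable K : fieldType.
Variables (lam sg dsg Z : 'I_5 -> K) (G : 'I_5 -> 'I_5 -> K) (o b bt h E : K).

Definition Gd j k := G j k - (if j == k then G i0 i0 else 0).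

Definition system_coeff j k := h^-1 * ((if j == k then lam j - lam i0 else 0) +
  (if (j == i1) && (k == i2) then o else 0)) + Gd j k.

(** [bt] is the rate of the factor exp (- beta x) extracted from Z. The non-decaying part b of row 4
    joins the diagonal, where, being nonnegative in the application, it helps. *)
Definition diag_coeff j := h^-1 * (lam j - lam i0) + bt + (if j == i4 then b else 0).

Definition residual j := \sum_k Gd j k * sg k - (if j == i4 then b * sg i4 else 0)
  - sg j * (h * \sum_k G i0 k * sg k) - dsg j.

Definition coupling j k := Gd j k - (if (j == i4) && (k == i4) then b else 0)
  - h * sg j * G i0 k.

(** Column 0 reduces to h [residual]: a change Z_0 of the coefficient of e_0 is accompanied by its
    own corrector h Z_0 [sg]. *)
Definition off_coeff j k := if k == i0 then h * residual j else
  h^-1 * (if (j == i1) && (k == i2) then o else 0) + coupling j k.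

(* With [sg] solving the first-order equation, [Y = X + h X_0 sg] turns the system
   for [Y] into one for [X = e_0 + E Z] whose only [O(1/h)] terms are [diag_coeff]
   and [o]. *)
Lemma reduction_identity : h != 0 -> sg i0 = 0 -> dsg i0 = 0 ->
  (forall j, j != i0 -> (lam j - lam i0 + (if j == i4 then h * b else 0)) * sg j =
     - (G j i0 + (if j == i1 then o * sg i2 else 0))) ->
  let X j := (if j == i0 then 1 else 0) + E * Z j in
  let dX j := - (bt * E) * Z j + E * (diag_coeff j * Z j + \sum_k off_coeff j k * Z k)
     + h * residual j in
  forall j, dX j + h * (dX i0 * sg j + X i0 * dsg j) =
    \sum_k system_coeff j k * (X k + h * X i0 * sg k).
Proof.
move=> hn s0 ds0 Hs X dX j.
have G1 : G i1 i0 = - ((lam i1 - lam i0) * sg i1) - o * sg i2.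
  by have := Hs i1 isT; rewrite /= addr0 => ->; ring.
have G2 : G i2 i0 = - ((lam i2 - lam i0) * sg i2).
  by have := Hs i2 isT; rewrite /= addr0 => ->; ring.
have G3 : G i3 i0 = - ((lam i3 - lam i0) * sg i3).
  by have := Hs i3 isT; rewrite /= addr0 => ->; ring.
have G4 : G i4 i0 = - ((lam i4 - lam i0 + h * b) * sg i4).
  by have := Hs i4 isT; rewrite /= => ->; ring.
rewrite /X /dX /diag_coeff /off_coeff /system_coeff /coupling /residual /Gd !sum_ord5.
elim/ord5_ind: j => /=; rewrite ?G1 ?G2 ?G3 ?G4 ?s0 ?ds0 ?(G1, G2, G3, G4); field; exact: hn.
Qed.

End Reduction.

Lemma continuousC_if (R : realType) (c : bool) (f : R -> R[i]) (x : R) :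
  continuousC f x -> continuousC (fun y => if c then f y else 0) x.
Proof. by case: c => // _; exact: continuousC_cst. Qed.

Lemma modc_ge_Re (R : realType) (z : R[i]) : complex.Re z <= modc z.
Proof. exact: le_trans (ler_norm _) (Re_le_modc z). Qed.

(* The unbounded entry [o / h] sits in column 2 and the non-decaying part of
   [cp] in row 4: a small weight on column 2 and a large one on row 4 absorb them
   into the real parts of the diagonal. *)
Lemma reduced_solution (R : realType) (beta C eps a : R) :
  0 < beta -> 0 <= C -> 0 < eps -> 0 <= a ->
  exists2 K : R, 0 <= K & forall (h : R) (dl rs : 'I_5 -> R -> R[i])
    (cp : 'I_5 -> 'I_5 -> R -> R[i]) (o : R -> R[i]) (b : R -> R), 0 < h <= 1 ->
  (forall j x, continuousC (fun y => dl j (Num.max a y)) x) ->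
  (forall j x, continuousC (fun y => rs j (Num.max a y)) x) ->
  (forall j k x, continuousC (fun y => cp j k (Num.max a y)) x) ->
  (forall x, continuousC (fun y => o (Num.max a y)) x) ->
  (forall x, continuousC (fun y => (b (Num.max a y))%:C) x) ->
  (forall x, a <= x ->
    [/\ forall j, 0 <= complex.Re (dl j x), 0 <= b x,
        eps * modc (o x) <= complex.Re (dl i1 x),
        forall j, modc (rs j x) <= C * expR (- beta * x) &
        forall j k, modc (cp j k x) <= C * expR (- beta * x) +
          (if (j == i4) && (k != i4) then C else 0)]) ->
  exists Z : 'I_5 -> R -> R[i],
    [/\ forall j x, continuousC (Z j) x,
        forall j x, a <= x -> modc (Z j x) <= K * h &
        forall j x, a < x -> is_deriveC (Z j) x
          ((h%:C^-1 * dl j x + beta%:C + (if j == i4 then (b x)%:C else 0)) * Z j x +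
           \sum_k (if k == i0 then h%:C * rs j x else
              h%:C^-1 * (if (j == i1) && (k == i2) then o x else 0) + cp j k x) * Z k x +
           h%:C * rs j x * (expR (beta * x))%:C)].
Proof.
move=> b0 C0 e0 a0.
(* The weight e <= eps / 8 on column 2 reduces the Jordan entry of row 1 to an eighth of the gap. D
   makes the constant couplings of row 4, of weighted size C (2 + e), at most an eighth of D beta. L
   serves the decaying couplings, of weighted size C (3 + e + D), against row weights at least e. F0
   is chosen with F0 e beta = C, the bound of the source. *)
pose e := Num.min 1 (eps / 8); pose D := 1 + 8 * C * (2 + e) / beta.
have ep : 0 < e by rewrite lt_min ltr01 divr_gt0.
have e1 : e <= 1 by rewrite ge_min lexx.
have e8 : e <= eps / 8 by rewrite ge_min lexx orbT.
have D1 : 1 <= D by rewrite /D lerDl divr_ge0 ?(ltW b0) // !mulr_ge0 //; lra.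
have DE : 8 * C * (2 + e) = (D - 1) * beta by rewrite /D; field; lra.
pose L := 8 * C * (3 + e + D) / e.
have LE : 8 * C * (3 + e + D) = L * e by rewrite /L; field; lra.
have L0 : 0 <= L by rewrite /L divr_ge0 ?(ltW ep) // !mulr_ge0 //; lra.
pose d (j : 'I_5) : R := if j == i2 then e else if j == i4 then D else 1.
have de j : e <= d j by elim/ord5_ind: j => /=; rewrite /d /=; lra.
have dp j : 0 < d j by exact: lt_le_trans ep (de j).
have dD j : d j <= D by elim/ord5_ind: j => /=; rewrite /d /=; lra.
pose F0 := C / (e * beta).
have F0E : F0 * (e * beta) = C by rewrite /F0 divfK // mulf_neq0 // gt_eqF.
have F00 : 0 <= F0 by rewrite /F0 divr_ge0 // mulr_ge0 ?ltW.
exists (6 * F0 * D * expR (L / beta)).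
  apply: mulr_ge0 (expR_ge0 _); apply: mulr_ge0; last lra.
  by apply: mulr_ge0.
move=> h dl rs cp o b /andP[hp h1] cdl crs ccp co cb H.
have hC : h%:C != 0 :> R[i] by apply: contraTneq hp => /(congr1 (@complex.Re R)) /= ->; rewrite ltxx.
have hV : h%:C^-1 = (h^-1)%:C :> R[i] by rewrite fmorphV.
pose mx (y : R) := Num.max a y.
pose P j x := h%:C^-1 * dl j (mx x) + beta%:C + (if j == i4 then (b (mx x))%:C else 0).
pose N j k x := if k == i0 then h%:C * rs j (mx x) else
  h%:C^-1 * (if (j == i1) && (k == i2) then o (mx x) else 0) + cp j k (mx x).
pose F j x := h%:C * rs j (mx x) * (expR (beta * mx x))%:C.
have PRe j x : complex.Re (P j x) =
    h^-1 * complex.Re (dl j (mx x)) + beta + (if j == i4 then b (mx x) else 0).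
  rewrite /P hV !ReCD ReCM /=; case: (j == i4) => /=; ring.
have am x : a <= mx x by rewrite /mx le_max lexx.
have hi : 0 < h^-1 by rewrite invr_gt0.
have xi x : expR (- beta * mx x) <= expR (- beta * x).
  by rewrite ler_expR !mulNr lerN2 ler_wpM2l ?(ltW b0) // /mx le_max lexx orbT.
have hh (z : R[i]) : modc (h%:C * z) <= modc z.
  by rewrite modcM modcR ger0_norm ?(ltW hp) // ler_piMl ?modc_ge0.
have Pb j x : beta <= complex.Re (P j x).
  rewrite PRe; have [r bb _ _ _] := H _ (am x).
  have : 0 <= h^-1 * complex.Re (dl j (mx x)) by rewrite mulr_ge0 ?r // ltW.
  by case: (j == i4); lra.
have bb x : 0 <= b (mx x) by have [] := H _ (am x).
have [Z HZ] : exists Z : 'I_5 -> R -> R[i], forall j x,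
    is_deriveC (Z j) x (P j x * Z j x + \sum_k N j k x * Z k x + F j x) /\
    modc (Z j x) <= 6 * (F0 * h) * d j * decay_weight beta L x.
  apply: (decaying_perturbation_solution b0 L0 _ dp).
  - by rewrite mulr_ge0 // ltW.
  - move=> j x; apply: continuousCD; first apply: continuousCD.
    + by apply: continuousCM; [exact: continuousC_cst|exact: cdl].
    + exact: continuousC_cst.
    + by apply: continuousC_if; exact: cb.
  - move=> j x; apply: continuousCM; first by apply: continuousCM; [exact: continuousC_cst|exact: crs].
    apply: continuousC_real; apply: (continuous_comp (f := fun y : R => beta * mx y) (g := @expR R)).
      apply: continuousM; first exact: cst_continuous.
      by apply: continuous_max; [exact: cst_continuous|exact: cvg_id].
    exact: continuous_expR.
  - move=> j k x; rewrite /N; case: (k == i0).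
      by apply: continuousCM; [exact: continuousC_cst|exact: crs].
    apply: continuousCD; last exact: ccp.
    by apply: continuousCM; [exact: continuousC_cst|apply: continuousC_if; exact: co].
  - by move=> j x; apply: le_trans (ltW b0) (Pb j x).
  - move=> j x; have [r _ eo rb cb'] := H _ (am x).
    have X := xi x; have X0 := expR_ge0 (- beta * mx x).
    have N0 : modc (N j i0 x) <= C * expR (- beta * x).
      rewrite /N /=; apply: le_trans (hh _) _; apply: le_trans (rb j) _.
      exact: ler_wpM2l.
    have NC k : k != i0 -> ~~ ((j == i1) && (k == i2)) -> modc (N j k x) <=
        C * expR (- beta * x) + (if (j == i4) && (k != i4) then C else 0).
      move=> k0 jk; rewrite /N (negbTE k0) (negbTE jk) mulr0 add0r.
      by apply: le_trans (cb' j k) _; rewrite lerD2r ler_wpM2l.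
    have N12 : j = i1 -> modc (N j i2 x) * e <= C * expR (- beta * x) * e +
        8^-1 * (h^-1 * complex.Re (dl i1 (mx x))).
      move=> ->; rewrite /N /=; have Q : modc (h%:C^-1 * o (mx x) + cp i1 i2 (mx x)) <=
        h^-1 * modc (o (mx x)) + C * expR (- beta * x).
        apply: le_trans (modcD _ _) _; apply: lerD.
          by rewrite modcM hV modcR gtr0_norm.
        apply: le_trans (cb' i1 i2) _; rewrite /= addr0; exact: ler_wpM2l.
      apply: le_trans (ler_wpM2r (ltW ep) Q) _.
      rewrite mulrDl addrC lerD2l -mulrA [X in _ <= X]mulrCA ler_wpM2l ?(ltW hi) //.
      have := modc_ge0 (o (mx x)); move: (modc (o (mx x))) eo => O eo O0.
      nra.
    have PR := PRe j x; have PB := Pb j x; have bx := bb x; have Y0 := expR_ge0 (- beta * x).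
    have rj := r j; have hr : 0 <= h^-1 * complex.Re (dl j (mx x)) by rewrite mulr_ge0 // ltW.
    rewrite sum_ord5 /d /=; move: N0 NC N12 PR PB bx Y0 hr; clear -C0 ep e1 D1 DE LE L0 b0.
    move: (expR (- beta * x)) (complex.Re (P j x)) => Y p.
    move=> N0 NC N12 PR PB bx Y0 hr.
    have CY : 0 <= C * Y by rewrite mulr_ge0.
    have LY : 8 * (C * Y) * (3 + e + D) = L * e * Y by rewrite -LE; ring.
    have LY0 : 0 <= L * Y by rewrite mulr_ge0.
    have m k := modc_ge0 (N j k x).
    elim/ord5_ind: j N0 NC N12 PR hr m => N0 NC N12 PR hr m /=.
    + have n1 := NC i1 isT isT; have n2 := NC i2 isT isT.
      have n3 := NC i3 isT isT; have n4 := NC i4 isT isT.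
      move: n1 n2 n3 n4; rewrite /= !addr0 => n1 n2 n3 n4.
      have m2 := ler_wpM2r (ltW ep) n2; have D0 : 0 <= D by lra.
      have m4 := ler_wpM2r D0 n4.
      have : L * e * Y <= L * Y by rewrite mulrAC ler_piMr.
      lra.
    + have n1 := NC i1 isT isT; have n2 := N12 erefl.
      have n3 := NC i3 isT isT; have n4 := NC i4 isT isT.
      move: n1 n2 n3 n4 PR; rewrite /= !addr0 => n1 n2 n3 n4 PR.
      have D0 : 0 <= D by lra.
      have m4 := ler_wpM2r D0 n4.
      have : L * e * Y <= L * Y by rewrite mulrAC ler_piMr.
      rewrite PR; lra.
    + have n1 := NC i1 isT isT; have n2 := NC i2 isT isT.
      have n3 := NC i3 isT isT; have n4 := NC i4 isT isT.
      move: n1 n2 n3 n4; rewrite /= !addr0 => n1 n2 n3 n4.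
      have m2 := ler_wpM2r (ltW ep) n2; have D0 : 0 <= D by lra.
      have m4 := ler_wpM2r D0 n4.
      have : 0 <= e * p by rewrite mulr_ge0 ?ltW //; lra.
      lra.
    + have n1 := NC i1 isT isT; have n2 := NC i2 isT isT.
      have n3 := NC i3 isT isT; have n4 := NC i4 isT isT.
      move: n1 n2 n3 n4; rewrite /= !addr0 => n1 n2 n3 n4.
      have m2 := ler_wpM2r (ltW ep) n2; have D0 : 0 <= D by lra.
      have m4 := ler_wpM2r D0 n4.
      have : L * e * Y <= L * Y by rewrite mulrAC ler_piMr.
      lra.
    + have n1 := NC i1 isT isT; have n2 := NC i2 isT isT.
      have n3 := NC i3 isT isT; have n4 := NC i4 isT isT.
      move: n1 n2 n3 n4; rewrite /= ?addr0 => n1 n2 n3 n4.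
      have m2 := ler_wpM2r (ltW ep) n2; have D0 : 0 <= D by lra.
      have m4 := ler_wpM2r D0 n4.
      have E1 : L * e * Y <= L * Y by rewrite mulrAC ler_piMr.
      have E2 : L * Y <= D * (L * Y) by rewrite ler_peMl.
      have E3 : D * beta <= D * p by rewrite ler_wpM2l.
      have : 8 * C * (2 + e) <= D * beta by rewrite DE; lra.
      lra.
  - move=> j x; have [r _ eo rb cb'] := H _ (am x).
    have /gt_eqF ex := expR_gt0 (beta * mx x).
    have S : modc (F j x) <= h * C.
      rewrite /F !modcM !modcR (gtr0_norm hp) (gtr0_norm (expR_gt0 _)).
      rewrite -mulrA ler_wpM2l ?(ltW hp) //.
      apply: le_trans (ler_wpM2r (expR_ge0 _) (rb j)) _.
      by rewrite -mulrA -expRD mulNr addNr expR0 mulr1.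
    apply: le_trans S _.
    rewrite (_ : h * C = F0 * h * (e * beta)); last by rewrite -[in LHS]F0E; ring.
    rewrite -[X in _ <= X]mulrA; apply: ler_wpM2l; first by rewrite mulr_ge0 // ltW.
    apply: ler_pM; [exact: ltW|exact: ltW|exact: de|].
    apply: le_trans (Pb j x) _; rewrite lerDl mulr_ge0 // expR_ge0.
exists Z; split.
- by move=> j x; exact: is_deriveC_continuous (HZ j x).1.
- move=> j x ax; apply: le_trans (HZ j x).2 _.
  have w1 : decay_weight beta L x <= expR (L / beta).
    rewrite /decay_weight ler_expR ler_piMr //; first by rewrite divr_ge0 // ltW.
    exact: (@expR_decay_le1 _ _ a).
  have -> : 6 * F0 * D * expR (L / beta) * h = 6 * (F0 * h) * D * expR (L / beta) by ring.
  have F6 : 0 <= 6 * (F0 * h) by apply: mulr_ge0 => //; apply: mulr_ge0 => //; exact: ltW.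
  apply: ler_pM => //; first by apply: mulr_ge0 => //; exact: ltW.
    by rewrite ltW // decay_weight_gt0.
  by rewrite ler_wpM2l.
- move=> j x ax; have := (HZ j x).1; rewrite /P /N /F.
  by have -> : mx x = x by apply/max_idPr; exact: ltW.
Qed.

Section FirstOrderCorrection.
Variables (R : realType) (beta h0 a Cz eps : R).
Variables (lm : 'I_5 -> R -> R -> R[i]) (o : R -> R -> R[i]).
Variables (G : 'I_5 -> 'I_5 -> R -> R -> R[i]) (b : R -> R).
Hypotheses (beta0 : 0 < beta) (a0 : 0 <= a) (h01 : h0 <= 1) (Cz0 : 0 < Cz) (eps0 : 0 < eps).
Hypotheses (tlm : forall j, tame beta h0 a 1 (lm j)) (to : tame beta h0 a 1 o).
Hypotheses (tG : forall j k, tame beta h0 a 1 (G j k)) (tb : rtame beta h0 a 1 b).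
Hypothesis b_ge0 : forall x, a <= x -> 0 <= b x.
Hypothesis dG : forall j k, j != i4 -> decaying beta h0 a (G j k).
Hypothesis dG4 : decaying beta h0 a (fun h x => G i4 i4 h x - (b x)%:C).
Hypothesis separation : forall j h x, j != i0 -> 0 < h < h0 -> a <= x ->
  Cz <= modc (lm j h x - lm i0 h x) /\ 0 <= complex.Re (lm j h x - lm i0 h x).
Hypothesis off_bound : forall h x, 0 < h < h0 -> a <= x ->
  eps * modc (o h x) <= complex.Re (lm i1 h x - lm i0 h x).

Notation tame := (tame beta h0 a).
Notation decaying := (decaying beta h0 a).
Notation bounded := (bounded_fam h0 a).

Lemma decaying_uniform (I : finType) (F : I -> R -> R -> R[i]) : (forall i, decaying (F i)) ->
  exists2 C : R, 0 <= C & forall i h x, 0 < h < h0 -> a <= x ->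
    modc (F i h x) <= C * expR (- beta * x).
Proof.
move=> H; have /choice[C HC] : forall i, exists C : R, 0 <= C /\ forall h x,
    0 < h < h0 -> a <= x -> modc (F i h x) <= C * expR (- beta * x).
  by move=> i; have [C C0 HC] := H i; exists C.
exists (\sum_i C i); first by apply: sumr_ge0 => i _; exact: (HC i).1.
move=> i h x hh ax; apply: le_trans ((HC i).2 h x hh ax) _.
rewrite ler_wpM2r ?expR_ge0 // (bigD1 i) //= lerDl.
by apply: sumr_ge0 => j _; exact: (HC j).1.
Qed.

Lemma bounded_uniform (I : finType) (F : I -> R -> R -> R[i]) : (forall i, bounded (F i)) ->
  exists2 C : R, 0 <= C & forall i h x, 0 < h < h0 -> a <= x -> modc (F i h x) <= C.
Proof.
move=> H; have /choice[C HC] : forall i, exists C : R, 0 <= C /\ forall h x,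
    0 < h < h0 -> a <= x -> modc (F i h x) <= C.
  by move=> i; have [C C0 HC] := H i; exists C.
exists (\sum_i C i); first by apply: sumr_ge0 => i _; exact: (HC i).1.
move=> i h x hh ax; apply: le_trans ((HC i).2 h x hh ax) _.
rewrite (bigD1 i) //= lerDl.
by apply: sumr_ge0 => j _; exact: (HC j).1.
Qed.

Lemma tame_if n (c : bool) f : tame n f -> tame n (fun h x => if c then f h x else 0).
Proof.
by case: c => // _; apply: (@tame_cst _ _ _ _ _ (fun=> 0) 0) => h _; rewrite modc0.
Qed.

Lemma decaying_if (c : bool) f : decaying f -> decaying (fun h x => if c then f h x else 0).
Proof. by case: c => // _; exact: decaying0. Qed.

Lemma tame_h n : tame n (fun h _ => h%:C).
Proof.
apply: (@tame_cst _ _ _ _ _ (fun h => h%:C) h0) => h /andP[hp hh].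
by rewrite modcR gtr0_norm // ltW.
Qed.

Lemma modcD_ge (z : R[i]) (t : R) : 0 <= complex.Re z -> 0 <= t -> modc z <= modc (z + t%:C).
Proof.
move=> z0 t0; rewrite -ler_sqr ?nnegrE ?modc_ge0 // !modc_sqr ReCD ImCD /=; nra.
Qed.

(** In row 4 the divisor contains h b. Otherwise b sg_4, which need not decay, would remain in the
    residual. As b >= 0 and Re (lm i4 - lm i0) >= 0, the divisor stays as large as the gap. *)
Let den j h x := lm j h x - lm i0 h x + (if j == i4 then h%:C * (b x)%:C else 0).

Let tame_den j : tame 1 (den j).
Proof.
apply: tameD; first by apply: tameD => //; exact: tameN.
by apply: tame_if; apply: tameM => //; exact: tame_h.
Qed.

Let den_away j : j != i0 -> away_from0 h0 a (den j).
Proof.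
move=> j0; exists Cz => // h x hh ax; have [s r] := separation j0 hh ax.
rewrite /den; case: ifP => _; last by rewrite addr0.
rewrite -rmorphM; apply: le_trans s _; apply: modcD_ge => //.
by rewrite mulr_ge0 ?b_ge0 // ltW //; case/andP: hh.
Qed.

Let src o2 j h x := - (G j i0 h x + (if j == i1 then o2 h x else 0)).
(** The system for the corrector is triangular: row 1 contains o sg_2, so component 2 comes
    first. *)
Let sg2 h x := src (fun _ _ => 0) i2 h x * (den i2 h x)^-1.
Let sg j h x := if j == i0 then 0 else src (fun h x => o h x * sg2 h x) j h x * (den j h x)^-1.

Let sg_props : forall j, tame 1 (sg j) /\ (j != i4 -> decaying (sg j)).
Proof.
have tV j : j != i0 -> tame 1 (fun h x => (den j h x)^-1).
  by move=> j0; apply: tameV => //; exact: den_away.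
have ts o2 j : tame 1 o2 -> tame 1 (src o2 j).
  by move=> t2; apply: tameN; apply: tameD => //; exact: tame_if.
have ds o2 j : j != i4 -> decaying o2 -> decaying (src o2 j).
  by move=> j4 d2; apply: decayingN; apply: decayingD; [exact: dG|exact: decaying_if].
have t0 : tame 1 (fun _ _ => 0).
  by apply: (@tame_cst _ _ _ _ _ (fun=> 0) 0) => h _; rewrite modc0.
have t2 : tame 1 sg2 by apply: tameM; [exact: ts|exact: tV].
have d2 : decaying sg2.
  by apply: decayingMl; [apply: ds => //; exact: decaying0|exact: tame_bounded (tV i2 isT)].
move=> j; rewrite /sg; have [j0|j0] := eqVneq j i0.
  by split => // _; exact: decaying0.
split; first by apply: tameM; [apply: ts; exact: tameM|exact: tV].
move=> j4; apply: decayingMl; last exact: tame_bounded (tV j j0).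
by apply: ds => //; apply: decayingMr => //; exact: tame_bounded to.
Qed.

(** The corrector may fail to decay in row 4, so it is kept as an explicit term of order h. What
    decays is the distance of the exact solution from e_0 + h [sg], namely exp (- beta x) (Z + h Z_0
    [sg]). *)
Lemma first_order_correction : exists (sg : 'I_5 -> R -> R -> R[i]) (K : R),
  [/\ forall j, bounded (sg j), 0 <= K & forall h, 0 < h < h0 ->
    exists Y : 'I_5 -> R -> R[i],
    [/\ forall j x, continuousC (Y j) x,
        forall j x, a < x -> is_deriveC (Y j) x (\sum_k system_coeff (fun j => lm j h x)
           (fun j k => G j k h x) (o h x) h%:C j k * Y k x) &
        forall j x, a <= x -> modc (Y j x - ((if j == i0 then 1 else 0) + h%:C * sg j h x))
           <= K * h * expR (- beta * x)]].
Proof.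
have /choice[dsg Hdsg] : forall j, exists f : R -> R -> R[i],
    [/\ forall h x, 0 < h < h0 -> a < x -> is_deriveC (sg j h) x (f h x), decaying f,
        tame 0 f & j = i0 -> f = fun _ _ => 0].
  move=> j; have [j0|j0] := eqVneq j i0.
    exists (fun _ _ => 0); split => //.
    - by move=> h x _ _; rewrite /sg j0 /=; exact: is_deriveC_cst.
    - exact: decaying0.
    - by apply: (@tame_cst _ _ _ _ _ (fun=> 0) 0) => h _; rewrite modc0.
  have [_ _ [f [f1 f2 f3]]] := (sg_props j).1.
  by exists f; split => // j0'; rewrite j0' eqxx in j0.
have tsg j := (sg_props j).1; have dcs j := (sg_props j).2.
have bsg j := tame_bounded (tsg j).
have tb' : tame 1 (fun _ x => (b x)%:C) := tb.
pose Gdf j k h x := G j k h x - (if j == k then G i0 i0 h x else 0).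
have tGd j k : tame 1 (Gdf j k).
  by apply: tameD => //; apply: tameN; exact: tame_if.
have dGd j k : j != i4 -> decaying (Gdf j k).
  move=> j4; apply: decayingD; first exact: dG.
  by apply: decayingN; apply: decaying_if; exact: dG.
have dGd4 : decaying (fun h x => Gdf i4 i4 h x - (b x)%:C).
  apply: decaying_ext (decayingD dG4 (decayingN (dG i0 (isT : i0 != i4)))) => h x _ _.
  by rewrite /Gdf /=; ring.
pose G0 h x := h%:C * \sum_k G i0 k h x * sg k h x.
have tG0 : tame 1 G0.
  by apply: tameM; [exact: tame_h|apply: tame_sum => k; exact: tameM].
have dG0 : decaying G0.
  apply: decayingMr; first exact: tame_bounded (tame_h 0).
  apply: decaying_sum => k; apply: decayingMl (bsg k); exact: dG.
pose rs j h x := residual (sg ^~ h ^~ x) (dsg ^~ h ^~ x) (fun j k => G j k h x) (b x)%:C h%:C j.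
pose cp j k h x := coupling (sg ^~ h ^~ x) (fun j k => G j k h x) (b x)%:C h%:C j k.
have trs j : tame 0 (rs j).
  have [_ _ t _] := Hdsg j.
  apply: tameD (tameN t); apply: tameD; last first.
    by apply: tameN; apply: tameM; [exact: tameS (tsg j)|exact: tameS tG0].
  apply: tameD.
    by apply: tame_sum => k; apply: tameM; [exact: tameS (tGd j k)|exact: tameS (tsg k)].
  by apply: tameN; apply: tame_if; apply: tameM; [exact: tameS tb'|exact: tameS (tsg i4)].
have tcp j k : tame 1 (cp j k).
  apply: tameD.
    have := tameD (tGd j k) (tameN (tame_if ((j == i4) && (k == i4)) tb')); exact.
  by apply: tameN; apply: tameM => //; apply: tameM => //; exact: tame_h.
have drs j : decaying (rs j).
  have [_ d _ _] := Hdsg j.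
  apply: decayingD (decayingN d); apply: decayingD; last first.
    by apply: decayingN; apply: decayingMr.
  have [j4|j4] := eqVneq j i4; last first.
    apply: decayingD; last by apply: decayingN; exact: decaying0.
    by apply: decaying_sum => k; apply: decayingMl; [exact: dGd|exact: bsg].
  rewrite j4.
  (* Neither the entry (4, 4) nor [sg i4] need decay. The term - b sg_4 of the residual combines
     with that entry into a decaying coefficient; the other products decay through [sg]. *)
  have D : decaying (fun h x => Gdf i4 i0 h x * sg i0 h x + (Gdf i4 i1 h x * sg i1 h x +
     (Gdf i4 i2 h x * sg i2 h x + (Gdf i4 i3 h x * sg i3 h x +
     (Gdf i4 i4 h x - (b x)%:C) * sg i4 h x)))).
    have q k : k != i4 -> decaying (fun h x => Gdf i4 k h x * sg k h x).
      by move=> k4; apply: decayingMr; [exact: tame_bounded (tGd _ _)|exact: dcs].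
    do 4 (apply: decayingD; first exact: q).
    exact: decayingMl.
  apply: decaying_ext D => h x _ _; rewrite sum_ord5 /Gd /Gdf /=; ring.
have dcp j k : ~~ ((j == i4) && (k != i4)) -> decaying (cp j k).
  move=> jk; apply: decayingD; last first.
    apply: decayingN; apply: decayingMr; last exact: dG.
    by apply: bounded_famM => //; exact: tame_bounded (tame_h 0).
  have [j4|j4] := eqVneq j i4; last first.
    by apply: decayingD; [exact: dGd|apply: decayingN; exact: decaying0].
  have k4 : k = i4 by apply/eqP; move: jk; rewrite j4 eqxx /= negbK.
  by rewrite j4 k4.
have [Cr Cr0 HCr] := decaying_uniform drs.
(* The entries of row 4 off the diagonal are bounded but need not decay; they are masked in order to
   extract one decay constant for all the others. *)
pose cp' (jk : 'I_5 * 'I_5) h x :=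
  if (jk.1 == i4) && (jk.2 != i4) then 0 else cp jk.1 jk.2 h x.
have dcp' jk : decaying (cp' jk).
  rewrite /cp'; have [_|E] := boolP ((jk.1 == i4) && (jk.2 != i4)); last exact: dcp.
  exact: decaying0.
have [Cc Cc0 HCc] := decaying_uniform dcp'.
have [Cb Cb0 HCb] := bounded_uniform (F := fun jk : 'I_5 * 'I_5 => cp jk.1 jk.2)
  (fun jk => tame_bounded (tcp jk.1 jk.2)).
have [Cs Cs0 HCs] := bounded_uniform bsg.
pose C := Cr + Cc + Cb.
have C0 : 0 <= C by rewrite /C; lra.
have [K K0 HK] := reduced_solution beta0 C0 eps0 a0.
exists sg, (K + K * Cs); split => //; first by rewrite addr_ge0 // mulr_ge0.
move=> h hh; have /andP[hp hh0] := hh; have h1 : 0 < h <= 1 by rewrite hp /= ltW // (lt_le_trans hh0).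
have [Z [cZ bZ dZ]] : exists Z : 'I_5 -> R -> R[i],
    [/\ forall j x, continuousC (Z j) x,
        forall j x, a <= x -> modc (Z j x) <= K * h &
        forall j x, a < x -> is_deriveC (Z j) x
          ((h%:C^-1 * (lm j h x - lm i0 h x) + beta%:C + (if j == i4 then (b x)%:C else 0)) * Z j x +
           \sum_k (if k == i0 then h%:C * rs j h x else
              h%:C^-1 * (if (j == i1) && (k == i2) then o h x else 0) + cp j k h x) * Z k x +
           h%:C * rs j h x * (expR (beta * x))%:C)].
  apply: (HK h (fun j x => lm j h x - lm i0 h x) (fun j => rs j h) (fun j k => cp j k h) (o h) b) => //.
  - by move=> j x; apply: continuousCD; [|apply: continuousCN]; exact: (tame_continuous (tlm _) hh).
  - by move=> j x; exact: (tame_continuous (trs _) hh).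
  - by move=> j k x; exact: (tame_continuous (tcp _ _) hh).
  - by move=> x; exact: (tame_continuous to hh).
  - by move=> x; exact: (tame_continuous tb hh).
  - move=> x ax; have X0 := expR_ge0 (- beta * x).
    split; [|exact: b_ge0|exact: off_bound| |].
    + move=> j; have [->|j0] := eqVneq j i0; first by rewrite subrr.
      by have [] := separation j0 hh ax.
    + move=> j; apply: le_trans (HCr j h x hh ax) _; apply: ler_wpM2r => //; rewrite /C; lra.
    + move=> j k; have := HCc (j, k) h x hh ax; have := HCb (j, k) h x hh ax; rewrite /cp' /=.
      case: ifP => _ cb cc.
        apply: le_trans cb _; have : 0 <= C * expR (- beta * x) by rewrite mulr_ge0.
        by rewrite /C; move: (_ * expR _) => t; lra.
      rewrite addr0; apply: le_trans cc _; apply: ler_wpM2r => //; rewrite /C; lra.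
pose E x := (expR (- beta * x))%:C : R[i].
have hC : h%:C != 0 :> R[i].
  by apply: contraTneq hp => /(congr1 (@complex.Re R)) /= ->; rewrite ltxx.
have dE x : is_deriveC E x (- (beta%:C * E x)).
  have D : is_derive x 1 (fun y : R => expR (- beta * y)) (- beta * expR (- beta * x)).
    exact: is_derive_expRM.
  have := is_deriveC_real D; rewrite rmorphM rmorphN mulNr; exact.
pose X j x := (if j == i0 then 1 else 0) + E x * Z j x.
pose Y j x := X j x + h%:C * X i0 x * sg j h (Num.max a x).
have cX j x : continuousC (X j) x.
  apply: continuousCD; first exact: continuousC_cst.
  by apply: continuousCM; [exact: is_deriveC_continuous (dE x)|exact: cZ].
exists Y; split.
- move=> j x; apply: continuousCD; first exact: cX.
  apply: continuousCM; last exact: (tame_continuous (tsg j) hh).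
  by apply: continuousCM; [exact: continuousC_cst|exact: cX].
- move=> j x ax; have mE : Num.max a x = x by apply/max_idPr; exact: ltW.
  pose dX j := - (beta%:C * E x) * Z j x + E x * (diag_coeff (fun j => lm j h x) (b x)%:C beta%:C h%:C j * Z j x +
     \sum_k off_coeff (sg ^~ h ^~ x) (dsg ^~ h ^~ x) (fun j k => G j k h x) (o h x) (b x)%:C h%:C j k * Z k x)
     + h%:C * rs j h x.
  have DX k : is_deriveC (X k) x (dX k).
    have := is_deriveCD (is_deriveC_cst (if k == i0 then 1 else 0) x) (is_deriveCM (dE x) (dZ k x ax)).
    congr is_deriveC; rewrite add0r mulrDr addrA.
    have EE : E x * (h%:C * rs k h x * (expR (beta * x))%:C) = h%:C * rs k h x.
      rewrite mulrCA -rmorphM mulrC -expRD mulNr addNr expR0 mul1r //.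
    by rewrite EE.
  have Dsg : is_deriveC (fun y => sg j h (Num.max a y)) x (dsg j h x).
    have [d _ _ _] := Hdsg j; apply: is_deriveC_near (d h x hh ax).
    by have := max_near ax; apply: filterS => y ->.
  have DY := is_deriveCD (DX j) (is_deriveCM (is_deriveCM (is_deriveC_cst h%:C x) (DX i0)) Dsg).
  have dsg0 : dsg i0 h x = 0 by have [_ _ _ ->] := Hdsg i0.
  have I := @reduction_identity _ (fun j => lm j h x) (sg ^~ h ^~ x) (dsg ^~ h ^~ x) (Z ^~ x)
    (fun j k => G j k h x) (o h x) (b x)%:C beta%:C h%:C (E x) hC erefl dsg0 _ j.
  have {}I := I _.
  move: DY; rewrite (_ : _ + _ = \sum_k system_coeff (fun j => lm j h x)
    (fun j k => G j k h x) (o h x) h%:C j k * Y k x) //.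
  rewrite (eq_bigr (fun k => system_coeff (fun j => lm j h x) (fun j k => G j k h x) (o h x) h%:C j k *
     (X k x + h%:C * X i0 x * sg k h x))); last by move=> k _; rewrite /Y mE.
  rewrite -I.
    by rewrite mE mul0r add0r -mulrA -[h%:C * X i0 x * _]mulrA -mulrDr.
  move=> k k0; have := away_neq0 (den_away k0) hh (ltW ax).
  rewrite -/(den k h x) /sg (negbTE k0) /src => dn.
  by rewrite mulrC divfK.
- move=> j x ax; have mE : Num.max a x = x by apply/max_idPr.
  have -> : Y j x - ((if j == i0 then 1 else 0) + h%:C * sg j h x) =
     E x * (Z j x + h%:C * Z i0 x * sg j h x).
    by rewrite /Y /X mE /=; ring.
  rewrite modcM modcR ger0_norm ?expR_ge0 // mulrC ler_wpM2r ?expR_ge0 //.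
  apply: le_trans (modcD _ _) _; rewrite mulrDl; apply: lerD; first exact: bZ.
  rewrite !modcM modcR gtr0_norm //.
  have := bZ i0 x ax; have := HCs j h x hh ax; have := modc_ge0 (sg j h x).
  have := modc_ge0 (Z i0 x); move: (modc _) (modc _) => z s z0 s0 sC zK.
  have hle : h <= 1 by case/andP: h1.
  rewrite [X in _ <= X]mulrAC; apply: ler_pM => //; first by rewrite mulr_ge0 // ltW.
  by apply: le_trans zK; rewrite ler_piMl.
Qed.

End FirstOrderCorrection.

(** * Systems diagonalized to leading order *)

Section MatrixDerivatives.
Variable R : realType.

Definition is_deriveM m n (F : R -> 'M[R[i]]_(m, n)) x (L : 'M[R[i]]_(m, n)) :=
  forall i j, is_deriveC (fun y => F y i j) x (L i j).

Lemma is_deriveM_mul m n p (F : R -> 'M[R[i]]_(m, n)) (G : R -> 'M[R[i]]_(n, p)) x A B :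
  is_deriveM F x A -> is_deriveM G x B ->
  is_deriveM (fun y => F y *m G y) x (A *m G x + F x *m B).
Proof.
move=> dF dG i j; rewrite !mxE -big_split /=.
have := @is_deriveC_sum R n (fun k y => F y i k * G y k j)
  (fun k => A i k * G x k j + F x i k * B k j) x (fun k => is_deriveCM (dF i k) (dG k j)).
by congr is_deriveC; apply/funext => y; rewrite mxE.
Qed.

Lemma is_deriveM_scale m n (f : R -> R[i]) (F : R -> 'M[R[i]]_(m, n)) x l A :
  is_deriveC f x l -> is_deriveM F x A ->
  is_deriveM (fun y => f y *: F y) x (l *: F x + f x *: A).
Proof.
move=> df dF i j; rewrite !mxE; have := is_deriveCM df (dF i j).
by congr is_deriveC; apply/funext => y; rewrite mxE.
Qed.

End MatrixDerivatives.

Section MatrixFamilies.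
Variables (R : realType) (beta h0 a : R).

Definition mtame n (F : R -> R -> 'M[R[i]]_5) :=
  forall i j, tame beta h0 a n (fun h x => F h x i j).

Hypotheses (beta0 : 0 < beta) (a0 : 0 <= a).

Lemma mtame_mul n F G : mtame n F -> mtame n G -> mtame n (fun h x => F h x *m G h x).
Proof.
move=> tF tG i j; apply: (@tame_ext _ _ _ _ _ (fun h x => \sum_k F h x i k * G h x k j)).
  by move=> h x _ _; rewrite mxE.
by apply: tame_sum => k; exact: tameM.
Qed.

Lemma mtame_sub n F G : mtame n F -> mtame n G -> mtame n (fun h x => F h x - G h x).
Proof.
move=> tF tG i j; apply: (@tame_ext _ _ _ _ _ (fun h x => F h x i j - G h x i j)).
  by move=> h x _ _; rewrite !mxE.
by apply: tameD => //; exact: tameN.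
Qed.

End MatrixFamilies.

Section DiagonalizedSystem.
Variables (R : realType) (beta h0 a Cz eps : R).
Variables (lm : 'I_5 -> R -> R -> R[i]) (o : R -> R -> R[i]) (b : R -> R).
Variables (Rm Qm Mm Phi : R -> R -> 'M[R[i]]_5).
Hypotheses (beta0 : 0 < beta) (a0 : 0 <= a) (h01 : h0 <= 1) (Cz0 : 0 < Cz) (eps0 : 0 < eps).
Hypotheses (tlm : forall j, tame beta h0 a 1 (lm j)) (to : tame beta h0 a 1 o).
Hypothesis tb : rtame beta h0 a 1 b.
Hypothesis b_ge0 : forall x, a <= x -> 0 <= b x.
Hypothesis separation : forall j h x, j != i0 -> 0 < h < h0 -> a <= x ->
  Cz <= modc (lm j h x - lm i0 h x) /\ 0 <= complex.Re (lm j h x - lm i0 h x).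
Hypothesis off_bound : forall h x, 0 < h < h0 -> a <= x ->
  eps * modc (o h x) <= complex.Re (lm i1 h x - lm i0 h x).
Hypotheses (tR : mtame beta h0 a 2 Rm) (tQ : mtame beta h0 a 1 Qm) (tM : mtame beta h0 a 1 Mm).
Hypothesis RQ : forall h x, 0 < h < h0 -> a <= x -> Rm h x *m Qm h x = 1%:M.
Hypothesis PhiR : forall h x, 0 < h < h0 -> a <= x -> Phi h x *m Rm h x =
  Rm h x *m (\matrix_(j, k) ((if j == k then lm j h x else 0) +
                             (if (j == i1) && (k == i2) then o h x else 0))).
Hypothesis dM : forall j k, j != i4 -> decaying beta h0 a (fun h x => Mm h x j k).
Hypothesis M44 : forall h x, 0 < h < h0 -> a <= x -> Mm h x i4 i4 = (b x)%:C.
Hypothesis Q4 : forall h x, 0 < h < h0 -> a <= x -> forall j, Qm h x j i4 = (j == i4)%:R.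
Hypothesis R4 : forall h x, 0 < h < h0 -> a <= x -> forall j, Rm h x j i4 = (j == i4)%:R.

Notation tame := (tame beta h0 a).
Notation decaying := (decaying beta h0 a).

(** [E] is any solution of the scalar equation, since in the theorem it is the exponential
    integrated from 0 rather than from a. In the derivative of E R Y the term R G = M R - R' cancels
    R' and leaves the zeroth-order part M. *)
Lemma diagonalized_solution : exists (gam : R -> R -> R[i]) (sg : R -> R -> 'cV[R[i]]_5) (B K : R),
  [/\ decaying gam, continuous_fam h0 a gam,
      forall h x i, 0 < h < h0 -> a <= x -> modc (sg h x i 0) <= B, 0 <= K &
      forall h, 0 < h < h0 -> exists Y : R -> 'cV[R[i]]_5,
      [/\ forall i x, continuousC (fun y => Y y i 0) x,
          forall (E : R -> R[i]) x, a < x ->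
            is_deriveC E x ((h%:C^-1 * lm i0 h x + gam h x) * E x) ->
            is_deriveM (fun y => E y *: (Rm h y *m Y y)) x
              (h%:C^-1 *: ((Phi h x + h%:C *: Mm h x) *m (E x *: (Rm h x *m Y x)))) &
          forall x i, a <= x -> modc (Y x i 0 - (e1 i 0 + h%:C * sg h x i 0))
            <= K * h * expR (- beta * x)]].
Proof.
have /choice[R1 HR1] : forall ij : 'I_5 * 'I_5, exists f : R -> R -> R[i],
    [/\ forall h x, 0 < h < h0 -> a < x -> is_deriveC (fun y => Rm h y ij.1 ij.2) x (f h x),
        decaying f & tame 1 f].
  by move=> [i j]; have [_ _ [f Hf]] := tR i j; exists f.
pose Rm' h x : 'M[R[i]]_5 := \matrix_(i, j) R1 (i, j) h x.
have tR' : mtame beta h0 a 1 Rm'.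
  move=> i j; have [_ _ t] := HR1 (i, j).
  by apply: tame_ext t => h x _ _; rewrite mxE.
have dR' i j : decaying (fun h x => Rm' h x i j).
  have [_ d _] := HR1 (i, j).
  by apply: decaying_ext d => h x _ _; rewrite mxE.
pose Gm h x := Qm h x *m (Mm h x *m Rm h x - Rm' h x).
have tR1 : mtame beta h0 a 1 Rm by move=> i j; exact: tameS.
have tG : mtame beta h0 a 1 Gm.
  by apply: mtame_mul => //; apply: mtame_sub => //; exact: mtame_mul.
have bR i j := tame_bounded (tR i j); have bQ i j := tame_bounded (tQ i j).
have dN j k : j != i4 -> decaying (fun h x => (Mm h x *m Rm h x - Rm' h x) j k).
  move=> j4; apply: (@decaying_ext _ _ _ _ (fun h x => \sum_l Mm h x j l * Rm h x l k - Rm' h x j k)).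
    by move=> h x _ _; rewrite !mxE.
  apply: decayingD; last exact: decayingN.
  by apply: decaying_sum => l; apply: decayingMl (bR l k); exact: dM.
(* The last column of Q is that of the identity, so the last row of M, the only one without decay,
   reaches no other row of G. *)
have dG j k : j != i4 -> decaying (fun h x => Gm h x j k).
  move=> j4; apply: (@decaying_ext _ _ _ _ (fun h x =>
      \sum_l if l == i4 then 0 else Qm h x j l * (Mm h x *m Rm h x - Rm' h x) l k)).
    move=> h x hh ax; rewrite [RHS]mxE; apply: eq_bigr => l _.
    by have [->|//] := eqVneq l i4; rewrite Q4 // (negbTE j4) mul0r.
  apply: decaying_sum => l; have [_|l4] := eqVneq l i4; first exact: decaying0.
  by apply: decayingMr; [exact: bQ|exact: dN].
(* With trivial last columns of Q and R, b enters the entry (4, 4) with coefficient 1, and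
   everything else there decays. *)
have dG4 : decaying (fun h x => Gm h x i4 i4 - (b x)%:C).
  apply: (@decaying_ext _ _ _ _ (fun h x => (\sum_l if l == i4 then 0 else
      Qm h x i4 l * (Mm h x *m Rm h x - Rm' h x) l i4) - Rm' h x i4 i4)).
    move=> h x hh ax; rewrite [Gm h x _ _]mxE (bigD1 i4) //= add0r.
    rewrite [in RHS](bigD1 i4) //= Q4 // eqxx mul1r [in RHS]mxE [(_ *m _) _ _]mxE.
    rewrite (_ : \sum_k _ = (b x)%:C); last first.
      rewrite (bigD1 i4) //= R4 // eqxx mulr1 M44 // big1 ?addr0 // => l l4.
      by rewrite R4 // (negbTE l4) mulr0.
    rewrite [(- Rm' h x) _ _]mxE.
    rewrite (eq_bigr (fun l => Qm h x i4 l * (Mm h x *m Rm h x - Rm' h x) l i4)); last first.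
      by move=> l /negbTE ->.
    by move: (\sum_(l | _) _) => t; ring.
  apply: decayingD; last exact: decayingN.
  apply: decaying_sum => l; have [_|l4] := eqVneq l i4; first exact: decaying0.
  by apply: decayingMr; [exact: bQ|exact: dN].
have [sg [K [bsg K0 HY]]] := first_order_correction beta0 a0 h01 Cz0 eps0 tlm to
  (G := fun j k h x => Gm h x j k) tG tb b_ge0 dG dG4 separation off_bound.
have [B B0 HB] := bounded_uniform bsg.
exists (fun h x => Gm h x i0 i0), (fun h x => \col_j sg j h x), B, K; split.
- exact: dG.
- exact: tame_continuous (tG i0 i0).
- by move=> h x i hh ax; rewrite mxE HB.
- by [].
move=> h hh; have [Y [cY dY bY]] := HY h hh.
have hC : h%:C != 0 :> R[i].
  have /andP[hp _] := hh.
  by apply: contraTneq hp => /(congr1 (@complex.Re R)) /= ->; rewrite ltxx.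
exists (fun x => \col_j Y j x); split.
- by move=> i x; have := cY i x; congr continuousC; apply/funext => y; rewrite mxE.
- move=> E x ax dE; have ax' := ltW ax.
  pose Lm : 'M[R[i]]_5 := \matrix_(j, k) ((if j == k then lm j h x else 0) +
                             (if (j == i1) && (k == i2) then o h x else 0)).
  pose Sm : 'M[R[i]]_5 := h%:C^-1 *: (Lm - (lm i0 h x)%:M) + (Gm h x - (Gm h x i0 i0)%:M).
  pose y : 'cV[R[i]]_5 := \col_j Y j x.
  have dYm : is_deriveM (fun t => \col_j Y j t : 'cV[R[i]]_5) x (Sm *m y).
    move=> i j; have := dY i x ax; rewrite (_ : (fun t => _) = Y i); last first.
      by apply/funext => t; rewrite mxE.
    congr is_deriveC; rewrite [RHS]mxE; apply: eq_bigr => k _.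
    rewrite [y _ _]mxE; congr (_ * _); rewrite /system_coeff /Gd /Sm !mxE.
    case: (eqVneq i k) => [->|ik] /=; last by rewrite !mulr0n !subr0 add0r.
    by rewrite !mulr1n [_ + _ - _]addrAC.
  have dRm : is_deriveM (fun t => Rm h t) x (Rm' h x).
    by move=> i j; have [d _ _] := HR1 (i, j); have := d h x hh ax; rewrite mxE.
  have := is_deriveM_scale dE (is_deriveM_mul dRm dYm); rewrite -/y.
  have RG : Rm h x *m Gm h x = Mm h x *m Rm h x - Rm' h x.
    by rewrite /Gm mulmxA RQ // mul1mx.
  suff -> : ((h%:C^-1 * lm i0 h x + Gm h x i0 i0) * E x) *: (Rm h x *m y) +
      E x *: (Rm' h x *m y + Rm h x *m (Sm *m y)) =
      h%:C^-1 *: ((Phi h x + h%:C *: Mm h x) *m (E x *: (Rm h x *m y))) by [].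
  have RS : Rm h x *m Sm = h%:C^-1 *: (Phi h x *m Rm h x) + Mm h x *m Rm h x - Rm' h x
      - (h%:C^-1 * lm i0 h x + Gm h x i0 i0) *: Rm h x.
    rewrite /Sm mulmxDr -scalemxAr !mulmxBr RG !mul_mx_scalar -PhiR // scalerBr scalerDl scalerA.
    by apply/matrixP => i j; rewrite !mxE; ring.
  have -> : (Phi h x + h%:C *: Mm h x) *m (E x *: (Rm h x *m y)) =
      E x *: ((Phi h x *m Rm h x) *m y + h%:C *: ((Mm h x *m Rm h x) *m y)).
    by rewrite -scalemxAr mulmxA mulmxDl mulmxDl -!scalemxAl.
  rewrite (mulmxA (Rm h x) Sm) RS !mulmxBl mulmxDl -!scalemxAl.
  move: (_ *m y) ((Mm h x *m _) *m y) (Rm' h x *m y) (Rm h x *m y) => v1 v2 v3 v4.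
  by apply/matrixP => i j; rewrite !mxE; field.
- move=> x i ax; rewrite !mxE andbT.
  have E : (if i == i0 then 1 else 0) = (i == 0)%:R :> R[i].
    by rewrite (_ : (0 : 'I_5) = i0); [case: (i == i0)|apply: val_inj].
  by have := bY i x ax; rewrite E.
Qed.

End DiagonalizedSystem.

(** * The ZND system along the profile *)

Section SymbolsAlongProfile.
Variables (R : realType) (th : thermo R) (w : profile R) (beta : R).
Hypotheses (Hth : thermodynamics th) (Hw : strong_detonation th w)
  (Hst : standing_assumptions th w beta).

Definition velC x : R[i] := (vel w x)%:C.
Definition volC x : R[i] := (vol w x)%:C.
Definition c0C x : R[i] := (c0 th (st w x))%:C.
Definition pSC x : R[i] := (d_S (pressure th) (st w x))%:C.
Definition plC x : R[i] := (d_lam (pressure th) (st w x))%:C.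

Lemma real_neq0 (t : R) : t != 0 -> t%:C != 0 :> R[i].
Proof. by apply: contraNneq => /(congr1 (@complex.Re R)) /= ->. Qed.

Lemma profile_neq0 x : 0 <= x ->
  [/\ velC x != 0, volC x != 0, c0C x != 0 & velC x ^+ 2 - c0C x ^+ 2 != 0].
Proof.
move=> x0; have u0 := vel_gt0 Hst x0; have v0 := vol_gt0 Hth Hw x0.
have c00 := c0_gt0 Hst x0; have [g g0 Hg] := sound_gap_bound Hst.
split; [by apply: real_neq0; rewrite gt_eqF ..|].
rewrite -!rmorphXn -rmorphB; apply: real_neq0; rewrite lt_eqF //.
by have := Hg x x0; rewrite /sound_gap; lra.
Qed.

Lemma gap_eq x : 0 <= x -> c0 th (st w x) ^+ 2 * eta th w x = sound_gap th w x.
Proof.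
by move=> x0; have c00 := c0_gt0 Hst x0; rewrite /eta /kappa /sound_gap; field; rewrite gt_eqF.
Qed.

Lemma vpv_eq x : 0 <= x ->
  vol w x * d_v (pressure th) (st w x) = vol w x * - (c0 th (st w x) ^+ 2 / vol w x ^+ 2).
Proof.
move=> x0; have v0 := vol_gt0 Hth Hw x0; rewrite (c0_sqr Hst x0).
by field; rewrite gt_eqF.
Qed.

Lemma realmx_Ax x : 0 <= x ->
  Defs.realmx (Ax th w x) = Ax_symbol (velC x) (volC x) (c0C x) (pSC x) (plC x).
Proof.
move=> x0; apply/matrixP => i j; rewrite !mxE /= (vpv_eq x0).
case: i => -[|[|[|[|[|i]]]]] //= _; case: j => -[|[|[|[|[|j]]]]] //= _;
  by rewrite /velC /volC /c0C /pSC /plC ?rmorphN ?rmorphM ?rmorphN ?rmorphM ?fmorphV ?rmorphXn.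
Qed.

Lemma realmx_Ay x : 0 <= x ->
  Defs.realmx (Ay th w x) = Ay_symbol (volC x) (c0C x) (pSC x) (plC x).
Proof.
move=> x0; apply/matrixP => i j; rewrite !mxE /= (vpv_eq x0).
case: i => -[|[|[|[|[|i]]]]] //= _; case: j => -[|[|[|[|[|j]]]]] //= _;
  by rewrite /volC /c0C /pSC /plC ?rmorphN ?rmorphM ?rmorphN ?rmorphM ?fmorphV ?rmorphXn.
Qed.

Lemma invmx_Ax x : 0 <= x ->
  invmx (Defs.realmx (Ax th w x)) = Ax_inv (velC x) (volC x) (c0C x) (pSC x) (plC x).
Proof.
move=> x0; have [u0 v0 c00 dl0] := profile_neq0 x0.
have E := Ax_invE (pSC x) (plC x) u0 v0 dl0.
rewrite realmx_Ax //; have [U _] := mulmx1_unit E.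
by rewrite -[LHS]mulmx1 -E mulKmx.
Qed.

Definition zeroth_order x := (invmx (Defs.realmx (Ax th w x)) *m Defs.realmx (Bmx th w x))^T.

Lemma system_symbol x (zeta nu : R[i]) (h : R) : 0 <= x ->
  Phi0 th w x zeta + h%:C *: Phi1 th w x nu =
  Phi_symbol (velC x) (volC x) (c0C x) (pSC x) (plC x) (zeta + h%:C * nu) iC
    + h%:C *: zeroth_order x.
Proof.
move=> x0; have [u0 v0 c00 dl0] := profile_neq0 x0.
rewrite -(Phi_symbolE (pSC x) (plC x) (zeta + h%:C * nu) iC u0 v0 dl0).
rewrite -(invmx_Ax x0) -(realmx_Ay x0) /Phi0 /Phi1 /zeroth_order.
move: (invmx _) (Defs.realmx (Bmx _ _ _)) (Defs.realmx (Ay _ _ _)) => A B C.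
rewrite scalerDr; move: (h%:C *: (A *m B)^T) => E.
have -> : A *m ((zeta + h%:C * nu)%:M + iC *: C) =
    A *m (zeta%:M + iC *: C) + (h%:C * nu) *: A.
  by rewrite [(zeta + _)%:M]raddfD addrAC mulmxDr mul_mx_scalar.
move: (A *m _) => P.
by apply/matrixP => i j; rewrite !mxE mulrA addrA.
Qed.

Lemma mu_eig x (z : R[i]) j : 0 <= x ->
  mu th w x z j = eig_symbol (velC x) (c0C x) z (Defs.sfun th w x z) j.
Proof.
move=> x0; have [u0 v0 c00 dl0] := profile_neq0 x0.
have kE : (kappa th w x)%:C = velC x / c0C x by rewrite /kappa rmorphM fmorphV.
have eE : (eta th w x * vel w x)%:C = (1 - (velC x / c0C x) ^+ 2) * velC x.
  by rewrite rmorphM rmorphB rmorph1 rmorphXn /= kE.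
have e0 : 1 - (velC x / c0C x) ^+ 2 != 0.
  rewrite (_ : _ - _ = - (velC x ^+ 2 - c0C x ^+ 2) / c0C x ^+ 2); last by field.
  by rewrite mulf_neq0 ?oppr_eq0 // invr_neq0 // expf_neq0.
rewrite /mu kE eE /eig_symbol -/(velC x).
have d0 : c0C x ^+ 2 - velC x ^+ 2 != 0 by rewrite -opprB oppr_eq0.
case: j => -[|[|[|[|[|j]]]]] //= _; field; rewrite ?u0 ?c00 ?dl0 ?d0 //=.
Qed.

Lemma Tmx_col0 x (z g : R[i]) i : 0 <= x ->
  Tmx th w x z i 0 =
  R_symbol (velC x) (volC x) (c0C x) (pSC x) (plC x) z (Defs.sfun th w x z) g iC i 0.
Proof.
move=> x0; have [u0 v0 c00 dl0] := profile_neq0 x0.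
have kE : (kappa th w x)%:C = velC x / c0C x by rewrite /kappa rmorphM fmorphV.
have mE : (mflux w x)%:C = velC x / volC x by rewrite /mflux rmorphM fmorphV.
rewrite /Tmx /R_symbol !mxE kE mE -/(velC x) -/(pSC x) -/(plC x).
by case: i => -[|[|[|[|[|j]]]]] //= _; field; rewrite ?u0 ?c00 ?v0.
Qed.

End SymbolsAlongProfile.

Section AwayFromZero.
Variables (R : realType) (beta h0 a : R).

Lemma away_from0M f g : away_from0 h0 a f -> away_from0 h0 a g ->
  away_from0 h0 a (fun h x => f h x * g h x : R[i]).
Proof.
move=> [c c0 H] [d d0 G]; exists (c * d); first exact: mulr_gt0.
by move=> h x hh ax; rewrite modcM; apply: ler_pM; rewrite ?H ?G // ltW.
Qed.

Lemma away_from0X f n : away_from0 h0 a f -> away_from0 h0 a (fun h x => f h x ^+ n : R[i]).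
Proof.
move=> af; elim: n => [|n IH].
  by exists 1 => // h x _ _; rewrite expr0 modc1.
have [c c0 H] := away_from0M af IH; exists c => // h x hh ax.
by rewrite exprS H.
Qed.

Lemma away_from0_cst (z : R[i]) : z != 0 -> away_from0 h0 a (fun _ _ => z).
Proof. by move=> z0; exists (modc z); rewrite ?modc_gt0. Qed.

Lemma tame_const n (z : R[i]) : tame beta h0 a n (fun _ _ => z).
Proof. exact: (@tame_cst _ _ _ _ _ (fun=> z) (modc z)). Qed.

Lemma tameX n m f : tame beta h0 a n f -> tame beta h0 a n (fun h x => f h x ^+ m).
Proof.
move=> tf; elim: m => [|m IH].
  by apply: tame_ext (tame_const n 1) => h x _ _; rewrite expr0.
by apply: tame_ext (tameM tf IH) => h x _ _; rewrite exprS.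
Qed.

Lemma decaying_restrict h1 b f : h1 <= h0 -> a <= b ->
  decaying beta h0 a f -> decaying beta h1 b f.
Proof.
move=> h10 ab [C C0 H]; exists C => // h x /andP[hp hh] bx.
by apply: H; rewrite ?hp ?(lt_le_trans hh) // (le_trans ab).
Qed.

End AwayFromZero.

(** * Spectral gaps along the profile *)

Section ProfileFamilies.
Variables (R : realType) (th : thermo R) (w : profile R) (beta : R).
Hypotheses (Hth : thermodynamics th) (Hw : strong_detonation th w)
  (Hst : standing_assumptions th w beta).
Variables (a Czeta hzn : R) (zeta nu : R[i]).
Hypotheses (Ha : 0 <= a) (Hzeta : 0 <= complex.Re zeta) (Hnu : 0 <= complex.Re nu).
Hypothesis Cz0 : 0 < Czeta.

Let z (h : R) := zeta + h%:C * nu.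
Let s h x := Defs.sfun th w x (z h).

Hypothesis Hsep : forall (j : 'I_5) (x h : R), j != 0 -> a <= x -> 0 < h <= hzn ->
  Czeta <= modc (mu th w x (z h) 0 - mu th w x (z h) j).

Local Notation U := (velC w).
Local Notation V := (volC w).
Local Notation C := (c0C th w).
Local Notation PS := (pSC th w).
Local Notation PL := (plC th w).

Let beta0 : 0 < beta. Proof. by have [_ _ [b0 _] _] := Hst. Qed.

Lemma sound_gap_tame n : rtame beta 1 0 n (sound_gap th w).
Proof.
have tc := c0_tame Hth Hw Hst n; have tu := vel_tame Hth Hw Hst n.
apply: (@rtame_ext _ _ _ _ _ (fun x => c0 th (st w x) * c0 th (st w x) + - (vel w x * vel w x))).
  by move=> x _; rewrite /sound_gap !expr2.
by apply: rtameD; [exact: rtameM|apply: rtameN; exact: rtameM].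
Qed.

Lemma Re_param h : 0 < h -> 0 <= complex.Re (z h).
Proof. by move=> hp; rewrite ReCD ReCM /= mul0r subr0 addr_ge0 // mulr_ge0 // ltW. Qed.

Lemma modc_param h : 0 < h <= 1 -> modc (z h) <= modc zeta + modc nu.
Proof.
move=> /andP[hp h1]; apply: le_trans (modcD _ _) _; rewrite lerD2l modcM modcR gtr0_norm //.
by rewrite ler_piMl // modc_ge0.
Qed.

Lemma gap_gt0 x : 0 <= x -> 0 < c0 th (st w x) ^+ 2 * eta th w x.
Proof.
move=> x0; rewrite (gap_eq Hst x0); have [g g0 H] := sound_gap_bound Hst.
exact: lt_le_trans (H x x0).
Qed.

Lemma sfun_continuous (A : R) (t : R[i]) : 0 <= A -> 0 <= complex.Re t ->
  forall x, continuousC (fun y => Defs.sfun th w (Num.max A y) t) x.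
Proof.
move=> A0 t0 x.
have pos y : 0 <= Num.max A y by rewrite le_max A0.
have cg : continuous (fun y : R => sound_gap th w (Num.max A y)).
  have cg : continuous (fun y : R => sound_gap th w (Num.max 0 y)).
    exact: (@rtame_continuous _ beta 0 _ (sound_gap_tame 0)).
  move=> y; apply: (eq_continuous_for (p := (fun y : R => sound_gap th w (Num.max 0 y)) \o (fun y => Num.max A y))).
    by move=> y' /=; rewrite (max_r (pos y')).
  apply: continuous_comp; last exact: cg.
  by apply: continuous_max; [exact: cst_continuous|exact: cvg_id].
have key e : 0 < e -> exists2 d : R, 0 < d & forall y, `|y - x| < d ->
    modc (Defs.sfun th w (Num.max A y) t - Defs.sfun th w (Num.max A x) t) < e.
  move=> e0; have [d d0 H] := (continuous_forP _ x).1 (cg x) (e ^+ 2) (exprn_gt0 2 e0).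
  exists d => // y /H H1; rewrite -ltr_sqr ?nnegrE ?modc_ge0 ?(ltW e0) //.
  apply: le_lt_trans (sfun_dist_sqr t0 (gap_gt0 (pos y)) (gap_gt0 (pos x))) _.
  by rewrite !(gap_eq Hst).
split; apply/continuous_forP => e e0; have [d d0 H] := key e e0; exists d => // y /H.
- by apply: le_lt_trans; rewrite -ReCN -ReCD Re_le_modc.
- by apply: le_lt_trans; rewrite -ImCN -ImCD Im_le_modc.
Qed.

Lemma c0_bounded : exists2 M : R, 0 < M & forall x, 0 <= x -> c0 th (st w x) <= M.
Proof.
have [M M0 H] := tame_bounded (c0_tame Hth Hw Hst 0).
exists (M + 1); first lra.
move=> x x0; have h1 : 0 < (2^-1 : R) < 1 by lra.
have := H _ x h1 x0; rewrite modcR; have := ler_norm (c0 th (st w x)); lra.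
Qed.

Lemma eig_diff1 x h : 0 <= x ->
  eig_symbol (U x) (C x) (z h) (s h x) 1 - eig_symbol (U x) (C x) (z h) (s h x) 0 =
  (2 * c0 th (st w x) / sound_gap th w x)%:C * s h x.
Proof.
move=> x0; have [u0 v0 c00 dl0] := profile_neq0 Hth Hw Hst x0.
rewrite /sound_gap !rmorphM fmorphV rmorphB !rmorphXn rmorph_nat /= -/(U x) -/(C x).
have d0 : C x ^+ 2 - U x ^+ 2 != 0 by rewrite -opprB oppr_eq0.
by rewrite /eig_symbol /=; field; rewrite dl0 d0.
Qed.

Lemma eig_diff2 x h (j : 'I_5) : 0 <= x -> (1 < j)%N ->
  eig_symbol (U x) (C x) (z h) (s h x) j - eig_symbol (U x) (C x) (z h) (s h x) 0 =
  (c0 th (st w x) / (vel w x * sound_gap th w x))%:C * (C x * z h + U x * s h x).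
Proof.
move=> x0 j1; have [u0 v0 c00 dl0] := profile_neq0 Hth Hw Hst x0.
rewrite /sound_gap !rmorphM fmorphV rmorphM rmorphB !rmorphXn /= -/(U x) -/(C x).
have d0 : C x ^+ 2 - U x ^+ 2 != 0 by rewrite -opprB oppr_eq0.
rewrite /eig_symbol; case: j j1 => -[|[|[|[|[|j]]]]] //= _ _; field; rewrite ?dl0 ?u0 ?d0 //.
Qed.

(** The eigenvalue differences are positive multiples of s and of c z + u s, whose real parts are
    nonnegative because Re s >= Re z >= 0. *)
Lemma eig_separation (j : 'I_5) h x : j != i0 -> 0 < h <= hzn -> a <= x ->
  Czeta <= modc (eig_symbol (U x) (C x) (z h) (s h x) j - eig_symbol (U x) (C x) (z h) (s h x) 0)
  /\ 0 <= complex.Re (eig_symbol (U x) (C x) (z h) (s h x) j - eig_symbol (U x) (C x) (z h) (s h x) 0).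
Proof.
move=> j0 hh ax; have x0 := le_trans Ha ax; have /andP[hp _] := hh.
have j0' : j != 0 by rewrite (_ : (0 : 'I_5) = i0) //; exact: val_inj.
split; first by have := Hsep j0' ax hh; rewrite !(mu_eig Hth Hw Hst) // -modcN opprB.
have [_ r _ _] := sfun_spec (Re_param hp) (gap_gt0 x0).
have u0 := vel_gt0 Hst x0; have c00 := c0_gt0 Hst x0; have r0 := Re_param hp.
have g0 := gap_gt0 x0; rewrite (gap_eq Hst x0) in g0.
have [j1|j1] := leqP j 1.
  have jE : j = i1.
    by case: j j0 j0' j1 => -[|[|j]] //= Hj _ _ _; exact: val_inj.
  rewrite jE (eig_diff1 h x0) ReCM /= mul0r subr0 mulr_ge0 //; last exact: le_trans r.
  by rewrite divr_ge0 ?(ltW g0) // mulr_ge0 // ltW.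
rewrite (eig_diff2 h x0 j1) ReCM ReCD !ReCM /= !mul0r !subr0 mulr_ge0 //.
  by rewrite divr_ge0 ?(ltW c00) // mulr_ge0 // ltW.
by rewrite addr_ge0 // mulr_ge0 ?(ltW c00) ?(ltW u0) //; exact: le_trans r.
Qed.

(** Through the formulas for the eigenvalue differences, separation bounds s and c z + u s from
    below. These are the delicate denominators of the dual basis. In the constants M is an upper
    bound of c0 and g a lower bound of c0^2 - u^2. *)
Lemma symbol_lower_bounds : exists2 c : R, 0 < c & forall h x, 0 < h <= hzn -> a <= x ->
  c <= modc (s h x) /\ c <= modc (C x * z h + U x * s h x).
Proof.
have [g g0 Hg] := sound_gap_bound Hst; have [M M0 HM] := c0_bounded.
have [C1 [C2 [C10 C21 HC]]] := kappa_vel_bounds Hst.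
exists (Num.min (Czeta * g / (2 * M)) (Czeta * (C1 * g) / M)).
  by rewrite lt_min !divr_gt0 ?mulr_gt0.
move=> h x hh ax; have x0 := le_trans Ha ax; have /andP[hp _] := hh.
have c00 := c0_gt0 Hst x0; have gx := Hg x x0; have Mx := HM x x0.
have gp : 0 < sound_gap th w x by lra.
have [_ /andP[ux _]] := HC x x0; have up : 0 < vel w x by lra.
have [S1 _] := @eig_separation i1 h x isT hh ax.
have [S2 _] := @eig_separation i2 h x isT hh ax.
move: S1 S2; rewrite (eig_diff1 h x0) (@eig_diff2 x h i2) // !modcM !modcR.
move: (modc (s h x)) (modc (_ + _)) (modc_ge0 (s h x)) (modc_ge0 (C x * z h + U x * s h x)) => p q p0 q0.
rewrite !ger0_norm ?divr_ge0 ?mulr_ge0 ?(ltW c00) ?(ltW gp) ?(ltW up) //.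
rewrite mulrAC ler_pdivlMr // [in Czeta <= _]mulrAC ler_pdivlMr ?mulr_gt0 // => S1 S2.
split; rewrite ge_min; apply/orP; [left|right].
  rewrite ler_pdivrMr ?mulr_gt0 //.
  have : Czeta * g <= Czeta * sound_gap th w x by rewrite ler_wpM2l // ltW.
  have : c0 th (st w x) * p <= M * p by rewrite ler_wpM2r.
  lra.
rewrite ler_pdivrMr //.
have : Czeta * (C1 * g) <= Czeta * (vel w x * sound_gap th w x).
  by apply: ler_wpM2l; [exact: ltW|apply: ler_pM => //; exact: ltW].
have : c0 th (st w x) * q <= M * q by rewrite ler_wpM2r.
lra.
Qed.

End ProfileFamilies.

(** * The eigenbasis along the profile *)

Section ProfileSystem.
Variables (R : realType) (th : thermo R) (w : profile R) (beta : R).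
Hypotheses (Hth : thermodynamics th) (Hw : strong_detonation th w)
  (Hst : standing_assumptions th w beta).
Variables (a Czeta h1 : R) (zeta nu : R[i]).
Hypotheses (Ha : 0 <= a) (Hzeta : 0 <= complex.Re zeta) (Hnu : 0 <= complex.Re nu).
Hypotheses (Cz0 : 0 < Czeta) (h11 : h1 <= 1).

Let z (h : R) := zeta + h%:C * nu.
Let s h x := Defs.sfun th w x (z h).

Hypothesis Hsep : forall (j : 'I_5) (x h : R), j != 0 -> a <= x -> 0 < h <= h1 ->
  Czeta <= modc (mu th w x (z h) 0 - mu th w x (z h) j).
Hypothesis Hvel : forall x, 0 <= x -> 2 * (h1 * complex.Re nu) <= vel w x.

Local Notation U := (velC w).
Local Notation V := (volC w).
Local Notation C := (c0C th w).
Local Notation PS := (pSC th w).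
Local Notation PL := (plC th w).

Let beta0 : 0 < beta. Proof. by have [_ _ [b0 _] _] := Hst. Qed.

(* The Jordan block of [z / u] and [mu_2] cannot be removed where the two
   coincide.  On the imaginary axis they stay apart and this choice annihilates
   the off-diagonal entry; for [Re zeta > 0] the entry is kept and dominated by
   the gap between [Re mu_1] and [Re mu_2]. *)
Definition jordan_shift h x : R[i] := if complex.Re zeta == 0 then
  z h * U x * (U x * s h x / C x + z h) / (U x ^+ 2 - z h ^+ 2) else 0.

Definition eigenbasis h x := R_symbol (U x) (V x) (C x) (PS x) (PL x) (z h) (s h x)
  (jordan_shift h x) iC.
Definition dual_basis h x := Q_symbol (U x) (V x) (C x) (PS x) (PL x) (z h) (s h x)
  (jordan_shift h x) iC.
Definition eigenvalue_of (j : 'I_5) h x : R[i] := eig_symbol (U x) (C x) (z h) (s h x) j.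
Definition jordan_entry h x := off_symbol (U x) (C x) (z h) (s h x) (jordan_shift h x).
Definition principal_symbol h x := Phi_symbol (U x) (V x) (C x) (PS x) (PL x) (z h) iC.

Notation tame := (tame beta h1 a).
Notation away := (away_from0 h1 a).

Let real_tame n f : rtame beta 1 0 n f -> tame n (fun _ x => (f x)%:C).
Proof. exact: tame_restrict. Qed.

Let range h : 0 < h < h1 -> 0 < h <= h1.
Proof. by move=> /andP[-> /ltW]. Qed.

Let away_velC : away (fun _ => U).
Proof.
have [C1 [C2 [C10 C21 HC]]] := kappa_vel_bounds Hst.
exists C1 => // h x _ ax; have x0 := le_trans Ha ax.
by rewrite modcR ger0_norm ?(ltW (vel_gt0 Hst x0)) //; have [_ /andP[]] := HC x x0.
Qed.

Let away_volC : away (fun _ => V).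
Proof.
have [c c0 H] := away_velC; have m0 := m0_gt0 Hth Hw Hst.
exists (c / (vel w 0 / vol w 0)); first by rewrite divr_gt0.
move=> h x hh ax; have := H h x hh ax; rewrite ler_pdivrMr // /volC /velC !modcR.
have x0 := le_trans Ha ax.
by rewrite (vel_eq Hth Hw x0) normrM (gtr0_norm m0) mulrC.
Qed.

Let away_c0C : away (fun _ => C).
Proof.
have [c c0 H] := away_velC; exists c => // h x hh ax; apply: le_trans (H h x hh ax) _.
have x0 := le_trans Ha ax; have u0 := vel_gt0 Hst x0; have c00 := c0_gt0 Hst x0.
have [g g0 Hg] := sound_gap_bound Hst.
rewrite !modcR !ger0_norm ?ltW // -ltr_sqr ?nnegrE ?ltW //.
by have := Hg x x0; rewrite /sound_gap; lra.
Qed.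

Let away_s : away s /\ away (fun h x => C x * z h + U x * s h x).
Proof.
have [c c0 H] := symbol_lower_bounds Hth Hw Hst Ha Hzeta Hnu Cz0 Hsep.
by split; exists c => // h x hh ax; have [] := H h x (range hh) ax.
Qed.

Let away_gap : away (fun _ x => U x ^+ 2 - C x ^+ 2).
Proof.
have [g g0 Hg] := sound_gap_bound Hst.
exists g => // h x _ ax; have x0 := le_trans Ha ax; have G := Hg x x0.
rewrite -!rmorphXn -rmorphB modcR ler0_norm; first by move: G; rewrite /sound_gap; lra.
by move: G; rewrite /sound_gap; lra.
Qed.

(** Since mu_2 - z / u = c (u^2 - z^2) / (u (c z + u s)), this lower bound is what admits
    [jordan_shift]. For Re zeta = 0 one has Re z = h Re nu <= u / 2, and (Im z)^2 only increases the
    real part of u^2 - z^2. *)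
Let away_cut : complex.Re zeta = 0 -> away (fun h x => U x ^+ 2 - z h ^+ 2).
Proof.
move=> r0; have [c c0 H] := away_velC; exists (3 / 4 * c ^+ 2).
  by rewrite mulr_gt0 ?exprn_gt0 //; lra.
move=> h x hh ax; have cu := H h x hh ax; have x0 := le_trans Ha ax.
have u0 := vel_gt0 Hst x0; have hv := Hvel x0; have /andP[hp hl] := hh.
apply: le_trans (modc_ge_Re _).
have zE : complex.Re (z h) = h * complex.Re nu by rewrite /z ReCD ReCM /= r0; ring.
rewrite !expr2 ReCD ReCN !ReCM zE /=.
move: cu; rewrite modcR ger0_norm ?(ltW u0) // => cu.
have hn : 2 * (h * complex.Re nu) <= vel w x.
  apply: le_trans hv; rewrite ler_wpM2l // ler_wpM2r // ltW //.
have hn0 : 0 <= h * complex.Re nu by rewrite mulr_ge0 // ltW.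
move: (complex.Im (z h)) => y; move: (h * complex.Re nu) hn hn0 => t hn hn0.
have : c * c <= vel w x * vel w x by apply: ler_pM => //; exact: ltW.
have : t * t <= vel w x * vel w x / 4 by nra.
nra.
Qed.

Let tame_atoms n : [/\ tame n (fun _ => U), tame n (fun _ => V), tame n (fun _ => C),
  tame n (fun _ => PS) & tame n (fun _ => PL)].
Proof.
have [tv tf] := profile_tame 1 Hth Hw Hst n; have [_ _ [ap _ _ _ _] _ _] := Hth.
split; [exact: real_tame (vel_tame Hth Hw Hst n)|exact: real_tame tv
  |exact: real_tame (c0_tame Hth Hw Hst n)|exact: real_tame (tf _ (analytic_on_d_S ap))
  |exact: real_tame (tf _ (analytic_on_d_lam ap))].
Qed.

Let tame_z n : tame n (fun h _ => z h).
Proof.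
apply: (@tame_cst _ _ _ _ _ z (modc zeta + modc nu)) => h /range /andP[hp hh].
by apply: modc_param => //; rewrite hp (le_trans hh).
Qed.

Let tame_s n : tame n s.
Proof.
apply: (@tame_sqrt _ _ _ _ _ _ (fun h x => z h * z h + (sound_gap th w x)%:C)).
- move=> h x /andP[hp _] ax; have x0 := le_trans Ha ax.
  have [E _ _ _] := sfun_spec (Re_param Hzeta Hnu hp) (gap_gt0 Hst x0).
  by rewrite -expr2 E (gap_eq Hst x0) expr2.
- move=> h /andP[hp _]; apply: (sfun_continuous Hth Hw Hst) => //.
  exact: Re_param.
- exact: away_s.1.
- apply: tameD; first by apply: tameM; exact: tame_z.
  by apply: real_tame; exact: sound_gap_tame.
Qed.

Local Ltac away_tac := repeat first [assumption | apply: away_from0M | apply: away_from0X |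
  apply: away_from0_cst; by rewrite pnatr_eq0].

Local Ltac tame_tac := repeat first [assumption | exact: tame_const |
  apply: tameD | apply: tameN | apply: tameM | apply: tameX |
  (apply: tameV; first by away_tac)].

Lemma jordan_shift_tame n : tame n jordan_shift.
Proof.
have [tU tV tC tS tL] := tame_atoms n; have ts := tame_s n; have tz := tame_z n.
rewrite /jordan_shift; have [r0|_] := eqVneq (complex.Re zeta) 0; last exact: tame_const.
have ac := away_cut r0; tame_tac.
Qed.

Local Ltac entry_tac := eapply tame_ext;
  [move=> ? ? _ _; rewrite [RHS]mxE /=; reflexivity | cbv beta; tame_tac].

Lemma eigenbasis_tame n : mtame beta h1 a n eigenbasis.
Proof.
have [tU tV tC tS tL] := tame_atoms n; have ts := tame_s n; have tz := tame_z n.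
have tg := jordan_shift_tame n; have [as_ aD] := away_s.
rewrite /eigenbasis.
case=> -[|[|[|[|[|i]]]]] //= Hi; case=> -[|[|[|[|[|j]]]]] //= Hj; entry_tac.
Qed.

Lemma dual_basis_tame n : mtame beta h1 a n dual_basis.
Proof.
have [tU tV tC tS tL] := tame_atoms n; have ts := tame_s n; have tz := tame_z n.
have tg := jordan_shift_tame n; have [as_ aD] := away_s.
rewrite /dual_basis.
case=> -[|[|[|[|[|i]]]]] //= Hi; case=> -[|[|[|[|[|j]]]]] //= Hj; entry_tac.
Qed.

Lemma principal_symbol_tame n : mtame beta h1 a n principal_symbol.
Proof.
have [tU tV tC tS tL] := tame_atoms n; have tz := tame_z n.
rewrite /principal_symbol.
case=> -[|[|[|[|[|i]]]]] //= Hi; case=> -[|[|[|[|[|j]]]]] //= Hj; entry_tac.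
Qed.

Let symbol_conditions h x : 0 < h < h1 -> a <= x ->
  [/\ s h x != 0, C x * z h + U x * s h x != 0,
      s h x ^+ 2 = z h ^+ 2 + C x ^+ 2 - U x ^+ 2 & (iC : R[i]) ^+ 2 = -1].
Proof.
move=> hh ax; have x0 := le_trans Ha ax; have /andP[hp _] := hh; split.
- exact: away_neq0 away_s.1 hh ax.
- exact: away_neq0 away_s.2 hh ax.
- have [E _ _ _] := sfun_spec (Re_param Hzeta Hnu hp) (gap_gt0 Hst x0).
  by rewrite E (gap_eq Hst x0) /sound_gap rmorphB !rmorphXn addrA.
- by apply: complex_ext; rewrite expr2 ?ReCM ?ImCM ?ReCN ?ImCN /=; ring.
Qed.

Lemma eigenbasis_inv h x : 0 < h < h1 -> a <= x -> eigenbasis h x *m dual_basis h x = 1%:M.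
Proof.
move=> hh ax; have [u0 v0 c00 dl0] := profile_neq0 Hth Hw Hst (le_trans Ha ax).
by have [s0 D0 sE iE] := symbol_conditions hh ax; exact: R_symbol_inv.
Qed.

Lemma principal_symbol_eigenbasis h x : 0 < h < h1 -> a <= x ->
  principal_symbol h x *m eigenbasis h x = eigenbasis h x *m
    (\matrix_(j, k) ((if j == k then eigenvalue_of j h x else 0) +
                     (if (j == i1) && (k == i2) then jordan_entry h x else 0))).
Proof.
move=> hh ax; have [u0 v0 c00 dl0] := profile_neq0 Hth Hw Hst (le_trans Ha ax).
have [s0 D0 sE iE] := symbol_conditions hh ax.
rewrite /principal_symbol /eigenbasis (Phi_R_symbol _ _ _ u0 v0 c00 dl0 sE iE).
congr (_ *m _); apply/matrixP => j k; rewrite !mxE; congr (_ + _).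
  by case: eqP => [->|_]; rewrite ?mul1r ?mul0r.
by rewrite -![_ == _ :> 'I_5]val_eqE /=; case: andP => _; rewrite ?mul1r ?mul0r.
Qed.

Let zeroth_orderE x j k : 0 <= x -> zeroth_order th w x j k =
  \sum_l Ax_inv (U x) (V x) (C x) (PS x) (PL x) k l * (Bmx th w x l j)%:C.
Proof.
move=> x0; rewrite /zeroth_order (invmx_Ax Hth Hw Hst x0) mxE mxE.
by apply: eq_bigr => l _; congr (_ * _); rewrite mxE.
Qed.

Let Ax_inv_tame n : mtame beta h1 a n (fun _ x => Ax_inv (U x) (V x) (C x) (PS x) (PL x)).
Proof.
have [tU tV tC tS tL] := tame_atoms n.
case=> -[|[|[|[|[|i]]]]] //= Hi; case=> -[|[|[|[|[|j]]]]] //= Hj; entry_tac.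
Qed.

Lemma zeroth_order_tame n : mtame beta h1 a n (fun _ x => zeroth_order th w x).
Proof.
move=> j k; apply: (@tame_ext _ _ _ _ _ (fun _ x =>
  \sum_l Ax_inv (U x) (V x) (C x) (PS x) (PL x) k l * (Bmx th w x l j)%:C)).
  by move=> h x _ ax; rewrite zeroth_orderE // (le_trans Ha).
apply: tame_sum => l; apply: tameM; first exact: Ax_inv_tame.
apply: real_tame; exact: Bmx_tame.
Qed.

Lemma zeroth_order_decay j k : j != i4 -> decaying beta h1 a (fun _ x => zeroth_order th w x j k).
Proof.
move=> j4; apply: (@decaying_ext _ _ _ _ (fun _ x =>
  \sum_l Ax_inv (U x) (V x) (C x) (PS x) (PL x) k l * (Bmx th w x l j)%:C)).
  by move=> h x _ ax; rewrite zeroth_orderE // (le_trans Ha).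
apply: decaying_sum => l; apply: decayingMr; first exact: tame_bounded (Ax_inv_tame 0 k l).
apply: (decaying_restrict h11 Ha); exact: (Bmx_decay Hth Hw Hst).
Qed.

Definition relaxation x : R := - d_lam (rate th) (st w x) / vel w x.

Lemma zeroth_order44 x : 0 <= x -> zeroth_order th w x i4 i4 = (relaxation x)%:C.
Proof.
move=> x0; rewrite zeroth_orderE // sum_ord5 /Ax_inv /Bmx !mxE /= !mul0r !add0r.
by rewrite /relaxation rmorphM fmorphV mulrC.
Qed.

Lemma relaxation_ge0 (x : R) : 0 <= x -> 0 <= relaxation x.
Proof.
move=> x0; have [_ _ _ [_ rl _ _]] := Hst.
rewrite /relaxation divr_ge0 ?(ltW (vel_gt0 Hst x0)) // oppr_ge0 ltW //.
exact: rl (dom_profile Hw x0).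
Qed.

Lemma relaxation_tame n : rtame beta h1 a n relaxation.
Proof.
have [_ tf] := profile_tame 1 Hth Hw Hst n; have [_ _ [_ _ _ _ ar] _ _] := Hth.
have [tU _ _ _ _] := tame_atoms n.
have tr : tame n (fun _ x => (d_lam (rate th) (st w x))%:C).
  exact: real_tame (tf _ (analytic_on_d_lam ar)).
apply: (@tame_ext _ _ _ _ _ (fun _ x => - (d_lam (rate th) (st w x))%:C / U x)).
  by move=> h x _ _; rewrite /relaxation rmorphM rmorphN fmorphV.
tame_tac.
Qed.

Lemma jordan_entry_bound : exists2 eps : R, 0 < eps & forall h x, 0 < h < h1 -> a <= x ->
  eps * modc (jordan_entry h x) <= complex.Re (eigenvalue_of i1 h x - eigenvalue_of i0 h x).
Proof.
have [r0|r0] := eqVneq (complex.Re zeta) 0.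
  exists 1 => // h x hh ax; have x0 := le_trans Ha ax.
  have [u0 v0 c00 dl0] := profile_neq0 Hth Hw Hst x0.
  have [s0 D0 sE iE] := symbol_conditions hh ax.
  have n0 := away_neq0 (away_cut r0) hh ax.
  have -> : jordan_entry h x = 0.
    rewrite /jordan_entry /off_symbol /eig_symbol /jordan_shift r0 eqxx /=.
    by field: sE; rewrite ?u0 ?c00 ?n0 ?dl0.
  rewrite modc0 mulr0.
  by have [] := eig_separation Hth Hw Hst Ha Hzeta Hnu Hsep (isT : i1 != i0) (range hh) ax.
have rp : 0 < complex.Re zeta by rewrite lt0r r0.
have [M M0 HM] := c0_bounded Hth Hw Hst.
pose N := modc zeta + modc nu + 1.
have N0 : 0 < N by rewrite /N; have := modc_ge0 zeta; have := modc_ge0 nu; lra.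
(* Re (mu_2 - mu_1) = (2 c0 / (c0^2 - u^2)) Re s is at least (2 / M) Re zeta, while the entry is -
   z, of modulus at most N. *)
exists (2 * complex.Re zeta / (M * N)); first by rewrite divr_gt0 ?mulr_gt0.
move=> h x hh ax; have x0 := le_trans Ha ax; have /andP[hp hl] := hh.
have -> : jordan_entry h x = - z h.
  by rewrite /jordan_entry /off_symbol /jordan_shift (negbTE r0) mul0r addr0.
rewrite modcN (eig_diff1 Hth Hw Hst zeta nu h x0) ReCM /= mul0r subr0.
have [_ rs _ _] := sfun_spec (Re_param Hzeta Hnu hp) (gap_gt0 Hst x0).
have rz : complex.Re zeta <= complex.Re (z h).
  by rewrite /z ReCD ReCM /= mul0r subr0 lerDl mulr_ge0 // ltW.
have {}rs := le_trans rz rs.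
have c00 := c0_gt0 Hst x0; have u0 := vel_gt0 Hst x0.
have gp : 0 < sound_gap th w x by have := gap_gt0 Hst x0; rewrite (gap_eq Hst x0).
have zN : modc (z h) <= N.
  have := @modc_param _ zeta nu h; rewrite hp (ltW (lt_le_trans hl h11)) => /(_ isT).
  by rewrite /N -/(z h); lra.
apply: (@le_trans _ _ (2 * complex.Re zeta / M)).
  rewrite invfM mulrA -mulrA ler_piMr //; last by rewrite mulrC ler_pdivrMr // mul1r.
  by rewrite divr_ge0 ?(ltW M0) // mulr_ge0.
rewrite ler_pdivrMr //; set k := _ / _.
have k0 : 0 <= k by rewrite divr_ge0 ?(ltW gp) // mulr_ge0 // ltW.
have k2 : 2 <= k * M.
  rewrite /k mulrAC ler_pdivlMr // -mulrA ler_wpM2l //.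
  apply: (@le_trans _ _ (c0 th (st w x) * c0 th (st w x))).
    by rewrite /sound_gap -expr2 gerBl sqr_ge0.
  by rewrite ler_wpM2l ?(ltW c00) // HM.
apply: (@le_trans _ _ (k * M * complex.Re zeta)); first by rewrite ler_wpM2r // ltW.
by rewrite [X in _ <= X]mulrAC ler_wpM2l // mulr_ge0 // ltW.
Qed.

Lemma profile_solution : exists (gam : R -> R -> R[i]) (sg : R -> R -> 'cV[R[i]]_5) (B K : R),
  [/\ decaying beta h1 a gam, continuous_fam h1 a gam,
      forall h x i, 0 < h < h1 -> a <= x -> modc (sg h x i 0) <= B, 0 <= K &
      forall h, 0 < h < h1 -> exists Y : R -> 'cV[R[i]]_5,
      [/\ forall i x, continuousC (fun y => Y y i 0) x,
          forall (E : R -> R[i]) x, a < x ->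
            is_deriveC E x ((h%:C^-1 * eigenvalue_of i0 h x + gam h x) * E x) ->
            is_deriveM (fun y => E y *: (eigenbasis h y *m Y y)) x
              (h%:C^-1 *: ((principal_symbol h x + h%:C *: zeroth_order th w x) *m
                 (E x *: (eigenbasis h x *m Y x)))) &
          forall x i, a <= x -> modc (Y x i 0 - (e1 i 0 + h%:C * sg h x i 0))
            <= K * h * expR (- beta * x)]].
Proof.
have [eps eps0 Heps] := jordan_entry_bound.
have tE n j : tame n (eigenvalue_of j).
  have [tU tV tC tS tL] := tame_atoms n; have ts := tame_s n; have tz := tame_z n.
  rewrite /eigenvalue_of /eig_symbol.
  by case: j => -[|[|[|[|[|j]]]]] //= Hj; tame_tac.
have to : tame 1 jordan_entry.
  have tg := jordan_shift_tame 1; have tz := tame_z 1; have [tU _ _ _ _] := tame_atoms 1.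
  have t1 := tE 1 i1; rewrite /jordan_entry /off_symbol; apply: tameD; first exact: tameN.
  apply: tameM tg _; apply: tameD t1 _; tame_tac.
apply: (diagonalized_solution (Cz := Czeta) (eps := eps) (lm := eigenvalue_of)
  (o := jordan_entry) (b := relaxation) (Qm := dual_basis)
  beta0 Ha h11 Cz0 eps0 (tE 1%N) to).
- exact: relaxation_tame.
- by move=> x ax; apply: relaxation_ge0; exact: le_trans ax.
- move=> j h x j0 hh ax.
  exact: (eig_separation Hth Hw Hst Ha Hzeta Hnu Hsep j0 (range hh) ax).
- exact: Heps.
- exact: eigenbasis_tame.
- exact: dual_basis_tame.
- exact: zeroth_order_tame.
- exact: eigenbasis_inv.
- exact: principal_symbol_eigenbasis.
- by move=> j k; exact: zeroth_order_decay.
- by move=> h x _ ax; apply: zeroth_order44; exact: le_trans ax.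
- by move=> h x _ _; case=> -[|[|[|[|[|j]]]]] //= Hj; rewrite /dual_basis /Q_symbol mxE.
- by move=> h x _ _; case=> -[|[|[|[|[|j]]]]] //= Hj; rewrite /eigenbasis /R_symbol mxE.
Qed.

End ProfileSystem.

(** * The approximate solution *)

Section ComplexVectors.
Variable R : realType.

Lemma vnorm_scale n (l : R[i]) (v : 'cV[R[i]]_n) : vnorm (l *: v) = modc l * vnorm v.
Proof.
rewrite /vnorm (eq_bigr (fun i => modc l ^+ 2 * modc (v i 0) ^+ 2)); last first.
  by move=> i _; rewrite mxE modcM exprMn.
by rewrite -mulr_sumr sqrtrM ?sqr_ge0 // sqrtr_sqr ger0_norm // modc_ge0.
Qed.

Lemma vnorm_bound n (v : 'cV[R[i]]_n) (c : R) : 0 <= c -> (forall i, modc (v i 0) <= c) ->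
  vnorm v <= n%:R * c.
Proof.
move=> c0 H; have nc : 0 <= n%:R * c by rewrite mulr_ge0.
rewrite /vnorm -[leRHS](ger0_norm nc) -sqrtr_sqr ler_wsqrtr //.
have S : \sum_(i < n) modc (v i 0) ^+ 2 <= \sum_(i < n) c ^+ 2.
  by apply: ler_sum => i _; rewrite lerXn2r ?nnegrE ?modc_ge0.
apply: le_trans S _; rewrite sumr_const card_ord -[X in X <= _]mulr_natl exprMn ler_wpM2r ?sqr_ge0 //.
by case: n {v H nc} => [|n]; [rewrite expr0n | rewrite ler_eXnr // ler1n].
Qed.

Lemma modc_mulmx n (M : 'M[R[i]]_n) (v : 'cV[R[i]]_n) (B c : R) i :
  (forall k, modc (M i k) <= B) -> (forall k, modc (v k 0) <= c) ->
  modc ((M *m v) i 0) <= n%:R * (B * c).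
Proof.
move=> HM Hv; rewrite mxE; apply: le_trans (modc_sum _ _ _) _.
have S : \sum_k modc (M i k * v k 0) <= \sum_(k < n) B * c.
  by apply: ler_sum => k _; rewrite modcM; apply: ler_pM; rewrite ?modc_ge0.
by apply: le_trans S _; rewrite sumr_const card_ord mulr_natl.
Qed.

Lemma has_derivative_half_line (f df : R -> R) (a x : R) :
  continuous (fun y : R => f (Num.max a y)) -> continuous (fun y : R => df (Num.max a y)) ->
  (forall y : R, a < y -> is_derive y 1 f (df y)) -> a <= x ->
  has_derivative_within `[a, +oo[ f x (df x).
Proof.
move=> cf cdf D; rewrite le_eqVlt => /orP[/eqP <-|ax].
  by apply: has_derivative_within_endpoint => //; exact: continuous_max_right.
by apply: has_derivative_within_interior => //; exact: D.
Qed.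

Lemma has_derivative_half_lineC n (f df : R -> 'cV[R[i]]_n) (a x : R) :
  (forall i y, continuousC (fun y => f (Num.max a y) i 0) y) ->
  (forall i y, continuousC (fun y => df (Num.max a y) i 0) y) ->
  (forall y : R, a < y -> is_deriveM f y (df y)) -> a <= x ->
  has_derivative_withinC `[a, +oo[ f x (df x).
Proof.
move=> cf cdf D ax i; split.
- apply: (@has_derivative_half_line (fun y => complex.Re (f y i 0)) (fun y => complex.Re (df y i 0))) => //.
  + by move=> y; have [] := cf i y.
  + by move=> y; have [] := cdf i y.
  + by move=> y ay; have [] := D y ay i 0.
- apply: (@has_derivative_half_line (fun y => complex.Im (f y i 0)) (fun y => complex.Im (df y i 0))) => //.
  + by move=> y; have [] := cf i y.
  + by move=> y; have [] := cdf i y.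
  + by move=> y ay; have [] := D y ay i 0.
Qed.

Lemma eq_locally_integrableC (f g : R -> R[i]) : (forall x, 0 <= x -> f x = g x) ->
  (forall x, continuousC g x) -> locally_integrableC f.
Proof.
move=> E cg X X0.
have pos x : x \in (`[0, X]%classic : set R) -> 0 <= x by rewrite inE /= in_itv /= => /andP[].
have H1 := @integrable_segment R (fun x => complex.Re (g x)) 0 X (fun x => (cg x).1).
have H2 := @integrable_segment R (fun x => complex.Im (g x)) 0 X (fun x => (cg x).2).
split; [refine (eq_integrable _ _ _ _ H1)|refine (eq_integrable _ _ _ _ H2)].
- exact: measurable_itv.
- by move=> x /pos x0; rewrite /= E.
- exact: measurable_itv.
- by move=> x /pos x0; rewrite /= E.
Qed.

Lemma eq_intC (f g : R -> R[i]) (x : R) : (forall y, 0 <= y -> f y = g y) -> intC f 0 x = intC g 0 x.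
Proof.
move=> E; have pos y : y \in (`[0, x]%classic : set R) -> 0 <= y by rewrite inE /= in_itv /= => /andP[].
rewrite /intC; congr (_ +i* _); apply: eq_Rintegral => y /pos y0; by rewrite E.
Qed.

End ComplexVectors.

(** * Dependence of [T e_1] on h *)

Section ApproximateEigenvector.
Variables (R : realType) (th : thermo R) (w : profile R) (beta : R).
Hypotheses (Hth : thermodynamics th) (Hw : strong_detonation th w)
  (Hst : standing_assumptions th w beta).
Variables (a cs N h1 : R) (zeta nu : R[i]).
Hypotheses (Ha : 0 <= a) (Hzeta : 0 <= complex.Re zeta) (Hnu : 0 <= complex.Re nu).

Let z (h : R) := zeta + h%:C * nu.

Hypotheses (cs0 : 0 < cs) (h10 : 0 < h1) (h11 : h1 <= 1).
Hypothesis Hs : forall h x, 0 < h < h1 -> a <= x -> cs <= modc (Defs.sfun th w x (z h)).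
Hypothesis Him : complex.Im zeta != 0 -> h1 * `|complex.Im nu| <= `|complex.Im zeta|.

Lemma param_dist h : 0 < h -> modc (z h - zeta) = h * modc nu.
Proof. by move=> hp; rewrite /z addrAC subrr add0r modcM modcR gtr0_norm. Qed.

(** The lower bound is given for h > 0 only. The square of s is polynomial in h; comparing it at 0
    with its value t^2 at some small h, where |t^2 - s^2| <= cs^2 / 2, leaves |s|^2 >= cs^2 / 2. *)
Lemma sfun_limit_bound x : a <= x -> cs / 2 <= modc (Defs.sfun th w x zeta).
Proof.
move=> ax; have x0 := le_trans Ha ax; have g0 := gap_gt0 Hst x0.
pose M := modc nu * (2 * modc zeta + modc nu) + 1.
have n0 := modc_ge0 nu; have m0 := modc_ge0 zeta.
have M0 : 0 < M by rewrite /M; have : 0 <= modc nu * (2 * modc zeta + modc nu) by [rewrite mulr_ge0 //; lra]; lra.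
pose h := Num.min (h1 / 2) (cs ^+ 2 / 2 / M).
have h0 : 0 < h by rewrite lt_min !divr_gt0 ?exprn_gt0.
have hh : 0 < h < h1.
  by have : h <= h1 / 2 by [rewrite ge_min lexx]; rewrite h0 /=; lra.
have hM : h * M <= cs ^+ 2 / 2.
  by rewrite -ler_pdivlMr // ge_min lexx orbT.
have [E _ _ _] := sfun_spec Hzeta g0; have [Eh _ _ _] := sfun_spec (Re_param Hzeta Hnu h0) g0.
have S := Hs hh ax; move: E Eh S.
move: (Defs.sfun th w x (zeta + _)) (Defs.sfun th w x zeta) => t s E Eh S.
have D : modc (t ^+ 2 - s ^+ 2) <= h * M.
  rewrite E Eh (_ : _ - _ = (z h - zeta) * (z h - zeta + (zeta + zeta))); last by rewrite /z; ring.
  rewrite modcM param_dist // -mulrA ler_wpM2l ?(ltW h0) //.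
  apply: (@le_trans _ _ (modc nu * (2 * modc zeta + modc nu))); last by rewrite /M; lra.
  rewrite ler_wpM2l //; apply: le_trans (modcD _ _) _; rewrite param_dist //.
  have := modcD zeta zeta; have : h * modc nu <= modc nu.
    by rewrite ler_piMl //; case/andP: hh => _ /ltW hl; exact: le_trans hl h11.
  lra.
have T : modc (t ^+ 2) <= modc (t ^+ 2 - s ^+ 2) + modc (s ^+ 2).
  by rewrite -{1}[t ^+ 2](subrK (s ^+ 2)) modcD.
have t2 : cs ^+ 2 <= modc (t ^+ 2).
  rewrite [modc _]modcM -[cs ^+ 2]/(cs * cs); apply: ler_pM => //; exact: ltW.
rewrite [modc (s ^+ 2)]modcM in T.
have := modc_ge0 s; nra.
Qed.

Lemma sfun_variation : exists2 L : R, 0 <= L & forall h x, 0 < h < h1 -> a <= x ->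
  modc (Defs.sfun th w x (z h) - Defs.sfun th w x zeta) <= L * h.
Proof.
have [g g0 Hg] := sound_gap_bound Hst.
(* The bounds 1 and g ensure that c^2 is at most the gap, and cs / 2 is the lower bound of |s| at h
   = 0. *)
pose c := Num.min (cs / 2) (Num.min 1 g).
have c0' : 0 < c by rewrite !lt_min g0 ltr01 divr_gt0.
have c1 : c <= cs / 2 by rewrite ge_min lexx.
have c2 : c <= 1 by rewrite !ge_min lexx orbT.
have c3 : c <= g by rewrite !ge_min lexx !orbT.
have n0 := modc_ge0 nu; have m0 := modc_ge0 zeta.
exists (modc nu * (2 * modc zeta + modc nu) / c).
  by rewrite divr_ge0 ?(ltW c0') // mulr_ge0 //; lra.
move=> h x hh ax; have /andP[hp hl] := hh; have x0 := le_trans Ha ax.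
have hle : h <= 1 by exact: le_trans (ltW hl) h11.
have gx := Hg x x0; have gp := gap_gt0 Hst x0.
(* [Him] keeps h |Im nu| below |Im zeta|, so Im z does not change sign. *)
have side : complex.Im zeta != 0 -> 0 <= complex.Im zeta * complex.Im (z h).
  move=> i0; have H := Him i0.
  rewrite /z ImCD ImCM /= mul0r addr0.
  have P : h * `|complex.Im nu| <= `|complex.Im zeta|.
    by apply: le_trans H; rewrite ler_wpM2r // ltW.
  have Q : - (complex.Im zeta * (h * complex.Im nu)) <= complex.Im zeta * complex.Im zeta.
    apply: le_trans (ler_norm _) _; rewrite normrN !normrM (gtr0_norm hp).
    have -> : complex.Im zeta * complex.Im zeta = `|complex.Im zeta| * `|complex.Im zeta|.
      by rewrite -normrM ger0_norm // -expr2 sqr_ge0.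
    by rewrite ler_wpM2l.
  by rewrite mulrDr; lra.
have V := @sfun_lipschitz_param _ th w c zeta (z h) x c0' Hzeta (Re_param Hzeta Hnu hp) gp _
  (le_trans c1 (sfun_limit_bound ax)) side.
rewrite mulrAC ler_pdivlMr // mulrC; apply: le_trans (V _) _.
  rewrite (gap_eq Hst x0) expr2; apply: le_trans gx; nra.
rewrite param_dist // (_ : modc nu * _ * h = h * modc nu * (2 * modc zeta + modc nu)); last by ring.
rewrite ler_wpM2l ?mulr_ge0 ?(ltW hp) //.
have := @modc_param _ zeta nu h; rewrite hp hle => /(_ isT).
by rewrite -/(z h); lra.
Qed.

Lemma Tmx_variation : exists2 L : R, 0 <= L & forall h x i, 0 < h < h1 -> a <= x ->
  (forall i j, modc (eigenbasis th w zeta nu h x i j) <= N) ->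
  modc ((Tmx th w x (z h) *m e1 - Tmx th w x zeta *m e1) i 0) <= L * h.
Proof.
have [L L0 HL] := sfun_variation; have [C1 [C2 [C10 C21 HC]]] := kappa_vel_bounds Hst.
have n0 := modc_ge0 nu.
have N0 : 0 <= `|N| / cs * L by rewrite mulr_ge0 // divr_ge0 // ltW.
exists (`|N| / cs * L + modc nu / C1).
  by rewrite addr_ge0 // divr_ge0 // ltW.
move=> h x i hh ax HN; have /andP[hp hl] := hh; have x0 := le_trans Ha ax.
have [u0 v0 c00 dl0] := profile_neq0 Hth Hw Hst x0.
have S := Hs hh ax; have V := HL h x hh ax; have [_ /andP[ux _]] := HC x x0.
have E (t : R[i]) : (Tmx th w x t *m e1) i 0 = Tmx th w x t i 0.
  by rewrite -colE mxE.
have nuC : 0 <= modc nu / C1 by rewrite divr_ge0 // ltW.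
rewrite [X in modc X](_ : _ = Tmx th w x (z h) i 0 - Tmx th w x zeta i 0); last first.
  have mB (A B : 'cV[R[i]]_5) : (A - B) i 0 = A i 0 - B i 0 by rewrite !mxE.
  by rewrite mB !E.
rewrite !(Tmx_col0 Hth Hw Hst _ (jordan_shift th w zeta nu h x) _ x0).
have := HN i i0; rewrite /eigenbasis (_ : i0 = 0); last exact: val_inj.
move: S V; rewrite -/(z h); move: (Defs.sfun th w x (z h)) (Defs.sfun th w x zeta) => s1 s2 S V.
have s0 : s1 != 0 by rewrite -modc_gt0 (lt_le_trans cs0).
(* An entry A that is a multiple of s varies by A (s1 - s2) / s1; here A is an entry of the
   eigenbasis, bounded by N, and |s1| >= cs. *)
have key (A : R[i]) : modc A <= N -> modc (A * ((s1 - s2) / s1)) <= (`|N| / cs * L + modc nu / C1) * h.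
  move=> AN; rewrite !modcM modcV; apply: (@le_trans _ _ (`|N| / cs * L * h)); last first.
    by rewrite ler_wpM2r ?(ltW hp) // lerDl.
  rewrite -(mulrA _ L) -mulrA; apply: ler_pM => //.
  - exact: modc_ge0.
  - by rewrite mulr_ge0 ?invr_ge0 ?modc_ge0.
  - exact: le_trans AN (ler_norm _).
  - rewrite mulrC; apply: ler_pM; rewrite ?invr_ge0 ?modc_ge0 //.
    by rewrite lef_pV2 ?posrE // (lt_le_trans cs0).
have zero : 0 <= (`|N| / cs * L + modc nu / C1) * h by rewrite mulr_ge0 ?addr_ge0 // ltW.
case: i {HN E} => -[|[|[|[|[|i]]]]] //= Hi; rewrite /R_symbol !mxE /= => AN.
- rewrite [X in modc X](_ : _ = c0C th w x * s1 / (velC w x * volC w x) * ((s1 - s2) / s1)); first exact: key.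
  by field; rewrite ?s0 ?u0 ?v0.
- rewrite -mulrBl modcM param_dist // modcV /velC modcR.
  apply: (@le_trans _ _ (modc nu / C1 * h)); last by rewrite ler_wpM2r ?(ltW hp) // lerDr.
  rewrite mulrC mulrCA mulrC ler_wpM2r ?(ltW hp) // mulrC ler_wpM2l //.
  by have up := vel_gt0 Hst x0; rewrite gtr0_norm // lef_pV2 ?posrE.
- rewrite (_ : _ + _ = 0) ?sqrtr0 //; rewrite subrr; ring.
- rewrite [X in modc X](_ : _ = - (pSC th w x * volC w x ^+ 2 / c0C th w x ^+ 2) *
     (c0C th w x * s1 / (velC w x * volC w x)) * ((s1 - s2) / s1)); first exact: key.
  by field; rewrite ?s0 ?u0 ?v0 ?c00.
- rewrite [X in modc X](_ : _ = - (plC th w x * volC w x ^+ 2 / c0C th w x ^+ 2) *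
     (c0C th w x * s1 / (velC w x * volC w x)) * ((s1 - s2) / s1)); first exact: key.
  by field; rewrite ?s0 ?u0 ?v0 ?c00.
Qed.

End ApproximateEigenvector.

Lemma continuousC_max (R : realType) (f : R -> R[i]) (a : R) :
  (forall x, continuousC f x) -> forall x, continuousC (fun y => f (Num.max a y)) x.
Proof.
move=> cf x; have [c1 c2] := cf (Num.max a x).
have cm : {for x, continuous (fun y => Num.max a y)}.
  by apply: continuous_max; [exact: cst_continuous|exact: cvg_id].
split.
- exact: (continuous_comp (f := fun y => Num.max a y) (g := fun y => complex.Re (f y)) cm c1).
- exact: (continuous_comp (f := fun y => Num.max a y) (g := fun y => complex.Im (f y)) cm c2).
Qed.

(** With t = T(z) e_1 and t0 = T(zeta) e_1, the correction rho regroups so that the remaining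
    difference is the eigenbasis applied to Y minus its two-term expansion. *)
Lemma corrected_difference (K : comNzRingType) n (W h : K) (T : 'M[K]_n) (Y e sg t t0 : 'cV[K]_n) :
  T *m e = t -> W *: (T *m Y) - W *: (t0 + ((t - t0) + h *: (T *m sg))) =
    W *: (T *m (Y - (e + h *: sg))).
Proof.
move=> <-; rewrite -scalerBr; congr (_ *: _).
by rewrite mulmxBr mulmxDr -scalemxAr; congr (_ - _); rewrite addrA addrCA subrr addr0.
Qed.

Section Coefficients.
Variables (R : realType) (th : thermo R) (w : profile R) (beta : R).
Hypotheses (Hth : thermodynamics th) (Hw : strong_detonation th w)
  (Hst : standing_assumptions th w beta).

(** Stated on all of x >= 0 because the exponent is integrated from 0; to the left of a no
    separation is available and s may vanish. *)
Lemma mu1_continuous (z : R[i]) : 0 <= complex.Re z ->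
  forall x, continuousC (fun y => mu th w (Num.max 0 y) z 0) x.
Proof.
move=> z0 x; have pos (y : R) : 0 <= Num.max 0 y by rewrite le_max lexx.
have cu : continuous (fun y : R => vel w (Num.max 0 y)).
  exact: (@rtame_continuous _ beta 0 _ (vel_tame Hth Hw Hst 0)).
have cc : continuous (fun y : R => c0 th (st w (Num.max 0 y))).
  exact: (@rtame_continuous _ beta 0 _ (c0_tame Hth Hw Hst 0)).
have CU t : continuousC (fun y => velC w (Num.max 0 y)) t by apply: continuousC_real; exact: cu.
have CC t : continuousC (fun y => c0C th w (Num.max 0 y)) t by apply: continuousC_real; exact: cc.
have CS := sfun_continuous Hth Hw Hst (lexx 0) z0.
have -> : (fun y => mu th w (Num.max 0 y) z 0) = (fun y =>
    (velC w (Num.max 0 y) * z + c0C th w (Num.max 0 y) * Defs.sfun th w (Num.max 0 y) z) /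
    (velC w (Num.max 0 y) * velC w (Num.max 0 y) - c0C th w (Num.max 0 y) * c0C th w (Num.max 0 y))).
  by apply/funext => y; rewrite (mu_eig Hth Hw Hst).
apply: continuousCM.
  apply: continuousCD; apply: continuousCM => //; exact: continuousC_cst.
apply: continuousCV.
  by have [_ _ _] := profile_neq0 Hth Hw Hst (pos x); rewrite !expr2.
by apply: continuousCD; [|apply: continuousCN]; exact: continuousCM.
Qed.

End Coefficients.

Theorem theorem2p1 (R : realType) (th : thermo R) (w : profile R) (beta : R)
  (Hth : thermodynamics th) (Hw : strong_detonation th w)
  (Hst : standing_assumptions th w beta)
  (a : R) (zeta nu : R[i])
  (Ha : 0 <= a) (Hzeta : 0 <= complex.Re zeta) (Hnu : 0 <= complex.Re nu)
  (Hsep : exists Czeta hzn : R, [/\ 0 < Czeta, 0 < hzn &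
     forall (j : 'I_5) (x h : R), j != 0 -> a <= x -> 0 < h <= hzn ->
       Czeta <= modc (mu th w x (zeta + h%:C * nu) 0
                      - mu th w x (zeta + h%:C * nu) j)]) :
  exists (h0 : R) (mus : R -> R -> R[i]) (rho theta : R -> R -> 'cV[R[i]]_5),
    0 < h0 /\
    [/\ (forall h : R, 0 < h < h0 -> locally_integrableC (mus h)),
        (exists C : R, forall h x : R, 0 < h < h0 -> 0 <= x ->
           modc (mus h x - mu th w x (zeta + h%:C * nu) 0)
             <= C * h * expR (- beta * x)),
        (exists C : R, forall h x : R, 0 < h < h0 -> a <= x ->
           vnorm (rho h x) <= C * h),
        (forall h : R, 0 < h < h0 -> solves_system th w zeta nu h a (theta h)) &
        (forall delta : R, delta < beta ->
           exists C : R, forall h x : R, 0 < h < h0 -> a <= x ->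
             vnorm (theta h x
                    - wkb_factor h (mus h) x
                        *: (Tmx th w x zeta *m e1 + rho h x))
             <= C * h * expR (- delta * x) * modc (wkb_factor h (mus h) x))].
Proof.
have [Cz [hzn [Cz0 hzn0 Hs]]] := Hsep.
have [C1 [C2 [C10 C21 HC]]] := kappa_vel_bounds Hst.
have b0 : 0 < beta by have [_ _ [b0 _] _] := Hst.
(* [hzn] is the range of the separation; C1 / (2 (Re nu + 1)) gives Re (h nu) <= u / 2; the last
   bound keeps Im (zeta + h nu) on the side of Im zeta. The summands 1 avoid division by zero. *)
pose h1 := Num.min (Num.min 1 hzn) (Num.min (C1 / (2 * (complex.Re nu + 1)))
   (if complex.Im zeta == 0 then 1 else `|complex.Im zeta| / (`|complex.Im nu| + 1))).
have nu1 : 0 < complex.Re nu + 1 by rewrite ltr_wpDl.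
have in1 : 0 < `|complex.Im nu| + 1 by rewrite ltr_wpDl.
have h10 : 0 < h1.
  rewrite !lt_min ltr01 hzn0 divr_gt0 ?mulr_gt0 //=.
  by case: eqP => // /eqP i0; rewrite divr_gt0 ?normr_gt0.
have h11 : h1 <= 1 by rewrite !ge_min lexx.
have h1z : h1 <= hzn by rewrite !ge_min lexx orbT.
have h1v : h1 <= C1 / (2 * (complex.Re nu + 1)) by rewrite !ge_min lexx !orbT.
have h1i : complex.Im zeta != 0 -> h1 * `|complex.Im nu| <= `|complex.Im zeta|.
  move=> i0; have : h1 <= `|complex.Im zeta| / (`|complex.Im nu| + 1).
    by rewrite /h1 (negbTE i0) !ge_min lexx !orbT.
  rewrite ler_pdivlMr // => H; apply: le_trans H; rewrite ler_wpM2l ?(ltW h10) //.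
  by rewrite lerDl.
have Hvel (x : R) : 0 <= x -> 2 * (h1 * complex.Re nu) <= vel w x.
  move=> /HC[_ /andP[u1 _]]; apply: le_trans u1; move: h1v.
  by rewrite ler_pdivlMr ?mulr_gt0 //; have := h10; lra.
have Hs1 (j : 'I_5) (x h : R) : j != 0 -> a <= x -> 0 < h <= h1 ->
    Cz <= modc (mu th w x (zeta + h%:C * nu) 0 - mu th w x (zeta + h%:C * nu) j).
  by move=> j0 ax /andP[hp hl]; apply: Hs => //; rewrite hp (le_trans hl).
have [gam [sg [B [K [dgam cgam bsg K0 HY]]]]] :=
  profile_solution Hth Hw Hst Ha Hzeta Hnu Cz0 h11 Hs1 Hvel.
have tR := eigenbasis_tame Hth Hw Hst Ha Hzeta Hnu Cz0 h11 Hs1 Hvel.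
have tM := zeroth_order_tame Hth Hw Hst Ha h11.
have tP n : mtame beta h1 a n (principal_symbol th w zeta nu).
  by exact: (principal_symbol_tame Hth Hw Hst zeta nu Ha h11).
have [N N0 HN] : exists2 N : R, 0 <= N & forall h x i j, 0 < h < h1 -> a <= x ->
    modc (eigenbasis th w zeta nu h x i j) <= N.
  have [N N0 H] := bounded_uniform (F := fun ij : 'I_5 * 'I_5 => fun h x =>
    eigenbasis th w zeta nu h x ij.1 ij.2) (fun ij => tame_bounded (tR 0%N ij.1 ij.2)).
  by exists N => // h x i j hh ax; exact: (H (i, j)).
have [cs cs0 Hcs] := symbol_lower_bounds Hth Hw Hst Ha Hzeta Hnu Cz0 Hs1.
have Hcs1 h (x : R) : 0 < h < h1 -> a <= x -> cs <= modc (Defs.sfun th w x (zeta + h%:C * nu)).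
  by move=> /andP[hp hl] ax; have [] := Hcs h x _ ax; rewrite // hp ltW.
have [L L0 HL] := Tmx_variation Hth Hw Hst N Ha Hzeta Hnu cs0 h10 h11 Hcs1 h1i.
have zre h : 0 < h -> 0 <= complex.Re (zeta + h%:C * nu) by exact: Re_param.
pose mus h x := mu th w x (zeta + h%:C * nu) 0 + h%:C * gam h (Num.max a x).
(* Agrees with [mus] for x >= 0 and is continuous on the whole line, as the antiderivative
   requires. *)
pose ext h x := mu th w (Num.max 0 x) (zeta + h%:C * nu) 0 + h%:C * gam h (Num.max a x).
have mus_ext h x : 0 <= x -> mus h x = ext h x by move=> x0; rewrite /mus /ext (max_r x0).
have cext h : 0 < h < h1 -> forall x, continuousC (ext h) x.
  move=> hh x; have /andP[hp _] := hh; apply: continuousCD.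
    by apply: (mu1_continuous Hth Hw Hst); exact: zre.
  by apply: continuousCM; [exact: continuousC_cst|exact: cgam].
have /choice[Y0 HY0] : forall h, exists Y : R -> 'cV[R[i]]_5, 0 < h < h1 ->
   [/\ forall i x, continuousC (fun y => Y y i 0) x,
          forall (E : R -> R[i]) x, a < x ->
            is_deriveC E x ((h%:C^-1 * eigenvalue_of th w zeta nu i0 h x + gam h x) * E x) ->
            is_deriveM (fun y => E y *: (eigenbasis th w zeta nu h y *m Y y)) x
              (h%:C^-1 *: ((principal_symbol th w zeta nu h x + h%:C *: zeroth_order th w x) *m
                 (E x *: (eigenbasis th w zeta nu h x *m Y x)))) &
          forall x i, a <= x -> modc (Y x i 0 - (e1 i 0 + h%:C * sg h x i 0))
            <= K * h * expR (- beta * x)].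
  move=> h; have [hh|hh] := boolP (0 < h < h1); last by exists (fun=> 0).
  by have [Y HYh] := HY h hh; exists Y.
pose T h x := eigenbasis th w zeta nu h x.
(* Two errors of size h that need not decay: the passage from T(zeta + h nu) e_1 to T(zeta) e_1, and
   the first-order corrector. *)
pose rho h x := (Tmx th w x (zeta + h%:C * nu) *m e1 - Tmx th w x zeta *m e1) +
  h%:C *: (T h x *m sg h x).
pose theta h x := wkb_factor h (mus h) x *: (T h x *m Y0 h x).
exists h1, mus, rho, theta; split => //; split.
- move=> h hh; exact: (eq_locally_integrableC (mus_ext h) (cext h hh)).
- have [G G0 HG] := dgam; exists G => h x hh x0; have /andP[hp _] := hh.
  rewrite /mus addrAC subrr add0r modcM modcR gtr0_norm // mulrAC mulrC ler_wpM2r ?(ltW hp) //.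
  have am : a <= Num.max a x by rewrite le_max lexx.
  apply: le_trans (HG h _ hh am) _; rewrite ler_wpM2l // ler_expR !mulNr lerN2.
  by rewrite ler_wpM2l ?(ltW b0) // le_max lexx orbT.
- exists (5%:R * (L + 5%:R * (N * `|B|))) => h x hh ax; have /andP[hp _] := hh.
  rewrite -mulrA; apply: vnorm_bound.
    by rewrite mulr_ge0 ?(ltW hp) // addr_ge0 // !mulr_ge0.
  move=> i; rewrite /rho mxE mulrDl; apply: le_trans (modcD _ _) _; apply: lerD.
    by apply: HL => // k l; exact: HN.
  rewrite mxE modcM modcR gtr0_norm // mulrC ler_wpM2r ?(ltW hp) //.
  apply: modc_mulmx => k; first exact: HN.
  exact: le_trans (bsg h x k hh ax) (ler_norm _).
- move=> h hh x ax; have /andP[hp _] := hh; have [cY dY bY] := HY0 h hh.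
  have [F [dF iF]] := antiderivativeC (cext h hh).
  pose E y := expC ((h^-1)%:C * F y).
  have wkbE y : 0 <= y -> wkb_factor h (mus h) y = E y.
    move=> y0; rewrite /wkb_factor /E (eq_intC _ (g := ext h)); last exact: mus_ext.
    by rewrite iF.
  have hn : h%:C != 0 :> R[i] by apply: real_neq0; rewrite gt_eqF.
  have dE y : is_deriveC E y ((h%:C^-1 * ext h y) * E y).
    have := is_deriveC_exp (is_deriveCM (is_deriveC_cst (h^-1)%:C y) (dF y)).
    by rewrite mul0r add0r (_ : (h%:C)^-1 = (h^-1)%:C) // fmorphV.
  have pos y : a <= y -> 0 <= y by exact: le_trans.
  have mp y : a <= Num.max a y by rewrite le_max lexx.
  pose theta' y := (h^-1)%:C *: ((Phi0 th w y zeta + h%:C *: Phi1 th w y nu) *m theta h y).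
  have symE y : 0 <= y -> theta' y = h%:C^-1 *:
      ((principal_symbol th w zeta nu h y + h%:C *: zeroth_order th w y) *m theta h y).
    by move=> y0; rewrite /theta' (system_symbol Hth Hw Hst zeta nu h y0) fmorphV.
  have cE y : continuousC (fun t => E (Num.max a t)) y.
    by apply: continuousC_max => t; exact: is_deriveC_continuous (dE t).
  have cT i j y : continuousC (fun t => T h (Num.max a t) i j) y.
    exact: (tame_continuous (tR 0%N i j) hh).
  have cYm i y : continuousC (fun t => Y0 h (Num.max a t) i 0) y.
    exact: (continuousC_max a (cY i)).
  have cth i y : continuousC (fun t => theta h (Num.max a t) i 0) y.
    have -> : (fun t => theta h (Num.max a t) i 0) = (fun t => E (Num.max a t) *
        \sum_k T h (Num.max a t) i k * Y0 h (Num.max a t) k 0).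
      by apply/funext => t; rewrite /theta mxE mxE wkbE // pos.
    apply: continuousCM => //; apply: continuousC_sum => k; exact: continuousCM.
  (* The equation is established for y > a; continuity of both sides up to a gives the one-sided
     derivative there. *)
  apply: (@has_derivative_half_lineC _ _ (theta h) theta' a x cth _ _ ax).
  + move=> i y; rewrite (_ : (fun t => _) = (fun t => h%:C^-1 *
        \sum_k (principal_symbol th w zeta nu h (Num.max a t) i k +
           h%:C * zeroth_order th w (Num.max a t) i k) * theta h (Num.max a t) k 0)); last first.
      apply/funext => t; rewrite symE ?pos // [LHS]mxE [in LHS]mxE; congr (_ * _).
      by apply: eq_bigr => k _; rewrite [in LHS]mxE [X in _ + X]mxE.
    apply: continuousCM; first exact: continuousC_cst.
    apply: continuousC_sum => k; apply: continuousCM => //; apply: continuousCD.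
      exact: (tame_continuous (tP 0%N i k) hh).
    apply: continuousCM; first exact: continuousC_cst.
    exact: (tame_continuous (tM 0%N i k) hh).
  + move=> y ay; have y0 := pos y (ltW ay); have my : Num.max a y = y by apply/max_idPr; exact: ltW.
    have dE' : is_deriveC E y ((h%:C^-1 * eigenvalue_of th w zeta nu i0 h y + gam h y) * E y).
      have := dE y; rewrite /ext my (max_r y0) (mu_eig Hth Hw Hst) // mulrDr mulKf //.
    move=> i j; have D := dY E y ay dE' i j.
    rewrite (symE y y0) {2}/theta (wkbE y y0); apply: is_deriveC_near D; near=> t.
    have t0 : 0 <= t by apply: ltW; near: t; apply: lt_nbhsr; exact: le_lt_trans Ha ay.
    by rewrite /theta (wkbE t t0).
(* The remaining error is bounded with the rate beta itself, so the constant does not depend on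
   delta. *)
- move=> delta db; exists (5%:R * (5%:R * (N * K))) => h x hh ax; have /andP[hp _] := hh.
  have [cY dY bY] := HY0 h hh; have x0 := le_trans Ha ax.
  have -> : theta h x - wkb_factor h (mus h) x *: (Tmx th w x zeta *m e1 + rho h x) =
      wkb_factor h (mus h) x *: (T h x *m (Y0 h x - (e1 + h%:C *: sg h x))).
    apply: corrected_difference; apply/colP => i; rewrite -!colE [LHS]mxE [RHS]mxE.
    exact: esym (Tmx_col0 Hth Hw Hst _ (jordan_shift th w zeta nu h x) _ x0).
  rewrite vnorm_scale mulrC ler_wpM2r ?modc_ge0 //.
  have -> : 5%:R * (5%:R * (N * K)) * h * expR (- delta * x) =
      5%:R * (5%:R * (N * (K * h * expR (- delta * x)))) by ring.
  have kh : 0 <= K * h * expR (- delta * x) by rewrite !mulr_ge0 ?expR_ge0 // ltW.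
  apply: vnorm_bound; first by apply: mulr_ge0 => //; exact: mulr_ge0.
  move=> i; apply: modc_mulmx => k; first exact: HN.
  have cE (A B' C : 'cV[R[i]]_5) (l : R[i]) :
    (A - (B' + l *: C)) k 0 = A k 0 - (B' k 0 + l * C k 0) by rewrite !mxE.
  rewrite cE; apply: le_trans (bY x k ax) _; rewrite ler_wpM2l ?mulr_ge0 ?(ltW hp) // ler_expR !mulNr lerN2.
  by rewrite ler_wpM2r // ltW.
Unshelve. all: by end_near.
Qed.
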